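(* Assume hypotheses (A1)–(A9) listed in the context hold. For $\epsilon>0$ let $(u^\epsilon,m^\epsilon)$ be a solution of the regularized system described in the context. Let $\theta>1$, $0\le\upsilon\le 1$, $\beta_0\in\left[1,\frac{d(1+\mu)}{d(1+\mu)-2}\right)$, and set \[ \beta_{\upsilon,\theta}=\frac{\theta\beta_0}{\theta+\upsilon-\theta\upsilon},\qquad r=\frac{d(\theta-1)+2}{2},\qquad p=\frac{\beta_{\upsilon,\theta}}{\alpha}. \] Suppose $p>1$. Then \[ \|g_\epsilon(m^\epsilon)\|_{L^\infty(0,T;L^p(\mathbb{T}^d))}\le C+C\|Du^\epsilon\|_{L^\infty(0,T;L^\infty(\mathbb{T}^d))}^{\frac{(2+2\mu)r\upsilon\alpha}{\theta\beta_0}}, \] where $C$ is independent of $\epsilon$.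
   Context: $\mathbb{T}^d$ is the $d$-dimensional flat torus, $T>0$ fixed. Data: $H:\mathbb{T}^d\times\mathbb{R}^d\to\mathbb{R}$, $g:[0,\infty)\to\mathbb{R}$, $u_T,m_0:\mathbb{T}^d\to\mathbb{R}$. Hypotheses: (A1) $H$ is $C^\infty$; $p\mapsto H(x,p)$ strictly convex; $\lim_{|p|\to\infty}H(x,p)/|p|=+\infty$; $H\ge1$. (A2) $g$ non-negative and increasing; $u_T,m_0\in C^\infty(\mathbb{T}^d)$, $m_0\ge0$, $\int m_0=1$. (A3) With $\hat L(x,p)=D_pH(x,p)\cdot p-H(x,p)$, there are $c,C>0$ with $\hat L\ge cH-C$. (A4) $g(z)=z^\alpha$, $\alpha>0$. (A5) $|D_xH|,|D^2_{xx}H|\le CH+C$, and for every symmetric matrix $M$ and $\delta>0$ there is $C_\delta$ with $\operatorname{tr}(D^2_{px}H M)\le\delta\operatorname{tr}(D^2_{pp}HM^2)+C_\delta H$. (A6) $m_0\ge\kappa_0>0$ for a constant $\kappa_0$. (A7) For some $0<\mu<1$ and non-negative constants: $c_1|p|^{2+\mu}+C_1\le H\le c_2|p|^{2+\mu}+C_2$. (A8) $|D_pH(x,p)|^2\le C|p|^\mu H(x,p)+C$. (A9) $|D^2_{xp}H|^2\le CH^{\frac{2+2\mu}{2+\mu}}$ and, for every symmetric $M$, $|D^2_{pp}HM|^2\le CH^{\frac{\mu}{2+\mu}}\operatorname{tr}(D^2_{pp}HMM)$. Regularized system: $\eta_\epsilon$ is a standard symmetric mollifying kernel on $\mathbb{T}^d$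 and $g_\epsilon(m)=\eta_\epsilon*g(\eta_\epsilon*m)$. A solution is a pair of smooth functions $u^\epsilon,m^\epsilon$ on $\mathbb{T}^d\times[0,T]$ with $-u^\epsilon_t+H(x,Du^\epsilon)=\Delta u^\epsilon+g_\epsilon(m^\epsilon)$, $m^\epsilon_t-\operatorname{div}(D_pH(x,Du^\epsilon)m^\epsilon)=\Delta m^\epsilon$, $u^\epsilon(x,T)=u_T(x)$, $m^\epsilon(x,0)=m_0(x)$. *)

(* Defs.v *)
From Stdlib Require Import Reals.
From Coquelicot Require Import Coquelicot.
From mathcomp Require Import ssreflect ssrbool eqtype ssrnat seq fintype bigop.
Set Implicit Arguments.
Unset Strict Implicit.
Local Open Scope R_scope.

(* Points of R^d, represented as functions 'I_d -> R.  Functions on the torus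
   T^d are Z^d-periodic functions on R^d (see [periodic]). *)
Definition pt (d : nat) := 'I_d -> R.

Definition upd {n : nat} (z : 'I_n -> R) (i : 'I_n) (r : R) : 'I_n -> R :=
  fun j => if j == i then r else z j.
Definition updn {n : nat} (z : 'I_n -> R) (k : nat) (r : R) : 'I_n -> R :=
  fun j => if nat_of_ord j == k then r else z j.

Definition sumI (n : nat) (f : 'I_n -> R) : R := \big[Rplus/0%R]_(i < n) f i.
Definition vnorm {n : nat} (v : 'I_n -> R) : R := sqrt (sumI (fun i => v i * v i)).
Definition mat (n : nat) := 'I_n -> 'I_n -> R.
Definition mnorm {n : nat} (A : mat n) : R :=
  sqrt (sumI (fun i => sumI (fun j => A i j * A i j))).
Definition mmul {n : nat} (A B : mat n) : mat n :=
  fun i j => sumI (fun k => A i k * B k j).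
Definition mtr {n : nat} (A : mat n) : R := sumI (fun i => A i i).
Definition msym {n : nat} (A : mat n) : Prop := forall i j, A i j = A j i.

Definition powr (x a : R) : R :=
  if Rlt_dec 0 x then Rpower x a else if Req_EM_T a 0 then 1 else 0.

Definition pd {n : nat} (i : 'I_n) (F : ('I_n -> R) -> R) : ('I_n -> R) -> R :=
  fun z => Derive (fun r => F (upd z i r)) (z i).
Fixpoint iterD {n : nat} (s : seq 'I_n) (F : ('I_n -> R) -> R) : ('I_n -> R) -> R :=
  match s with
  | nil => F
  | i :: s' => pd i (iterD s' F)
  end.

Definition cont_within {n : nat} (K : ('I_n -> R) -> Prop) (G : ('I_n -> R) -> R)
  (z : 'I_n -> R) : Prop :=
  forall eps, 0 < eps -> exists delta, 0 < delta /\
    forall w, K w -> (forall i, Rabs (w i - z i) < delta) -> Rabs (G w - G z) < eps.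

(* C^infinity(closure of O), K = closure of O: all iterated partial derivatives
   exist on the open set O and extend continuously to K; F is continuous on K. *)
Definition smooth_on {n : nat} (O K : ('I_n -> R) -> Prop) (F : ('I_n -> R) -> R) : Prop :=
  (forall z, K z -> cont_within K F z) /\
  forall s : seq 'I_n,
    (forall z, O z -> forall i, ex_derive (fun r => iterD s F (upd z i r)) (z i)) /\
    exists G : ('I_n -> R) -> R,
      (forall z, O z -> G z = iterD s F z) /\ (forall z, K z -> cont_within K G z).

Definition smooth {n : nat} (F : ('I_n -> R) -> R) : Prop :=
  smooth_on (fun _ => True) (fun _ => True) F.

Definition periodic {d : nat} (f : pt d -> R) : Prop :=
  forall x i, f (upd x i (x i + 1)) = f x.

Definition Hjoint {d : nat} (H : pt d -> pt d -> R) : ('I_(d + d) -> R) -> R :=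
  fun z => H (fun i => z (lshift d i)) (fun i => z (rshift d i)).
Definition dHx {d : nat} (i : 'I_d) (H : pt d -> pt d -> R) : pt d -> pt d -> R :=
  fun x p => Derive (fun r => H (upd x i r) p) (x i).
Definition dHp {d : nat} (i : 'I_d) (H : pt d -> pt d -> R) : pt d -> pt d -> R :=
  fun x p => Derive (fun r => H x (upd p i r)) (p i).

Fixpoint itint {n : nat} (k : nat) (a b : R) (f : ('I_n -> R) -> R) (z : 'I_n -> R) : R :=
  match k with
  | O => f z
  | S k' => RInt (fun r => itint k' a b f (updn z k' r)) a b
  end.
Definition boxint {n : nat} (a b : R) (f : ('I_n -> R) -> R) : R :=
  itint n a b f (fun _ => 0).
Definition torint {d : nat} (f : pt d -> R) : R := boxint 0 1 f.

Definition Lpnorm {d : nat} (q : R) (f : pt d -> R) : R :=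
  powr (torint (fun x => powr (Rabs (f x)) q)) (/ q).

(* a standard symmetric mollifying kernel eta (support in the closed unit ball);
   eta_eps(x) = eps^{-d} eta(x/eps) *)
Definition is_mollifier {d : nat} (eta : pt d -> R) : Prop :=
  smooth eta /\ (forall w, 0 <= eta w) /\ (forall w, 1 <= vnorm w -> eta w = 0) /\
  boxint (-1) 1 eta = 1 /\ (forall w, eta (fun i => - w i) = eta w).

(* (eta_eps * f)(x) = int eta_eps(x-y) f(y) dy = int_{[-1,1]^d} eta(w) f(x - eps w) dw *)
Definition conv {d : nat} (eta : pt d -> R) (eps : R) (f : pt d -> R) (x : pt d) : R :=
  boxint (-1) 1 (fun w => eta w * f (fun i => x i - eps * w i)).

Definition gfun (alpha z : R) : R := if Rlt_dec 0 z then Rpower z alpha else 0.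

Definition geps {d : nat} (eta : pt d -> R) (eps alpha : R) (m : pt d -> R -> R)
  (x : pt d) (t : R) : R :=
  conv eta eps (fun y => gfun alpha (conv eta eps (fun z => m z t) y)) x.

Definition tjoint {d : nat} (u : pt d -> R -> R) : ('I_(d + 1) -> R) -> R :=
  fun z => u (fun i => z (lshift 1 i)) (z (rshift d ord0)).
Definition smooth_slab {d : nat} (T : R) (u : pt d -> R -> R) : Prop :=
  smooth_on (fun z => 0 < z (rshift d ord0) < T)
            (fun z => 0 <= z (rshift d ord0) <= T) (tjoint u).
Definition periodic_t {d : nat} (u : pt d -> R -> R) : Prop :=
  forall t, periodic (fun x => u x t).

Definition Dt {d : nat} (u : pt d -> R -> R) : pt d -> R -> R :=
  fun x t => Derive (fun s => u x s) t.
Definition Dxu {d : nat} (i : 'I_d) (u : pt d -> R -> R) : pt d -> R -> R :=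
  fun x t => Derive (fun r => u (upd x i r) t) (x i).
Definition grad {d : nat} (u : pt d -> R -> R) (x : pt d) (t : R) : pt d :=
  fun i => Dxu i u x t.
Definition lap {d : nat} (u : pt d -> R -> R) (x : pt d) (t : R) : R :=
  sumI (fun i => Dxu i (Dxu i u) x t).

Definition is_solution {d : nat} (T : R) (H : pt d -> pt d -> R) (uT m0 : pt d -> R)
  (alpha : R) (eta : pt d -> R) (eps : R) (u m : pt d -> R -> R) : Prop :=
  smooth_slab T u /\ periodic_t u /\ smooth_slab T m /\ periodic_t m /\
  (forall x t, 0 < t < T ->
     - Dt u x t + H x (grad u x t) = lap u x t + geps eta eps alpha m x t) /\
  (forall x t, 0 < t < T ->
     Dt m x t - sumI (fun i => Dxu i (fun y s => dHp i H y (grad u y s) * m y s) x t)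
     = lap m x t) /\
  (forall x, u x T = uT x) /\ (forall x, m x 0 = m0 x).

Definition supR (E : R -> Prop) : R := real (Lub_Rbar E).
Definition LinfLp {d : nat} (T q : R) (f : pt d -> R -> R) : R :=
  supR (fun r => exists t, 0 < t < T /\ r = Lpnorm q (fun x => f x t)).
Definition LinfLinf_grad {d : nat} (T : R) (u : pt d -> R -> R) : R :=
  supR (fun r => exists x t, 0 < t < T /\ r = vnorm (grad u x t)).

(* Main.v *)
(* Pairing the equation of u with m and with m0 and subtracting cancels the
   unknown u(., 0); with (A3) this bounds the integrals of H m, H and g.  Pairing
   the equation of Delta u with m, where (A5) absorbs the mixed derivatives and
   the mollified coupling has a favourable sign, bounds the integral of A m,
   where A = tr (D_pp H (D^2 u)^2).

   By (A9), |div D_pH| <= C (A + H)^((1 + mu) / (2 + mu)).  Inserted in the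
   energy identity for m^beta0, Hoelder's inequality against those two bounds
   and a subcritical Sobolev inequality give, for R bounding the integral of
   m^beta0 at all times, an inequality R <= C + C R^e; here e < 1 because of the
   range of beta0, so m is bounded in L^infty(0, T; L^beta0).

   For y the integral of m^(theta beta0), the same identity with the drift not
   integrated by parts gives y' <= c y (|D_pH|_infty^2 + C - c' y^(1/r)), and
   |D_pH|^2 <= C + C |Du|^(2 + 2 mu) by (A7) and (A8).  Interpolating L^beta
   between L^beta0 and L^(theta beta0), with Jensen's inequality for the
   mollifications, gives the estimate. *)

From HB Require Import structures.
From Stdlib Require Import Reals Lra Lia FunctionalExtensionality ClassicalEpsilon.
From Coquelicot Require Import Coquelicot.
From mathcomp Require Import ssreflect ssrfun ssrbool eqtype ssrnat seq choice fintype bigop.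
Require Import Defs.
Set Implicit Arguments.
Unset Strict Implicit.
Local Open Scope R_scope.

(** * Finite sums, norms and real powers *)

(** The constants must not depend on [eps], so the kernel enters the estimates only through its
    sign, its mass and its evenness. What may degenerate with [eps], such as the positive lower
    bound of [m] or the bounds on derivatives, is used only qualitatively: to differentiate real
    powers of [m], to integrate up to the end times, to make suprema finite. Derivatives are
    controlled only for [0 < t < T]; at the end times only [u] and [m] themselves are continuous.
    Hence balance laws are read on continuous representatives, and the Laplacian of [u] at the ends
    is moved onto the data. A Sobolev inequality strictly below the critical exponent is enough: the
    range of [beta0] is open, and [2 * r = d * (theta - 1) + 2] exceeds by 2 the value at which the
    critical exponent would be required. Averaging over cubes proves such an inequality. The range
    of [beta0] also forces [2 <= d], and the nonnegativity of [A] is read off (A5). *)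

HB.instance Definition _ := Monoid.isComLaw.Build R 0 Rplus
  (fun x y z => esym (Rplus_assoc x y z)) Rplus_comm Rplus_0_l.

Lemma sumI_ext n (f g : 'I_n -> R) : (forall i, f i = g i) -> sumI f = sumI g.
Proof. by move=> h; apply: eq_bigr => i _. Qed.

Lemma sumI_plus n (f g : 'I_n -> R) : sumI (fun i => f i + g i) = sumI f + sumI g.
Proof. exact: big_split. Qed.

Lemma sumI_scal n c (f : 'I_n -> R) : sumI (fun i => c * f i) = c * sumI f.
Proof.
apply: (big_ind2 (fun x y => x = c * y)) => [|x1 x2 y1 y2 -> ->|//]; ring.
Qed.

Lemma sumI_opp n (f : 'I_n -> R) : sumI (fun i => - f i) = - sumI f.
Proof.
rewrite (_ : - sumI f = (-1) * sumI f); last ring.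
rewrite -sumI_scal; apply: sumI_ext => i; ring.
Qed.

Lemma sumI_minus n (f g : 'I_n -> R) : sumI (fun i => f i - g i) = sumI f - sumI g.
Proof. by rewrite /Rminus -sumI_opp -sumI_plus. Qed.

Lemma sumI_0 n : sumI (fun _ : 'I_n => 0) = 0.
Proof. by rewrite /sumI big1. Qed.

Lemma sumI_le n (f g : 'I_n -> R) : (forall i, f i <= g i) -> sumI f <= sumI g.
Proof.
move=> h; apply: (big_ind2 (fun x y => x <= y)) => [|x1 x2 y1 y2 h1 h2|i _].
- lra.
- lra.
- exact: h.
Qed.

Lemma sumI_ge0 n (f : 'I_n -> R) : (forall i, 0 <= f i) -> 0 <= sumI f.
Proof. move=> h; rewrite -(sumI_0 n); exact: sumI_le. Qed.

Lemma sumI_ge_term n (f : 'I_n -> R) i : (forall i, 0 <= f i) -> f i <= sumI f.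
Proof.
move=> h; rewrite /sumI (bigD1 i) //=.
have : 0 <= \big[Rplus/0]_(j < n | j != i) f j.
  apply: (big_ind (fun x => 0 <= x)) => [|x y hx hy|j _]; [lra|lra|exact: h].
by move=> h0; rewrite -[X in X <= _]Rplus_0_r; apply: Rplus_le_compat_l.
Qed.

Lemma sumI_swap n m (f : 'I_n -> 'I_m -> R) :
  sumI (fun i => sumI (f i)) = sumI (fun j => sumI (fun i => f i j)).
Proof. exact: exchange_big. Qed.

Lemma sumI_delta n (f : 'I_n -> R) k : sumI (fun i => if i == k then f i else 0) = f k.
Proof. by rewrite /sumI -big_mkcond big_pred1_eq. Qed.

Lemma sumI_split m n (f : 'I_(m + n) -> R) :
  sumI f = sumI (fun i => f (lshift n i)) + sumI (fun i => f (rshift m i)).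
Proof. exact: big_split_ord. Qed.

Lemma sumI_Rabs n (f : 'I_n -> R) : Rabs (sumI f) <= sumI (fun i => Rabs (f i)).
Proof.
apply: (big_ind2 (fun x y => Rabs x <= y)) => [|x1 x2 y1 y2 h1 h2|i _].
- rewrite Rabs_R0; lra.
- apply: Rle_trans (Rabs_triang _ _) _; lra.
- lra.
Qed.

Lemma sumI_const n c : sumI (fun _ : 'I_n => c) = INR n * c.
Proof.
rewrite /sumI big_const_ord; elim: n => [|n IH] /=.
  ring.
by rewrite IH; case: n {IH} => [|n] /=; ring.
Qed.

Lemma vnorm_ge0 n (v : 'I_n -> R) : 0 <= vnorm v.
Proof. exact: sqrt_pos. Qed.

Lemma vnorm_sqr n (v : 'I_n -> R) : vnorm v * vnorm v = sumI (fun i => v i * v i).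
Proof. apply: sqrt_sqrt; apply: sumI_ge0 => i; nra. Qed.

Lemma vnorm_coord n (v : 'I_n -> R) i : Rabs (v i) <= vnorm v.
Proof.
rewrite -(sqrt_Rsqr_abs (v i)); apply: sqrt_le_1_alt; rewrite /Rsqr.
apply: (@sumI_ge_term n (fun i => v i * v i)) => j; nra.
Qed.

Lemma mnorm_entry n (A : mat n) i j : Rabs (A i j) <= mnorm A.
Proof.
rewrite -(sqrt_Rsqr_abs (A i j)); apply: sqrt_le_1_alt; rewrite /Rsqr.
apply: Rle_trans (@sumI_ge_term n (fun i => sumI (fun j => A i j * A i j)) i _).
  by apply: (@sumI_ge_term n (fun j => A i j * A i j)) => k; nra.
move=> k; apply: sumI_ge0 => l; nra.
Qed.

Lemma mtr_mnorm n (A : mat n) : Rabs (mtr A) <= INR n * mnorm A.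
Proof.
apply: Rle_trans (sumI_Rabs _) _; rewrite -sumI_const.
apply: sumI_le => i; exact: mnorm_entry.
Qed.

Lemma powr_Rpower x a : 0 < x -> powr x a = Rpower x a.
Proof. by rewrite /powr; case: Rlt_dec. Qed.

Lemma powr_gt0 x a : 0 < x -> 0 < powr x a.
Proof. move=> h; rewrite powr_Rpower //; exact: exp_pos. Qed.

Lemma powr_ge0 x a : 0 <= powr x a.
Proof.
rewrite /powr; case: Rlt_dec => h /=; first by apply: Rlt_le; exact: exp_pos.
case: Req_EM_T => ? /=; lra.
Qed.

Lemma powr_npos x a : a <> 0 -> x <= 0 -> powr x a = 0.
Proof.
move=> h h2; rewrite /powr; case: Rlt_dec => h3 /=; first lra.
by case: Req_EM_T.
Qed.

Lemma powr_neg x a : 0 < a -> x <= 0 -> powr x a = 0.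
Proof. move=> h; apply: powr_npos; exact: Rgt_not_eq. Qed.

Lemma powr_exp0 x : powr x 0 = 1.
Proof.
rewrite /powr; case: Rlt_dec => h; first exact: Rpower_O.
by case: Req_EM_T.
Qed.

Lemma powr_base1 a : powr 1 a = 1.
Proof. rewrite powr_Rpower; [|lra]; by rewrite /Rpower ln_1 Rmult_0_r exp_0. Qed.

Lemma powr_1 x : 0 <= x -> powr x 1 = x.
Proof.
case=> h; first by rewrite powr_Rpower // Rpower_1.
by rewrite -h powr_neg; lra.
Qed.

Lemma powr_mult x y a : 0 <= x -> 0 <= y -> powr (x * y) a = powr x a * powr y a.
Proof.
move=> hx hy; case: (Req_dec a 0) => [->|ha]; first by rewrite !powr_exp0; ring.
case: hx => hx; last by rewrite -hx Rmult_0_l powr_npos //; lra.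
case: hy => hy; last by rewrite -hy Rmult_0_r powr_npos //; lra.
by rewrite !powr_Rpower ?Rpower_mult_distr //; apply: Rmult_lt_0_compat.
Qed.

Lemma powr_powr x a b : 0 <= x -> powr (powr x a) b = powr x (a * b).
Proof.
case=> h.
  by rewrite (powr_Rpower a h) powr_Rpower ?Rpower_mult ?powr_Rpower //; exact: exp_pos.
rewrite -h; case: (Req_dec a 0) => [->|ha]; first by rewrite Rmult_0_l !powr_exp0 powr_base1.
case: (Req_dec b 0) => [->|hb]; first by rewrite Rmult_0_r !powr_exp0.
rewrite (@powr_npos 0 a) //; last lra.
by rewrite !powr_npos //; first exact: Rmult_integral_contrapositive_currified; lra.
Qed.

Lemma powr_plus x a b : 0 < x -> powr x (a + b) = powr x a * powr x b.
Proof. by move=> h; rewrite !powr_Rpower // Rpower_plus. Qed.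

Lemma powr_plus0 x a b : 0 < a -> 0 < b -> powr x (a + b) = powr x a * powr x b.
Proof.
move=> ha hb; case: (Rlt_dec 0 x) => h; first exact: powr_plus.
rewrite !powr_neg; lra.
Qed.

Lemma powr_le x y a : 0 <= a -> x <= y -> powr x a <= powr y a.
Proof.
case=> [ha|<-] h; last by rewrite !powr_exp0; lra.
case: (Rlt_dec 0 x) => hx.
  rewrite !powr_Rpower; try lra; apply: Rle_Rpower_l; lra.
rewrite (@powr_neg x) //; try lra; exact: powr_ge0.
Qed.

Lemma powr_lt x y a : 0 < a -> 0 <= x < y -> powr x a < powr y a.
Proof.
move=> ha [hx h]; rewrite (@powr_Rpower y); last lra.
case: hx => hx; first by rewrite powr_Rpower //; apply: Rlt_Rpower_l; lra.
rewrite -hx powr_neg; [exact: exp_pos|lra|lra].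
Qed.

Lemma powr_2 x : 0 <= x -> powr x 2 = x * x.
Proof.
move=> h; rewrite (_ : 2 = 1 + 1); last ring.
by rewrite powr_plus0 ?powr_1 //; lra.
Qed.

Lemma powr_inv_r x a : 0 <= x -> a <> 0 -> powr (powr x a) (/ a) = x.
Proof. by move=> h ha; rewrite powr_powr // Rinv_r // powr_1. Qed.

Lemma powr_inv_l x a : 0 <= x -> a <> 0 -> powr (powr x (/ a)) a = x.
Proof. by move=> h ha; rewrite powr_powr // Rinv_l // powr_1. Qed.

Lemma powr_le_exp x a b : 1 <= x -> a <= b -> powr x a <= powr x b.
Proof. by move=> hx h; rewrite !powr_Rpower; try lra; apply: Rle_Rpower. Qed.

Lemma is_derive_powr_pos x a : 0 < x ->
  is_derive (fun y => powr y a) x (a * powr x (a - 1)).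
Proof.
move=> h; rewrite powr_Rpower //.
apply: (is_derive_ext_loc (fun y => Rpower y a)).
  have e : 0 < x by [].
  exists (mkposreal x e) => y; rewrite /ball /= /AbsRing_ball /abs /minus /plus /opp /= => hy.
  rewrite powr_Rpower //; move: hy => /Rabs_def2; lra.
apply/is_derive_Reals; exact: derivable_pt_lim_power.
Qed.

Lemma powr_small a eps : 0 < a -> 0 < eps ->
  exists d, 0 < d /\ forall x, x < d -> powr x a < eps.
Proof.
move=> ha he; exists (powr eps (/ a)); split; first exact: powr_gt0.
move=> x hx; case: (Rlt_dec 0 x) => h; last by rewrite powr_neg; lra.
rewrite -(@powr_inv_l eps a); try lra.
apply: powr_lt; lra.
Qed.

Lemma continuous_powr x a : 0 < a -> continuous (fun y => powr y a) x.
Proof.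
move=> ha; case: (Rtotal_order x 0) => [h|[->|h]].
- have h' : 0 < - x by lra.
  apply: (@continuous_ext_loc R_UniformSpace R_UniformSpace _ (fun _ => 0)); last exact: continuous_const.
  exists (mkposreal _ h') => y; rewrite /ball /= /AbsRing_ball /abs /minus /plus /opp /=.
  move=> /Rabs_def2 ?; rewrite powr_neg; lra.
- apply/filterlim_locally => eps.
  have [d [hd h]] := powr_small ha (cond_pos eps).
  exists (mkposreal d hd) => y; rewrite /ball /= /AbsRing_ball /abs /minus /plus /opp /=.
  move=> /Rabs_def2 [h1 h2].
  rewrite (@powr_neg 0); try lra; rewrite Ropp_0 Rplus_0_r Rabs_pos_eq; last exact: powr_ge0.
  apply: h; lra.
- apply: ex_derive_continuous; eexists; exact: is_derive_powr_pos.
Qed.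

(** With [powr] zero on the negative half-line, this concerns a power of the positive part. At 0 the
    right difference quotient is [powr y (a - 1)], which tends to 0 because [1 < a]. *)
Lemma is_derive_powr x a : 1 < a ->
  is_derive (fun y => powr y a) x (a * powr x (a - 1)).
Proof.
move=> ha; case: (Rtotal_order x 0) => [h|[->|h]].
- rewrite (@powr_neg x); try lra; rewrite Rmult_0_r.
  have h' : 0 < - x by lra.
  apply: (is_derive_ext_loc (fun _ => 0)); last exact: is_derive_const.
  exists (mkposreal _ h') => y; rewrite /ball /= /AbsRing_ball /abs /minus /plus /opp /=.
  move=> /Rabs_def2 ?; rewrite powr_neg; lra.
- rewrite (@powr_neg 0); try lra; rewrite Rmult_0_r.
  apply/is_derive_Reals => eps he.
  have ha1 : 0 < a - 1 by lra.
  have [d [hd h]] := powr_small ha1 he.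
  exists (mkposreal d hd) => y hy /= hyd.
  rewrite Rplus_0_l (@powr_neg 0); try lra; rewrite !Rminus_0_r.
  case: (Rlt_dec 0 y) => h0; last by rewrite powr_neg; try lra; rewrite /Rdiv Rmult_0_l Rabs_R0.
  rewrite (_ : a = (a - 1) + 1); last ring.
  rewrite powr_plus // powr_1; last lra.
  rewrite /Rdiv Rmult_assoc Rinv_r // Rmult_1_r Rabs_pos_eq; last exact: powr_ge0.
  apply: h; move: hyd => /Rabs_def2; lra.
- exact: is_derive_powr_pos.
Qed.

(** Convexity of [exp] in its tangent form: [1 + s <= exp s] at [s = ln x - z] and [s = ln y - z],
    where [z = a * ln x + (1 - a) * ln y] makes the linear terms cancel in the weighted sum. *)
Lemma young x y a : 0 <= x -> 0 <= y -> 0 < a < 1 ->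
  powr x a * powr y (1 - a) <= a * x + (1 - a) * y.
Proof.
move=> [hx|<-] [hy|<-] ha; try by rewrite (@powr_neg 0); try lra; nra.
rewrite !powr_Rpower // /Rpower -exp_plus.
set z := _ + _.
have e1 : x = exp z * exp (ln x - z) by rewrite -exp_plus Rplus_minus exp_ln.
have e2 : y = exp z * exp (ln y - z) by rewrite -exp_plus Rplus_minus exp_ln.
have i1 := exp_ineq1_le (ln x - z).
have i2 := exp_ineq1_le (ln y - z).
rewrite {1}e1 {1}e2.
have ez := exp_pos z.
have : exp z * 1 <= exp z * (a * exp (ln x - z) + (1 - a) * exp (ln y - z)).
  apply: Rmult_le_compat_l; first lra.
  have : a * (1 + (ln x - z)) + (1 - a) * (1 + (ln y - z)) = 1 by rewrite /z; ring.
  nra.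
lra.
Qed.

(* A local property that persists when its constant is enlarged holds with a
   single constant on a cube. *)
Lemma cube_uniform n (a b : R) (P : ('I_n -> R) -> R -> Prop) :
  (forall z M M', M <= M' -> P z M -> P z M') ->
  (forall z, (forall i, a <= z i <= b) -> exists M d, 0 < d /\
     forall w, (forall i, Rabs (w i - z i) < d) -> P w M) ->
  exists M, forall z, (forall i, a <= z i <= b) -> P z M.
Proof.
move=> mono hloc.
case: (Rle_dec a b) => hab; last first.
  case: n P mono hloc => [|n] P mono hloc.
    have [|M [d [hd h]]] := hloc (fun _ => 0); first by case.
    by exists M => z _; apply: h => -[].
  by exists 0 => z h; have := h ord0; lra.
(* Induction on the number [k] of leading coordinates that run over the whole of [[a, b]]; the
   others stay within [d] of [z]. *)
have step : forall k, (k <= n)%N -> forall z : 'I_n -> R, (forall i, a <= z i <= b) ->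
    exists M d, 0 < d /\ forall w, (forall j : 'I_n, (j < k)%N -> a <= w j <= b) ->
      (forall j : 'I_n, (k <= j)%N -> Rabs (w j - z j) < d) -> P w M.
  elim=> [|k IH] hk z hz.
    have [M [d [hd h]]] := hloc z hz.
    by exists M, d; split => // w _ hw; apply: h => i; apply: hw.
  pose good (r : R) (p : R * posreal) := forall w,
    (forall j : 'I_n, (j < k)%N -> a <= w j <= b) ->
    (forall j : 'I_n, (k <= j)%N -> Rabs (w j - updn z k r j) < p.2) -> P w p.1.
  have ex r : exists p, a <= r <= b -> good r p.
    case: (excluded_middle_informative (a <= r <= b)) => hr; last first.
      by exists (0, mkposreal 1 Rlt_0_1).
    have hz' i : a <= updn z k r i <= b by rewrite /updn; case: ifP.
    have [M [d [hd h]]] := IH (ltnW hk) _ hz'.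
    by exists (M, mkposreal d hd).
  pose f r := proj1_sig (constructive_indefinite_description _ (ex r)).
  have hf r : a <= r <= b -> good r (f r).
    by rewrite /f; case: constructive_indefinite_description.
  (* The gauge stores both the radius and the size of the constant: a lower bound [d] for its value
     at [r] bounds the constant [(f r).1] by [/ d]. *)
  have gp r : 0 < Rmin (f r).2 (/ (1 + Rabs (f r).1)).
    apply: Rmin_pos; first exact: cond_pos.
    apply: Rinv_0_lt_compat; have := Rabs_pos (f r).1; lra.
  have [d hd] := compactness_value_1d a b (fun r => mkposreal _ (gp r)).
  exists (/ d), d; split; first exact: cond_pos.
  move=> w hw1 hw2.
  apply: NNPP => hn.
  have hwk : a <= w (Ordinal hk) <= b by apply: hw1 => /=.
  apply: (hd _ hwk) => -[r [hr [h1 h2]]]; apply: hn.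
  rewrite /= in h1 h2.
  have m1 := Rmin_l (f r).2 (/ (1 + Rabs (f r).1)).
  have m2 := Rmin_r (f r).2 (/ (1 + Rabs (f r).1)).
  apply: (mono _ (f r).1).
    apply: Rle_trans (Rle_abs _) _.
    have p1 := Rabs_pos (f r).1.
    apply: Rle_trans (_ : 1 + Rabs (f r).1 <= _); first lra.
    rewrite -(Rinv_inv (1 + _)); apply: Rinv_le_contravar; first exact: cond_pos.
    lra.
  apply: (hf r hr) => j hj; first by apply: hw1; apply: ltnW.
  rewrite /updn; case: eqP => ej.
    have -> : j = Ordinal hk by apply: ord_inj.
    lra.
  apply: Rlt_le_trans (_ : d <= _); last lra.
  by apply: hw2; rewrite ltn_neqAle hj andbT; apply/eqP => e; apply: ej.
have [|M [d [hd h]]] := step n (leqnn n) (fun _ => a); first by move=> i; lra.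
exists M => z hz; apply: h => j; first by move=> _; exact: hz.
by rewrite leqNgt ltn_ord.
Qed.

(** * Iterated integrals of continuous functions *)

Definition cont {U : UniformSpace} (f : U -> R) : Prop := forall z, continuous f z.

Section Continuity.
Variable U : UniformSpace.
Implicit Types f g : U -> R.

Lemma cont_const (c : R) : cont (fun _ : U => c).
Proof. move=> z; exact: continuous_const. Qed.

Lemma cont_plus f g : cont f -> cont g -> cont (fun z => f z + g z).
Proof. move=> hf hg z; exact: (@continuous_plus U _ R_NormedModule f g z). Qed.

Lemma cont_opp f : cont f -> cont (fun z => - f z).
Proof. move=> hf z; exact: (@continuous_opp U _ R_NormedModule f z). Qed.

Lemma cont_minus f g : cont f -> cont g -> cont (fun z => f z - g z).
Proof. by move=> hf hg; apply: cont_plus => //; apply: cont_opp. Qed.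

Lemma cont_mult f g : cont f -> cont g -> cont (fun z => f z * g z).
Proof. move=> hf hg z; exact: (@continuous_mult U R_AbsRing f g z). Qed.

Lemma cont_sumI n (f : 'I_n -> U -> R) : (forall i, cont (f i)) -> cont (fun z => sumI (fun i => f i z)).
Proof.
move=> h; rewrite /sumI; elim: (index_enum _) => [|i s IH].
  rewrite (_ : (fun z => _) = fun _ => 0); first exact: cont_const.
  by apply: functional_extensionality => z; rewrite big_nil.
rewrite (_ : (fun z => _) = fun z => f i z + \big[Rplus/0]_(j <- s) f j z).
  exact: cont_plus.
by apply: functional_extensionality => z; rewrite big_cons.
Qed.

Lemma cont_comp {V : UniformSpace} (c : U -> V) (f : V -> R) :
  (forall z, continuous c z) -> cont f -> cont (fun z => f (c z)).
Proof. move=> hc hf z; exact: (@continuous_comp _ _ _ c f z). Qed.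

Lemma cont_comp2 {V W : UniformSpace} (c : U -> V) (e : U -> W) (f : V -> W -> R) :
  (forall z, continuous c z) -> (forall z, continuous e z) ->
  cont (fun p : V * W => f p.1 p.2) -> cont (fun z => f (c z) (e z)).
Proof. move=> hc he hf z; exact: (@continuous_comp_2 _ _ _ _ c e f z). Qed.

Lemma cont_Rmax f g : cont f -> cont g -> cont (fun z => Rmax (f z) (g z)).
Proof.
move=> hf hg.
rewrite (_ : (fun z => _) = fun z => / 2 * (f z + g z + Rabs (f z - g z))).
  apply: cont_mult; first exact: cont_const.
  apply: cont_plus; first exact: cont_plus.
  by apply: (cont_comp (V := R_UniformSpace) (f := Rabs)); [exact: cont_minus|move=> y; exact: continuous_Rabs].
apply: functional_extensionality => z; rewrite /Rmax.
case: Rle_dec => /= h; [rewrite Rabs_left1; lra|rewrite Rabs_pos_eq; lra].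
Qed.

Lemma cont_Rabs f : cont f -> cont (fun z => Rabs (f z)).
Proof. by move=> h; apply: (cont_comp (V := R_UniformSpace) (f := Rabs)) => // y; exact: continuous_Rabs. Qed.

Lemma cont_powr f a : 0 < a -> cont f -> cont (fun z => powr (f z) a).
Proof. by move=> ha h; apply: (cont_comp (V := R_UniformSpace) (f := fun y => powr y a)) => // y; exact: continuous_powr. Qed.

Lemma locally_forall_ord n (z : U) (P : 'I_n -> U -> Prop) :
  (forall i, locally z (P i)) -> locally z (fun u => forall i, P i u).
Proof.
move=> h.
have : forall k, locally z (fun u => forall i : 'I_n, (i < k)%N -> P i u).
  elim=> [|k IH]; first exact: filter_forall.
  case: (ltnP k n) => hk.
    apply: filter_imp (filter_and _ _ IH (h (Ordinal hk))) => u [h1 h2] i.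
    rewrite ltnS leq_eqVlt => /orP [/eqP e|]; last exact: h1.
    by have -> : i = Ordinal hk by apply: ord_inj.
  apply: filter_imp IH => u h1 i hi; apply: h1.
  exact: leq_trans (ltn_ord i) hk.
move=> /(_ n); apply: filter_imp => u h1 i; apply: h1; exact: ltn_ord.
Qed.

Lemma continuous_pt n (c : U -> pt n) (z : U) :
  (forall i, continuous (fun u => c u i) z) -> continuous c z.
Proof.
move=> h; apply/filterlim_locally => eps.
apply: (locally_forall_ord (P := fun i u => ball (c z i) eps (c u i))) => i.
by move: (h i) => /filterlim_locally /(_ eps).
Qed.

End Continuity.

Lemma continuous_coord n (i : 'I_n) (z : pt n) : continuous (fun w : pt n => w i) z.
Proof. by apply/filterlim_locally => eps; exists eps => w h; apply: h. Qed.

Lemma cont_fst {U V : UniformSpace} (z : U * V) : continuous fst z.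
Proof. destruct z; exact: continuous_fst. Qed.

Lemma cont_snd {U V : UniformSpace} (z : U * V) : continuous snd z.
Proof. destruct z; exact: continuous_snd. Qed.

Lemma cont_id {U : UniformSpace} (z : U) : continuous (fun z => z) z.
Proof. exact: continuous_id. Qed.

Lemma continuous_coord_comp {U : UniformSpace} n (c : U -> pt n) (i : 'I_n) (z : U) :
  continuous c z -> continuous (fun u => c u i) z.
Proof. by move=> h; apply: (continuous_comp c (fun w : pt n => w i)) => //; exact: continuous_coord. Qed.

Lemma continuous_fst_comp {U V W : UniformSpace} (c : U -> V * W) z :
  continuous c z -> continuous (fun u => (c u).1) z.
Proof. by move=> h; apply: (continuous_comp c fst) => //; exact: cont_fst. Qed.

Lemma continuous_snd_comp {U V W : UniformSpace} (c : U -> V * W) z :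
  continuous c z -> continuous (fun u => (c u).2) z.
Proof. by move=> h; apply: (continuous_comp c snd) => //; exact: cont_snd. Qed.

Lemma continuous_updn {U : UniformSpace} n (c : U -> pt n) k (r : U -> R) (z : U) :
  continuous c z -> continuous r z -> continuous (fun u => updn (c u) k (r u)) z.
Proof.
move=> hc hr; apply: continuous_pt => i; rewrite /updn.
by case: (nat_of_ord i == k) => //; exact: continuous_coord_comp.
Qed.

Lemma continuous_upd {U : UniformSpace} n (c : U -> pt n) k (r : U -> R) (z : U) :
  continuous c z -> continuous r z -> continuous (fun u => upd (c u) k (r u)) z.
Proof.
move=> hc hr; apply: continuous_pt => i; rewrite /upd.
by case: (i == k) => //; exact: continuous_coord_comp.
Qed.

Lemma cont_slice {U V : UniformSpace} (F : U -> V -> R) u :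
  cont (fun p : U * V => F p.1 p.2) -> cont (F u).
Proof.
move=> h; apply: (cont_comp2 (c := fun _ => u) (e := fun z => z)) => // z.
  exact: continuous_const.
exact: continuous_id.
Qed.

(** A tube argument: compactness of [[a, b]] gives one neighbourhood of [u] on which [F w] is
    uniformly close to [F u]. *)
Lemma cont_RInt {U : UniformSpace} (F : U -> R -> R) a b :
  a <= b -> cont (fun z : U * R => F z.1 z.2) -> cont (fun u => RInt (F u) a b).
Proof.
move=> hab hF u.
have ex w : ex_RInt (F w) a b.
  apply: ex_RInt_continuous => t _; exact: (@cont_slice _ _ F w hF).
apply/filterlim_locally => eps.
(* Values are compared through a centre of the cover, which costs [e] twice; the summand 1 keeps the
   denominator positive when [a = b]. *)
pose e := eps / (2 * (b - a) + 1).
have hd : 0 < 2 * (b - a) + 1 by lra.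
have he : 0 < e by apply: Rdiv_lt_0_compat => //; exact: cond_pos.
have loc t : exists d : posreal, forall w x, ball u d w -> ball t d x -> Rabs (F w x - F u t) < e.
  move: (hF (u, t)) => /filterlim_locally /(_ (mkposreal e he)) [d h].
  by exists d => w x h1 h2; apply: (h (w, x)); split.
pose del t := proj1_sig (constructive_indefinite_description _ (loc t)).
have hdel t w x : ball u (del t) w -> ball t (del t) x -> Rabs (F w x - F u t) < e.
  by rewrite /del; case: constructive_indefinite_description => d h; apply: h.
have [d hcomp] := compactness_value_1d a b del.
exists d => w hw; rewrite /ball /= /AbsRing_ball /abs /= /minus /plus /opp /=.
have -> : RInt (F w) a b + - RInt (F u) a b = RInt (fun x => F w x - F u x) a b.
  by symmetry; exact: (RInt_minus (F w) (F u) a b (ex w) (ex u)).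
apply: Rle_lt_trans (_ : (b - a) * (2 * e) < _); last first.
  have -> : (b - a) * (2 * e) = eps * ((2 * (b - a)) / (2 * (b - a) + 1)) by rewrite /e; field; lra.
  rewrite -[X in _ < X]Rmult_1_r; apply: Rmult_lt_compat_l; first exact: cond_pos.
  apply/Rlt_div_l => //; lra.
apply: abs_RInt_le_const => //; first exact: (ex_RInt_minus (V := R_NormedModule)).
move=> x hx.
apply: Rnot_lt_le => hlt; apply: (hcomp x hx) => -[t [ht [h1 h2]]].
have bx : ball t (del t) x by rewrite /ball /= /AbsRing_ball /abs /= /minus /plus /opp /=.
have b1 := hdel t w x (ball_le _ _ _ h2 _ hw) bx.
have b2 := hdel t u x (ball_center _ _) bx.
move: b1 b2 hlt => /Rabs_def2 b1 /Rabs_def2 b2.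
by apply: Rle_not_lt; apply: Rabs_le; lra.
Qed.

Lemma itint_cont {U : UniformSpace} n k a b (F : U -> pt n -> R) :
  a <= b -> cont (fun p : U * pt n => F p.1 p.2) ->
  cont (fun p : U * pt n => itint k a b (F p.1) p.2).
Proof.
move=> hab; elim: k => [|k IH] hF //=.
apply: cont_RInt => //.
apply: (cont_comp2 (c := fun q : U * pt n * R => q.1.1)
  (e := fun q : U * pt n * R => updn q.1.2 k q.2 : pt n)
  (f := fun u z => itint k a b (F u) z)) => [z|z|].
- by apply: continuous_fst_comp; exact: cont_fst.
- apply: continuous_updn; last exact: cont_snd.
  by apply: continuous_snd_comp; exact: cont_fst.
- exact: IH.
Qed.

Lemma boxint_cont {U : UniformSpace} n a b (F : U -> pt n -> R) :
  a <= b -> cont (fun p : U * pt n => F p.1 p.2) -> cont (fun u => boxint a b (F u)).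
Proof.
move=> hab hF.
apply: (cont_comp2 (c := fun u => u) (e := fun _ => (fun _ => 0) : pt n)
  (f := fun u z => itint n a b (F u) z)) => [z|z|].
- exact: cont_id.
- exact: continuous_const.
- exact: itint_cont.
Qed.

Lemma RInt_plusR (f g : R -> R) a b : ex_RInt f a b -> ex_RInt g a b ->
  RInt (fun x => f x + g x) a b = RInt f a b + RInt g a b.
Proof. exact: RInt_plus. Qed.

Lemma RInt_scalR (f : R -> R) c a b : ex_RInt f a b ->
  RInt (fun x => c * f x) a b = c * RInt f a b.
Proof. exact: RInt_scal. Qed.

Section BoxIntegral.
Variables (n : nat) (a b : R).
Hypothesis hab : a <= b.
Implicit Types f g : pt n -> R.

Lemma itint_cont1 k f : cont f -> cont (itint k a b f).
Proof.
move=> hf.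
have h : cont (fun p : R * pt n => (fun _ : R => f) p.1 p.2).
  by apply: (cont_comp (c := snd)) => // z; exact: cont_snd.
have h2 := @itint_cont R_UniformSpace n k a b (fun _ => f) hab h.
exact: (@cont_slice R_UniformSpace (fct_UniformSpace 'I_n R_UniformSpace) (fun _ : R => itint k a b f) 0 h2).
Qed.

Lemma itint_line k f z : cont f -> cont (fun r => itint k a b f (updn z k r)).
Proof.
move=> hf; apply: cont_comp; last exact: itint_cont1.
move=> r; apply: continuous_updn; [exact: continuous_const|exact: cont_id].
Qed.

Lemma itint_ex k f z : cont f -> ex_RInt (fun r => itint k a b f (updn z k r)) a b.
Proof. move=> hf; apply: ex_RInt_continuous => t _; exact: itint_line. Qed.

Lemma itint_plus k f g z : cont f -> cont g ->
  itint k a b (fun w => f w + g w) z = itint k a b f z + itint k a b g z.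
Proof.
move=> hf hg; elim: k z => [|k IH] z //=.
rewrite -RInt_plusR; try exact: itint_ex.
by apply: RInt_ext => r _; rewrite IH.
Qed.

Lemma itint_scal k c f z : cont f ->
  itint k a b (fun w => c * f w) z = c * itint k a b f z.
Proof.
move=> hf; elim: k z => [|k IH] z //=.
rewrite -RInt_scalR; last exact: itint_ex.
by apply: RInt_ext => r _; rewrite IH.
Qed.

Lemma itint_le k f g z : cont f -> cont g ->
  (forall w, (forall j : 'I_n, (j < k)%N -> a <= w j <= b) ->
     (forall j : 'I_n, (k <= j)%N -> w j = z j) -> f w <= g w) ->
  itint k a b f z <= itint k a b g z.
Proof.
move=> hf hg; elim: k z => [|k IH] z h /=; first exact: h.
apply: RInt_le => //; try exact: itint_ex.
move=> r hr; apply: IH => w h1 h2; apply: h => j hj.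
  move: hj; rewrite ltnS leq_eqVlt => /orP [/eqP e|]; last exact: h1.
  by rewrite h2 ?e // /updn e eqxx; lra.
by rewrite h2 ?(ltnW hj) // /updn gtn_eqF.
Qed.

Lemma boxint_plus f g : cont f -> cont g ->
  boxint a b (fun w => f w + g w) = boxint a b f + boxint a b g.
Proof. exact: itint_plus. Qed.

Lemma boxint_scal c f : cont f -> boxint a b (fun w => c * f w) = c * boxint a b f.
Proof. exact: itint_scal. Qed.

Lemma boxint_le f g : cont f -> cont g ->
  (forall w, (forall j, a <= w j <= b) -> f w <= g w) -> boxint a b f <= boxint a b g.
Proof. by move=> hf hg h; apply: itint_le => // w h1 _; apply: h => j; apply: h1. Qed.

End BoxIntegral.

Lemma boxint_const n c : boxint 0 1 (fun _ : pt n => c) = c.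
Proof.
rewrite /boxint.
have : forall k z, itint k 0 1 (fun _ : pt n => c) z = c.
  elim=> [|k IH] z //=.
  rewrite (RInt_ext _ (fun _ => c)); last by move=> r _; rewrite IH.
  rewrite RInt_const /scal /= /mult /=; ring.
by apply.
Qed.

Lemma boxint_fun0 n a b : a <= b -> boxint a b (fun _ : pt n => 0) = 0.
Proof.
move=> h; transitivity (0 * boxint a b (fun _ : pt n => 0)); last ring.
rewrite -boxint_scal //; last exact: cont_const.
congr (boxint _ _ _); apply: functional_extensionality => w; ring.
Qed.

Lemma boxint_opp n a b (f : pt n -> R) : a <= b -> cont f ->
  boxint a b (fun w => - f w) = - boxint a b f.
Proof.
move=> h hf; rewrite (_ : - boxint a b f = (-1) * boxint a b f); last ring.
rewrite -boxint_scal //; congr (boxint _ _ _).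
by apply: functional_extensionality => w; ring.
Qed.

Lemma boxint_ge0 n a b (f : pt n -> R) : a <= b -> cont f ->
  (forall w, (forall j, a <= w j <= b) -> 0 <= f w) -> 0 <= boxint a b f.
Proof.
move=> h hf h0; rewrite -(boxint_fun0 n h); apply: boxint_le => //; exact: cont_const.
Qed.

(* Only the derivative needs joint continuity. *)
Lemma is_derive_RInt_under (F F' : R -> R -> R) a b lo hi s :
  a <= b -> lo < s < hi ->
  (forall s, lo < s < hi -> cont (F s)) ->
  cont (fun z : R * R => F' z.1 z.2) ->
  (forall s x, lo < s < hi -> is_derive (fun s => F s x) s (F' s x)) ->
  is_derive (fun s => RInt (F s) a b) s (RInt (F' s) a b).
Proof.
move=> hab hs hF hF' hd.
have loc : locally s (fun s => lo < s < hi).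
  have h1 : 0 < Rmin (s - lo) (hi - s) by apply: Rmin_pos; lra.
  exists (mkposreal _ h1) => y; rewrite /ball /= /AbsRing_ball /abs /minus /plus /opp /=.
  have := Rmin_l (s - lo) (hi - s); have := Rmin_r (s - lo) (hi - s).
  move=> ? ? /Rabs_def2; lra.
rewrite (RInt_ext (F' s) (fun t => Derive (fun u => F u t) s)); last first.
  by move=> t _; symmetry; apply: is_derive_unique; exact: hd.
apply: is_derive_RInt_param.
- apply: filter_imp loc => y hy t _; eexists; exact: hd.
- move=> t _; apply/continuity_2d_pt_filterlim.
  apply: (@continuous_ext_loc (prod_UniformSpace R_UniformSpace R_UniformSpace) R_UniformSpace _ (fun z : R * R => F' z.1 z.2)); last exact: hF'.
  case: loc => e he; exists e => -[u v] [/= h1 h2].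
  by symmetry; apply: is_derive_unique; apply: hd; apply: he.
- apply: filter_imp loc => y hy; apply: ex_RInt_continuous => t _; exact: hF.
Qed.

Lemma is_derive_itint n (F F' : R -> pt n -> R) a b lo hi :
  a <= b ->
  (forall s, lo < s < hi -> cont (F s)) ->
  cont (fun z : R * pt n => F' z.1 z.2) ->
  (forall s x, lo < s < hi -> is_derive (fun s => F s x) s (F' s x)) ->
  forall k s z, lo < s < hi ->
  is_derive (fun s => itint k a b (F s) z) s (itint k a b (F' s) z).
Proof.
move=> hab hF hF' hd; elim=> [|k IH] s z hs /=; first exact: hd.
apply: (@is_derive_RInt_under (fun s r => itint k a b (F s) (updn z k r))
  (fun s r => itint k a b (F' s) (updn z k r)) a b lo hi s) => //.
- move=> s' hs'; apply: itint_line => //; exact: hF.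
- apply: (cont_comp2 (c := fun q : R * R => q.1) (e := fun q : R * R => updn z k q.2 : pt n)
    (f := fun s w => itint k a b (F' s) w)) => [q|q|].
  + exact: cont_fst.
  + by apply: continuous_updn; [exact: continuous_const|exact: cont_snd].
  + exact: itint_cont.
- by move=> s' r hs'; apply: IH.
Qed.

Lemma is_derive_boxint n (F F' : R -> pt n -> R) a b lo hi s :
  a <= b -> lo < s < hi ->
  (forall s, lo < s < hi -> cont (F s)) ->
  cont (fun z : R * pt n => F' z.1 z.2) ->
  (forall s x, lo < s < hi -> is_derive (fun s => F s x) s (F' s x)) ->
  is_derive (fun s => boxint a b (F s)) s (boxint a b (F' s)).
Proof. move=> hab hs hF hF' hd; exact: (is_derive_itint hab hF hF' hd). Qed.

Lemma is_derive_RInt_cont (f : R -> R) a s : cont f -> is_derive (fun s => RInt f a s) s (f s).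
Proof.
move=> hf; apply: (@is_derive_RInt _ f (fun s => RInt f a s) a s) => //.
apply: filter_forall => t; apply: RInt_correct; apply: ex_RInt_continuous => u _; exact: hf.
Qed.

(** Both sides are followed as functions of the upper limit: they vanish at [c] and have the same
    derivative [psi]. *)
Lemma boxint_RInt_swap n (G : pt n -> R -> R) a b c d : a <= b -> c <= d ->
  cont (fun z : pt n * R => G z.1 z.2) ->
  boxint a b (fun x => RInt (G x) c d) = RInt (fun r => boxint a b (fun x => G x r)) c d.
Proof.
move=> hab hcd hG.
have hG' : cont (fun z : R * pt n => G z.2 z.1).
  by apply: (cont_comp2 (c := snd) (e := fst) (f := G)) => // z; [exact: cont_snd|exact: cont_fst].
pose phi s := boxint a b (fun x => RInt (G x) c s).
pose psi r := boxint a b (fun x => G x r).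
have hpsi : cont psi by apply: boxint_cont.
have d1 s : c - 1 < s < d + 1 -> is_derive (fun s => boxint a b (fun x => RInt (G x) c s)) s (psi s).
  move=> hs; apply: (@is_derive_boxint n (fun s x => RInt (G x) c s) (fun s x => G x s) a b (c - 1) (d + 1)) => //.
    move=> s' _ x.
    (* Differentiating on a neighbourhood of [[c, d]] brings in upper limits below [c]. *)
    case: (Rle_dec c s') => h; first exact: (@cont_RInt _ G c s' h hG).
    apply: (continuous_ext (fun x => - RInt (G x) s' c)).
      by move=> y; rewrite -[RHS](opp_RInt_swap (G y)) //; apply: ex_RInt_continuous => t _; exact: (@cont_slice _ _ G y hG).
    by apply: cont_opp; apply: cont_RInt => //; lra.
  by move=> s' x _; apply: is_derive_RInt_cont; exact: (@cont_slice _ _ G x hG).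
have p0 : phi c = 0.
  rewrite /phi -(boxint_fun0 n hab); congr (boxint _ _ _).
  by apply: functional_extensionality => x; rewrite RInt_point.
case: hcd => hcd; last by rewrite -hcd RInt_point -/(phi c) p0.
have := is_RInt_derive phi psi c d.
rewrite Rmin_left ?Rmax_right; try lra.
move=> /(_ (fun x hx => d1 x ltac:(lra)) (fun x hx => hpsi x)) /is_RInt_unique ->.
by rewrite p0 /minus /plus /opp /= -/(phi d); ring.
Qed.

Lemma boxint_swap n m (G : pt n -> pt m -> R) a b c d : a <= b -> c <= d ->
  cont (fun z : pt n * pt m => G z.1 z.2) ->
  boxint a b (fun x => boxint c d (G x)) = boxint c d (fun y => boxint a b (fun x => G x y)).
Proof.
move=> hab hcd hG; rewrite {2 3}/boxint.
have : forall k z, boxint a b (fun x => itint k c d (G x) z) =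
   itint k c d (fun y => boxint a b (fun x => G x y)) z; last by apply.
elim=> [|k IH] z //=.
rewrite (boxint_RInt_swap (G := fun x r => itint k c d (G x) (updn z k r))) //.
  by apply: RInt_ext => r _; rewrite IH.
apply: (cont_comp2 (c := fun q : pt n * R => q.1) (e := fun q : pt n * R => updn z k q.2 : pt m)
    (f := fun x w => itint k c d (G x) w)) => [q|q|].
- exact: cont_fst.
- by apply: continuous_updn; [exact: continuous_const|exact: cont_snd].
- exact: itint_cont.
Qed.

(** * Hölder and Jensen inequalities, integrals over the torus *)

Section PositiveFunctional.
Variables (X : Type) (D : X -> Prop) (A : (X -> R) -> Prop) (L : (X -> R) -> R).
Hypothesis A_lin : forall f g c e, A f -> A g -> A (fun x => c * f x + e * g x).
Hypothesis L_lin : forall f g c e, A f -> A g ->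
  L (fun x => c * f x + e * g x) = c * L f + e * L g.
Hypothesis L_mono : forall f g, A f -> A g -> (forall x, D x -> f x <= g x) -> L f <= L g.

Lemma holder (a : R) (F G E : X -> R) (x y : R) : 0 < a < 1 -> A F -> A G -> A E ->
  (forall z, D z -> 0 <= F z) -> (forall z, D z -> 0 <= G z) ->
  (forall z, D z -> E z <= powr (F z) a * powr (G z) (1 - a)) ->
  0 < x -> 0 < y -> L F <= x -> L G <= y -> L E <= powr x a * powr y (1 - a).
Proof.
move=> ha hF hG hE F0 G0 hEFG hx hy Lx Ly.
set c := powr x a * powr y (1 - a).
have c0 : 0 < c by apply: Rmult_lt_0_compat; apply: powr_gt0.
apply: Rle_trans (_ : L (fun z => (c * a / x) * F z + (c * (1 - a) / y) * G z) <= _).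
  apply: L_mono => //; first exact: A_lin.
  move=> z hz; apply: Rle_trans (hEFG z hz) _.
  have fx : 0 <= F z / x by apply: Rdiv_le_0_compat => //; exact: F0.
  have gy : 0 <= G z / y by apply: Rdiv_le_0_compat => //; exact: G0.
  have := young fx gy ha.
  have -> : powr (F z) a * powr (G z) (1 - a) =
     c * (powr (F z / x) a * powr (G z / y) (1 - a)).
    rewrite {1}(_ : F z = F z / x * x); last by field; lra.
    rewrite {1}(_ : G z = G z / y * y); last by field; lra.
    rewrite (powr_mult a fx); try lra; rewrite (powr_mult _ gy); try lra.
    rewrite /c; ring.
  move=> hyo; apply: Rle_trans (Rmult_le_compat_l c _ _ (Rlt_le _ _ c0) hyo) _.
  right; field; lra.
rewrite L_lin //.
have e1 : c * a / x * L F <= c * a.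
  rewrite -{2}(Rmult_1_r (c * a)) (_ : c * a / x * L F = (c * a) * (L F / x)); last by field; lra.
  apply: Rmult_le_compat_l; first by apply: Rmult_le_pos; lra.
  by apply/Rle_div_l => //; lra.
have e2 : c * (1 - a) / y * L G <= c * (1 - a).
  rewrite -{2}(Rmult_1_r (c * (1 - a))) (_ : c * (1 - a) / y * L G = (c * (1 - a)) * (L G / y)); last by field; lra.
  apply: Rmult_le_compat_l; first by apply: Rmult_le_pos; lra.
  by apply/Rle_div_l => //; lra.
nra.
Qed.

(** The tangent to [powr] at [c = L f] lies below the graph, by [young] with weight [/ p]. Applying
    [L], of total mass one, to the tangent returns its value at [c]. *)
Lemma jensen (f : X -> R) (p : R) : 1 <= p -> A f -> A (fun _ => 1) -> L (fun _ => 1) = 1 ->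
  A (fun x => powr (f x) p) -> (forall x, D x -> 0 <= f x) ->
  powr (L f) p <= L (fun x => powr (f x) p).
Proof.
move=> hp hf h1 e1 hfp f0.
have Lp0 : 0 <= L (fun x => powr (f x) p).
  have <- : L (fun x => 0 * 1 + 0 * 1) = 0 by rewrite L_lin // ; ring.
  apply: L_mono => //; first exact: A_lin.
  by move=> x _; have := powr_ge0 (f x) p; lra.
case: (Rlt_dec 0 (L f)) => hc; last by rewrite powr_neg; lra.
set c := L f in hc *.
case: hp => hp; last first.
  rewrite -hp powr_1; [|lra]; rewrite /c; apply: L_mono => //; first by rewrite hp.
  by move=> x hx; rewrite powr_1; [lra|exact: f0].
set k := p * powr c (p - 1).
have ck : k * c = p * powr c p.
  rewrite /k (_ : powr c p = powr c (p - 1) * powr c 1); first by rewrite (@powr_1 c); [ring|lra].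
  by rewrite -powr_plus //; congr powr; ring.
have <- : L (fun x => k * f x + (powr c p - k * c) * 1) = powr c p.
  rewrite L_lin // e1 -/c; ring.
apply: L_mono => //; first exact: A_lin.
move=> x hx.
have ip : 0 < / p < 1.
  split; first by apply: Rinv_0_lt_compat; lra.
  rewrite -Rinv_1; apply: Rinv_lt_contravar; lra.
have := young (powr_ge0 (f x) p) (powr_ge0 c p) ip.
rewrite powr_inv_r; [|exact: f0|lra].
rewrite powr_powr; [|lra].
rewrite (_ : p * (1 - / p) = p - 1); last by field; lra.
move=> hy.
have : p * (f x * powr c (p - 1)) <= p * (/ p * powr (f x) p + (1 - / p) * powr c p).
  apply: Rmult_le_compat_l; lra.
have -> : p * (/ p * powr (f x) p + (1 - / p) * powr c p) = powr (f x) p + (p - 1) * powr c p.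
  by field; lra.
rewrite -/k.
have -> : p * (f x * powr c (p - 1)) = k * f x by rewrite /k; ring.
lra.
Qed.

End PositiveFunctional.

Lemma cont_within_continuous n (F : pt n -> R) (z : pt n) :
  cont_within (fun _ => True) F z <-> continuous F z.
Proof.
split=> h.
  apply/filterlim_locally => eps.
  have [d [hd h1]] := h eps (cond_pos eps).
  exists (mkposreal d hd) => w hw; apply: h1 => // i; exact: (hw i).
move=> eps he.
move: h => /filterlim_locally /(_ (mkposreal eps he)) [d h].
exists d; split; first exact: cond_pos.
by move=> w _ hw; apply: h.
Qed.

Lemma updn_ord n (z : pt n) (i : 'I_n) r : updn z i r = upd z i r.
Proof. by apply: functional_extensionality => j; rewrite /updn /upd (inj_eq (@ord_inj n)). Qed.

Lemma upd_same n (z : pt n) (i : 'I_n) r : upd z i r i = r.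
Proof. by rewrite /upd eqxx. Qed.

Lemma upd_upd n (z : pt n) (i : 'I_n) r s : upd (upd z i r) i s = upd z i s.
Proof. by apply: functional_extensionality => j; rewrite /upd; case: (j == i). Qed.

Lemma upd_id n (z : pt n) (i : 'I_n) : upd z i (z i) = z.
Proof. by apply: functional_extensionality => j; rewrite /upd; case: eqP => [->|]. Qed.

Lemma upd_comm n (z : pt n) (i j : 'I_n) r s : i != j ->
  upd (upd z i r) j s = upd (upd z j s) i r.
Proof.
move=> h; apply: functional_extensionality => k; rewrite /upd.
case: (eqVneq k j) => [->|//]; by rewrite eq_sym (negbTE h).
Qed.

Lemma itint_indep n k a b (f : pt n -> R) (z z' : pt n) :
  (forall j : 'I_n, (k <= j)%N -> z j = z' j) -> itint k a b f z = itint k a b f z'.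
Proof.
elim: k z z' => [|k IH] z z' h /=.
  by congr f; apply: functional_extensionality => j; apply: h.
apply: RInt_ext => r _; apply: IH => j hj; rewrite /updn.
case: eqP => // e; apply: h; rewrite ltn_neqAle hj andbT; apply/eqP => e'; exact: e.
Qed.

Lemma itint_periodic n k a b (f : pt n -> R) (w : pt n) (i : 'I_n) :
  periodic f -> (k <= i)%N -> itint k a b f (upd w i (w i + 1)) = itint k a b f w.
Proof.
move=> hf; elim: k w => [|k IH] w hk /=; first exact: hf.
apply: RInt_ext => r _; rewrite -[RHS]IH; last exact: ltnW.
congr itint; apply: functional_extensionality => j; rewrite /updn /upd.
case: (eqVneq j i) => [->|//].
by rewrite gtn_eqF.
Qed.

Lemma RInt_periodic (G : R -> R) c : cont G -> (forall r, G (r + 1) = G r) ->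
  RInt G c (c + 1) = RInt G 0 1.
Proof.
move=> hG hp.
have ex a b : ex_RInt G a b by apply: ex_RInt_continuous => t _; exact: hG.
have e1 : RInt G c 0 + RInt G 0 1 = RInt G c 1 by exact: (RInt_Chasles G c 0 1).
have e2 : RInt G c 1 + RInt G 1 (c + 1) = RInt G c (c + 1) by exact: (RInt_Chasles G c 1 (c + 1)).
have e3 : RInt G 1 (c + 1) = RInt G 0 c.
  have := RInt_comp_lin G 1 1 0 c (ex _ _).
  rewrite !Rmult_1_l Rplus_0_l => <-.
  by apply: RInt_ext => r _; rewrite !Rmult_1_l hp /scal /= /mult /= Rmult_1_l.
have e4 : RInt G c 0 + RInt G 0 c = RInt G c c by exact: (RInt_Chasles G c 0 c).
rewrite RInt_point /zero /= in e4; lra.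
Qed.

(** One coordinate at a time, each step being the shift invariance of the integral of a periodic
    function of one variable. *)
Lemma torint_shift n (f : pt n -> R) (h : pt n) : cont f -> periodic f ->
  torint (fun x => f (fun i => x i + h i)) = torint f.
Proof.
move=> hf hp.
have key : forall k, (k <= n)%N -> forall z : pt n,
    itint k 0 1 (fun x => f (fun i => x i + h i)) z = itint k 0 1 f (fun i => z i + h i).
  elim=> [|k IH] hk z //=.
  pose i := Ordinal hk.
  pose zh : pt n := fun i => z i + h i.
  pose G r := itint k 0 1 f (updn zh k r).
  have hG : cont G by apply: itint_line => //; lra.
  have pG r : G (r + 1) = G r.
    rewrite /G -[RHS](@itint_periodic n k 0 1 f _ i) //; congr itint.
    by rewrite !(@updn_ord n _ i) upd_upd upd_same.
  rewrite (RInt_ext _ (fun r => G (r + h i))); last first.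
    move=> r _; rewrite IH ?(ltnW hk) //; congr itint.
    apply: functional_extensionality => j; rewrite /updn; case: eqP => [e|//].
    by congr (_ + h _); apply: ord_inj.
  have := RInt_comp_lin G 1 (h i) 0 1.
  rewrite Rmult_0_r Rplus_0_l Rmult_1_l (Rplus_comm 1) => H0.
  rewrite -[RHS](RInt_periodic (h i) hG pG) -H0; last first.
    by apply: ex_RInt_continuous => t _; exact: hG.
  by apply: RInt_ext => r _; rewrite Rmult_1_l /scal /= /mult /= Rmult_1_l.
rewrite /torint /boxint key //; apply: itint_indep => j.
by rewrite leqNgt ltn_ord.
Qed.

(** Translation invariance makes the integral of the shifted [f] constant in the shift, and its
    derivative at 0 is the integral of [g]; no boundary terms arise. *)
Lemma torint_pd n (i : 'I_n) (f g : pt n -> R) : cont f -> periodic f -> cont g ->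
  (forall x, is_derive (fun r => f (upd x i r)) (x i) (g x)) -> torint g = 0.
Proof.
move=> hf hp hg hd.
pose F (s : R) (x : pt n) := f (upd x i (x i + s)).
pose F' (s : R) (x : pt n) := g (upd x i (x i + s)).
have c0 : cont (fun z : R * pt n => upd z.2 i (z.2 i + z.1) i).
  move=> z; apply: (continuous_ext (fun z : R * pt n => z.2 i + z.1)).
    by move=> q; rewrite upd_same.
  apply: (@cont_plus _ (fun z : R * pt n => z.2 i) (fun z => z.1)) => q.
    by apply: continuous_coord_comp; exact: cont_snd.
  exact: cont_fst.
have c1 (z : R * pt n) : continuous (fun z : R * pt n => upd z.2 i (z.2 i + z.1) : pt n) z.
  apply: continuous_upd; first exact: cont_snd.
  apply: (continuous_ext (fun z : R * pt n => upd z.2 i (z.2 i + z.1) i)); last exact: c0.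
  by move=> q; rewrite upd_same.
have hd1 : is_derive (fun s => boxint 0 1 (F s)) 0 (boxint 0 1 (F' 0)).
  apply: (@is_derive_boxint n F F' 0 1 (-1) 1); try lra.
  - move=> s _; apply: (@cont_slice _ _ F s).
    exact: (@cont_comp _ _ (fun z : R * pt n => upd z.2 i (z.2 i + z.1)) f).
  - exact: (@cont_comp _ _ (fun z : R * pt n => upd z.2 i (z.2 i + z.1)) g).
  - move=> s x _; have := hd (upd x i (x i + s)); rewrite upd_same => h1.
    apply: (is_derive_ext (fun s => f (upd (upd x i (x i + s)) i (x i + s)))).
      by move=> t; rewrite upd_upd.
    rewrite /F' -[g _]Rmult_1_l.
    apply: (is_derive_ext (fun t => f (upd (upd x i (x i + s)) i (x i + t)))).
      by move=> t; rewrite !upd_upd.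
    apply: (@is_derive_comp _ _ (fun r => f (upd (upd x i (x i + s)) i r)) (fun t => x i + t)).
      exact: h1.
    by auto_derive.
have e s : boxint 0 1 (F s) = torint f.
  rewrite -(@torint_shift n f (fun j => if j == i then s else 0) hf hp); congr (boxint _ _ _).
  apply: functional_extensionality => x; congr f; apply: functional_extensionality => j.
  by rewrite /upd; case: eqP => [->|]; rewrite ?Rplus_0_r.
have e' : boxint 0 1 (F' 0) = torint g.
  congr (boxint _ _ _); apply: functional_extensionality => x; rewrite /F' Rplus_0_r.
  by rewrite upd_id.
rewrite -e' -(is_derive_unique _ _ _ hd1).
rewrite (Derive_ext _ (fun _ => torint f)) //; exact: Derive_const.
Qed.

Lemma boxint_reflect n (f : pt n -> R) a : 0 <= a -> cont f ->
  boxint (- a) a (fun w => f (fun i => - w i)) = boxint (- a) a f.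
Proof.
move=> ha hf.
have key : forall k z, itint k (- a) a (fun w => f (fun i => - w i)) z =
    itint k (- a) a f (fun i => - z i).
  elim=> [|k IH] z //=.
  pose G r := itint k (- a) a f (updn (fun i => - z i) k r).
  have hG : cont G by apply: itint_line => //; lra.
  rewrite (RInt_ext _ (fun r => G (- r))); last first.
    move=> r _; rewrite IH; congr itint; apply: functional_extensionality => j.
    by rewrite /updn; case: eqP.
  have := RInt_comp_lin G (-1) 0 (- a) a.
  rewrite !Rplus_0_r (_ : -1 * - a = a); last ring.
  rewrite (_ : -1 * a = - a); last ring.
  move=> H0; rewrite -/(RInt G (- a) a).
  have ex : ex_RInt G a (- a) by apply: ex_RInt_continuous => t _; exact: hG.
  have ex' : ex_RInt G (- a) a by apply: ex_RInt_continuous => t _; exact: hG.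
  have := H0 ex => {}H0.
  have e : RInt (fun y => -1 * G (-1 * y + 0)) (- a) a = RInt G a (- a) by exact: H0.
  rewrite RInt_scalR in e; last first.
    apply: ex_RInt_continuous => t _.
    apply: (@cont_comp _ _ (fun y => -1 * y + 0) G) => // y.
    by apply: ex_derive_continuous; auto_derive.
  have e2 : - RInt G (- a) a = RInt G a (- a) by exact: (opp_RInt_swap G).
  have e3 : RInt (fun r => G (- r)) (- a) a = RInt (fun y => G (-1 * y + 0)) (- a) a.
    by apply: RInt_ext => r _; congr G; ring.
  transitivity (RInt G (- a) a); [lra|by []].
rewrite /boxint key; apply: itint_indep => j; by rewrite leqNgt ltn_ord.
Qed.

(* The cube [x + [0, s]^n] is contained in a period. *)
Lemma boxint_scaled_le n (f : pt n -> R) (x : pt n) (s : R) : 0 < s <= 1 ->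
  cont f -> periodic f -> (forall x, 0 <= f x) ->
  boxint 0 1 (fun y => f (fun i => x i + s * y i)) <= / s ^ n * torint f.
Proof.
move=> hs hf hp f0.
have c1 : cont (fun y : pt n => f (fun i => x i + s * y i)).
  apply: (@cont_comp _ _ (fun y : pt n => (fun i => x i + s * y i) : pt n)) => // z.
  apply: continuous_pt => i.
  apply: (@cont_plus _ (fun _ => x i) (fun y : pt n => s * y i)); first exact: cont_const.
  apply: cont_mult; first exact: cont_const.
  move=> w; exact: continuous_coord.
have key : forall k, (k <= n)%N -> forall z : pt n,
    itint k 0 1 (fun y => f (fun i => x i + s * y i)) z <=
    / s ^ k * itint k 0 1 f (fun i => x i + s * z i).
  elim=> [|k IH] hk z /=; first by rewrite Rinv_1 Rmult_1_l; lra.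
  pose i := Ordinal hk.
  pose zh : pt n := fun i => x i + s * z i.
  pose G r := itint k 0 1 f (updn zh k r).
  have hG : cont G by apply: itint_line => //; lra.
  have pG r : G (r + 1) = G r.
    rewrite /G -[RHS](@itint_periodic n k 0 1 f _ i) //; congr itint.
    by rewrite !(@updn_ord n _ i) upd_upd upd_same.
  have G0 r : 0 <= G r.
    have -> : 0 = itint k 0 1 (fun _ => 0 * 0) (updn zh k r).
      by rewrite itint_scal ?Rmult_0_l //; [lra|exact: cont_const].
    apply: itint_le => //; [lra|exact: cont_const|].
    by move=> w _ _; rewrite Rmult_0_l.
  have exG a b : ex_RInt G a b by apply: ex_RInt_continuous => t _; exact: hG.
  have cG2 : cont (fun r => G (s * r + x i)).
    apply: (@cont_comp _ _ (fun r => s * r + x i) G) => // r.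
    by apply: ex_derive_continuous; auto_derive.
  apply: Rle_trans (_ : RInt (fun r => / s ^ k * G (s * r + x i)) 0 1 <= _).
    apply: RInt_le; [lra| | |].
    - by apply: itint_ex => //; lra.
    - apply: ex_RInt_continuous => t _; apply: cont_mult => //; exact: cont_const.
    - move=> r _; apply: Rle_trans (IH (ltnW hk) _) _; right; congr (_ * itint _ _ _ _ _).
      apply: functional_extensionality => j; rewrite /updn; case: eqP => [e|//].
      rewrite (_ : j = i); [ring|exact: ord_inj].
  rewrite RInt_scalR; last by apply: ex_RInt_continuous => t _; exact: cG2.
  have e : s * RInt (fun r => G (s * r + x i)) 0 1 = RInt G (x i) (x i + s).
    rewrite -RInt_scalR; last by apply: ex_RInt_continuous => t _; exact: cG2.
    have := RInt_comp_lin G s (x i) 0 1 (exG _ _).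
    by rewrite Rmult_0_r Rplus_0_l Rmult_1_r (Rplus_comm s) => <-.
  have le1 : RInt G (x i) (x i + s) <= RInt G 0 1.
    rewrite -(RInt_periodic (x i) hG pG).
    have <- : RInt G (x i) (x i + s) + RInt G (x i + s) (x i + 1) = RInt G (x i) (x i + 1).
      exact: (RInt_Chasles G).
    have : 0 <= RInt G (x i + s) (x i + 1) by apply: RInt_ge_0 => //; lra.
    lra.
  have le2 : RInt (fun r => G (s * r + x i)) 0 1 <= / s * RInt G 0 1.
    apply: (Rmult_le_reg_l s); first lra.
    by rewrite e -Rmult_assoc Rinv_r ?Rmult_1_l; lra.
  change (/ s ^ k * RInt (fun r => G (s * r + x i)) 0 1 <= / (s * s ^ k) * RInt G 0 1).
  rewrite Rinv_mult (Rmult_comm (/ s)) Rmult_assoc; apply: Rmult_le_compat_l => //.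
  left; apply: Rinv_0_lt_compat; apply: pow_lt; lra.
apply: Rle_trans (key n (leqnn n) _) _; right; congr (_ * _).
by apply: itint_indep => j; rewrite leqNgt ltn_ord.
Qed.

Lemma periodic_IZR n (f : pt n -> R) (x : pt n) i (k : Z) : periodic f ->
  f (upd x i (x i + IZR k)) = f x.
Proof.
move=> hf.
have hn (m : nat) y : f (upd y i (y i + INR m)) = f y.
  elim: m y => [|m IH] y; first by rewrite /= Rplus_0_r upd_id.
  rewrite S_INR -[RHS]IH -[RHS](hf _ i) upd_same upd_upd; congr (f (upd _ _ _)); ring.
case: k => [|p|p].
- exact: (hn O).
- rewrite (_ : Z.pos p = Z.of_nat (Pos.to_nat p)); last lia.
  by rewrite -INR_IZR_INZ; exact: hn.
- rewrite (_ : Z.neg p = (- Z.of_nat (Pos.to_nat p))%Z); last lia.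
  rewrite opp_IZR -INR_IZR_INZ -[LHS](hn (Pos.to_nat p)) upd_same upd_upd.
  rewrite (_ : x i + - INR _ + INR _ = x i); [by rewrite upd_id|ring].
Qed.

Lemma periodic_reduce n (x : pt n) :
  exists y : pt n, (forall i, 0 <= y i <= 1) /\ forall f, periodic f -> f x = f y.
Proof.
exists (fun i => frac_part (x i)); split.
  by move=> i; have := base_fp (x i); lra.
move=> f hf.
have key : forall k, (k <= n)%N ->
    f (fun j => if (j < k)%N then frac_part (x j) else x j) = f x.
  elim=> [|k IH] hk; first by congr f.
  rewrite -(IH (ltnW hk)); pose i := Ordinal hk.
  rewrite -[RHS](@periodic_IZR n f _ i (- Int_part (x i))%Z) //; congr f.
  apply: functional_extensionality => j; rewrite /upd ltnS leq_eqVlt.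
  case: eqP => e.
    have -> : j = i by apply: ord_inj.
    by rewrite eqxx ltnn opp_IZR /frac_part /=.
  by case: (eqVneq j i) => [e'|//]; case: e; rewrite e'.
rewrite -(key n (leqnn n)); congr f; apply: functional_extensionality => j.
by rewrite ltn_ord.
Qed.

Lemma cube_bounded n (f : pt n -> R) a b : cont f ->
  exists M, forall z, (forall i, a <= z i <= b) -> Rabs (f z) <= M.
Proof.
move=> hf; apply: (@cube_uniform n a b (fun z M => Rabs (f z) <= M)) => [z M M'|z _]; first lra.
have /cont_within_continuous h := hf z.
have [d [hd h1]] := h 1 Rlt_0_1.
exists (Rabs (f z) + 1), d; split => // w hw.
have h2 := h1 w I hw.
have -> : f w = f z + (f w - f z) by ring.
apply: Rle_trans (Rabs_triang _ _) _; lra.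
Qed.

Lemma periodic_bounded n (f : pt n -> R) : cont f -> periodic f ->
  exists M, forall z, Rabs (f z) <= M.
Proof.
move=> hf hp; have [M h] := cube_bounded 0 1 hf.
by exists M => z; have [y [hy e]] := periodic_reduce z; rewrite (e f) //; apply: h.
Qed.

Lemma slab_bounded d (T : R) (g : pt d -> R -> R) :
  cont (fun z : pt d * R => g z.1 z.2) ->
  exists M, forall x t, (forall i, 0 <= x i <= 1) -> 0 <= t <= T -> Rabs (g x t) <= M.
Proof.
move=> hg.
(* Time is divided by [T], so that the slab becomes a unit cube in dimension [d + 1]. *)
pose F (z : pt (d + 1)) := g (fun i => z (lshift 1 i)) (T * z (rshift d ord0)).
have hF : cont F.
  apply: (cont_comp2 (c := fun z : pt (d + 1) => (fun i => z (lshift 1 i)) : pt d)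
     (e := fun z : pt (d + 1) => T * z (rshift d ord0)) (f := g)) => //.
    by move=> z; apply: continuous_pt => i; exact: continuous_coord.
  apply: (@cont_mult _ (fun _ => T)); first exact: cont_const.
  by move=> z; exact: continuous_coord.
have [M h] := cube_bounded 0 1 hF.
exists M => y t hy ht.
pose s := if Req_EM_T T 0 then 0 else t / T.
have hs : 0 <= s <= 1 /\ T * s = t.
  rewrite /s; case: Req_EM_T => hT /=; first lra.
  split; last by field.
  have T0 : 0 < T by lra.
  split; first by apply: Rdiv_le_0_compat; lra.
  apply/Rle_div_l; lra.
pose z : pt (d + 1) := fun j => match split j with inl i => y i | inr _ => s end.
have e1 : F z = g y t.
  rewrite /F /z.
  have -> : (fun i : 'I_d => match split (lshift 1 i) with inl i0 => y i0 | inr _ => s end) = y.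
    by apply: functional_extensionality => i; rewrite (unsplitK (inl i)).
  by rewrite (unsplitK (inr ord0)) hs.2.
rewrite -e1; apply: h => j; rewrite /z; case: split => ?; [exact: hy|exact: hs.1].
Qed.

(** * A Sobolev inequality on the torus *)

(** Where [f] vanishes, the product rule needs only continuity of [g]. In [chain_rule] the factor
    [g] is a mean of partial derivatives, for which continuity is all that is assumed. *)
Lemma is_derive_mult0 (f g : R -> R) s l : f s = 0 -> continuous g s -> is_derive f s l ->
  is_derive (fun r => g r * f r) s (g s * l).
Proof.
move=> f0 hg /is_derive_Reals hf; apply/is_derive_Reals => eps he.
pose M := Rabs (g s) + 1 + Rabs l.
have M0 : 0 < M by rewrite /M; have := Rabs_pos (g s); have := Rabs_pos l; lra.
pose e := Rmin 1 (eps / (2 * M)).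
have e0 : 0 < e by apply: Rmin_pos; [lra|apply: Rdiv_lt_0_compat; lra].
have e1 : e <= 1 by exact: Rmin_l.
have e2 : e * (2 * M) <= eps.
  have := Rmin_r 1 (eps / (2 * M)); rewrite -/e => h.
  apply: Rle_trans (Rmult_le_compat_r (2 * M) _ _ _ h) _; first lra.
  right; field; lra.
have [d1 h1] := hf _ e0.
move: hg => /filterlim_locally /(_ (mkposreal e e0)) [d2 h2].
have d0 : 0 < Rmin d1 d2 by apply: Rmin_pos; exact: cond_pos.
exists (mkposreal _ d0) => h hn /= hd.
have k1 : Rabs ((f (s + h) - f s) / h - l) < e.
  by apply: h1 => //; apply: Rlt_le_trans hd _; exact: Rmin_l.
have k2 : Rabs (g (s + h) - g s) < e.
  apply: h2; rewrite /ball /= /AbsRing_ball /abs /minus /plus /opp /=.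
  rewrite (_ : s + h + - s = h); last ring.
  apply: Rlt_le_trans hd _; exact: Rmin_r.
rewrite f0 Rmult_0_r Rminus_0_r; rewrite f0 Rminus_0_r in k1.
have -> : g (s + h) * f (s + h) / h - g s * l =
   g (s + h) * (f (s + h) / h - l) + (g (s + h) - g s) * l by field.
apply: Rle_lt_trans (Rabs_triang _ _) _; rewrite !Rabs_mult.
have k3 : Rabs (g (s + h)) <= Rabs (g s) + 1.
  have -> : g (s + h) = g s + (g (s + h) - g s) by ring.
  apply: Rle_trans (Rabs_triang _ _) _; lra.
have p1 := Rabs_pos (g (s + h)); have p2 := Rabs_pos l.
have p3 := Rabs_pos (f (s + h) / h - l); have p4 := Rabs_pos (g (s + h) - g s).
apply: Rle_lt_trans (_ : (Rabs (g s) + 1) * e + e * Rabs l < _).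
  apply: Rplus_le_compat; first by apply: Rmult_le_compat; lra.
  by apply: Rmult_le_compat_r; lra.
have : e * M < eps by nra.
rewrite /M; lra.
Qed.

Section ChainRule.
Variables (n : nat) (F : pt n -> R) (dF : 'I_n -> pt n -> R).
Hypothesis dF_cont : forall i, cont (dF i).
Hypothesis F_der : forall i x, is_derive (fun r => F (upd x i r)) (x i) (dF i x).

(** Hadamard's formula: the quotient of the increment is a mean of the partial derivative along the
    segment, and so depends continuously on all variables. *)
Lemma upd_increment i z b :
  F (upd z i b) - F z = RInt (fun s => dF i (upd z i (z i + s * (b - z i)))) 0 1 * (b - z i).
Proof.
have hd r : is_derive (fun r => F (upd z i r)) r (dF i (upd z i r)).
  have := F_der i (upd z i r); rewrite upd_same => h.
  by apply: is_derive_ext h => t; rewrite upd_upd.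
have hc : cont (fun r => dF i (upd z i r)).
  apply: (@cont_comp _ _ (fun r => upd z i r : pt n)) => // r.
  by apply: continuous_upd; [exact: continuous_const|exact: continuous_id].
have h1 := is_RInt_derive (fun r => F (upd z i r)) _ (z i) b (fun x _ => hd x) (fun x _ => hc x).
have h2 := is_RInt_unique _ _ _ _ h1.
have -> : F (upd z i b) - F z = RInt (fun r => dF i (upd z i r)) (z i) b.
  by rewrite h2 upd_id.
have := RInt_comp_lin (fun r => dF i (upd z i r)) (b - z i) (z i) 0 1.
rewrite Rmult_0_r Rplus_0_l Rmult_1_r (_ : b - z i + z i = b); last ring.
move=> <-; last by apply: ex_RInt_continuous => t _; exact: hc.
rewrite Rmult_comm -RInt_scalR; last first.
  apply: ex_RInt_continuous => t _.
  apply: (@cont_comp _ _ (fun s => z i + s * (b - z i)) (fun r => dF i (upd z i r))) => // y.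
  by apply: ex_derive_continuous; auto_derive.
by apply: RInt_ext => s _; congr (_ * dF i (upd z i _)); ring.
Qed.

Lemma chain_rule (c : R -> pt n) (c' : pt n) s :
  (forall i, is_derive (fun r => c r i) s (c' i)) ->
  is_derive (fun r => F (c r)) s (sumI (fun i => dF i (c s) * c' i)).
Proof.
move=> hc.
(* [mix k] moves the first [k] coordinates along the curve and freezes the others at their values at
   [s]; raising [k] by one adds one increment of the form treated by [is_derive_mult0]. *)
pose mix k r : pt n := fun j => if (j < k)%N then c r j else c s j.
have mixs k : mix k s = c s by apply: functional_extensionality => j; rewrite /mix; case: (j < k)%N.
have cmix k : continuous (fun r => mix k r) s.
  apply: continuous_pt => j; rewrite /mix; case: (j < k)%N; last exact: continuous_const.
  by apply: ex_derive_continuous; exists (c' j).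
have key : forall k, (k <= n)%N -> is_derive (fun r => F (mix k r)) s
    (sumI (fun i => if (i < k)%N then dF i (c s) * c' i else 0)).
  elim=> [|k IH] hk.
    rewrite sumI_0; exact: (@is_derive_const _ _ (F (c s)) s).
  pose i := Ordinal hk.
  pose G (q : pt n * R) := RInt (fun t => dF i (upd q.1 i (q.1 i + t * (q.2 - q.1 i)))) 0 1.
  have hG : cont G.
    apply: (@cont_RInt _ (fun q t => dF i (upd q.1 i (q.1 i + t * (q.2 - q.1 i))))); first lra.
    have c11 : cont (fun z : pt n * R * R => z.1.1 i).
      move=> z; apply: (@continuous_coord_comp _ n (fun z : pt n * R * R => z.1.1)).
      by apply: continuous_fst_comp; exact: cont_fst.
    apply: (@cont_comp _ _ (fun z : pt n * R * R => upd z.1.1 i (z.1.1 i + z.2 * (z.1.2 - z.1.1 i)) : pt n)) => // z.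
    apply: continuous_upd; first by apply: continuous_fst_comp; exact: cont_fst.
    apply: (@cont_plus _ (fun z : pt n * R * R => z.1.1 i) (fun z => z.2 * (z.1.2 - z.1.1 i))) => //.
    apply: (@cont_mult _ (fun z : pt n * R * R => z.2)) => [y|]; first exact: cont_snd.
    by apply: cont_minus => // y; apply: continuous_snd_comp; exact: cont_fst.
  apply: (is_derive_ext (fun r => F (mix k r) + G (mix k r, c r i) * (c r i - c s i))).
    move=> r.
    have e : mix k.+1 r = upd (mix k r) i (c r i).
      apply: functional_extensionality => j; rewrite /mix /upd ltnS leq_eqVlt.
      case: (eqVneq j i) => [->|ne]; first by rewrite eqxx.
      by case: eqP => [e|//]; case/eqP: ne; apply: ord_inj.
    have := upd_increment i (mix k r) (c r i); rewrite -e.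
    have -> : mix k r i = c s i by rewrite /mix ltnn.
    move=> h; rewrite /G /=.
    have -> : mix k r i = c s i by rewrite /mix ltnn.
    lra.
  have -> : sumI (fun i => if (i < k.+1)%N then dF i (c s) * c' i else 0) =
     sumI (fun i => if (i < k)%N then dF i (c s) * c' i else 0) + G (mix k s, c s i) * c' i.
    have -> : G (mix k s, c s i) = dF i (c s).
      rewrite /G mixs /= (RInt_ext _ (fun _ => dF i (c s))).
        by rewrite RInt_const /scal /= /mult /=; ring.
      by move=> t _; rewrite Rminus_diag Rmult_0_r Rplus_0_r upd_id.
    rewrite -(sumI_delta (fun i => dF i (c s) * c' i) i) -sumI_plus; apply: sumI_ext => j.
    rewrite ltnS leq_eqVlt; case: (eqVneq j i) => [->|ne].
      by rewrite eqxx ltnn /=; ring.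
    by case: eqP => [e|_] /=; [case/eqP: ne; apply: ord_inj|case: (j < k)%N; ring].
  apply: (@is_derive_plus _ _ (fun r => F (mix k r))).
    exact: IH (ltnW hk).
  apply: (@is_derive_mult0 (fun r => c r i - c s i) (fun r => G (mix k r, c r i))).
  - by rewrite Rminus_diag.
  - apply: (@continuous_comp_2 _ _ _ _ (fun r => mix k r) (fun r => c r i) (fun a b => G (a, b))).
    + exact: cmix.
    + by apply: ex_derive_continuous; exists (c' i).
    + apply: (continuous_ext G); last exact: hG.
      by case.
  - rewrite -[c' i]Rminus_0_r; apply: (@is_derive_minus _ _ (fun r => c r i)) => //.
    exact: is_derive_const.
have := key n (leqnn n).
rewrite (sumI_ext (g := fun i => dF i (c s) * c' i)); last by move=> i; rewrite ltn_ord.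
apply: is_derive_ext => r; congr F.
by apply: functional_extensionality => j; rewrite /mix ltn_ord.
Qed.

End ChainRule.

Lemma sumI_sqr n (a : 'I_n -> R) : sumI a * sumI a <= INR n * sumI (fun i => a i * a i).
Proof.
rewrite -(sumI_scal (INR n)).
have -> : sumI a * sumI a = sumI (fun i => sumI (fun j => a i * a j)).
  by rewrite -sumI_scal; apply: sumI_ext => i; rewrite sumI_scal Rmult_comm.
have -> : sumI (fun i => INR n * (a i * a i)) =
   sumI (fun i => sumI (fun j => / 2 * (a i * a i) + / 2 * (a j * a j))).
  rewrite (sumI_ext (f := fun i => sumI (fun j => / 2 * (a i * a i) + / 2 * (a j * a j)))
    (g := fun i => INR n * (/ 2 * (a i * a i)) + sumI (fun j => / 2 * (a j * a j)))); last first.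
    by move=> i; rewrite sumI_plus sumI_const.
  rewrite sumI_plus sumI_const -sumI_scal -sumI_plus; apply: sumI_ext => i; field.
apply: sumI_le => i; apply: sumI_le => j.
have := Rle_0_sqr (a i - a j); rewrite /Rsqr; lra.
Qed.

Lemma powr_sum_le a b p : 0 <= a -> 0 <= b -> 0 <= p ->
  powr (a + b) p <= powr 2 p * (powr a p + powr b p).
Proof.
move=> ha hb hp.
have k a' b' : 0 <= a' -> 0 <= b' -> a' <= b' -> powr (a' + b') p <= powr 2 p * (powr a' p + powr b' p).
  move=> ha' hb' h; apply: Rle_trans (_ : powr (2 * b') p <= _); first by apply: powr_le; lra.
  rewrite powr_mult; try lra; have := powr_ge0 a' p; have := powr_ge0 2 p; nra.
case: (Rle_dec a b) => h; first exact: k.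
by rewrite Rplus_comm (Rplus_comm (powr a p)); apply: k; lra.
Qed.

Lemma torint_jensen n (f : pt n -> R) p : 1 <= p -> cont f -> (forall x, 0 <= f x) ->
  powr (torint f) p <= torint (fun x => powr (f x) p).
Proof.
move=> hp hf f0.
apply: (@jensen _ (fun _ => True) cont) => //.
- by move=> u v c e hu hv; apply: cont_plus; apply: cont_mult => //; exact: cont_const.
- move=> u v c e hu hv; rewrite /torint boxint_plus ?boxint_scal //; try lra;
  by apply: cont_mult => //; exact: cont_const.
- by move=> u v hu hv h; apply: boxint_le => //; [lra|move=> w _; exact: h].
- exact: cont_const.
- exact: boxint_const.
- apply: cont_powr => //; lra.
Qed.

Lemma RInt01_jensen (f : R -> R) p : 1 <= p -> cont f -> (forall x, 0 < x < 1 -> 0 <= f x) ->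
  powr (RInt f 0 1) p <= RInt (fun x => powr (f x) p) 0 1.
Proof.
move=> hp hf f0.
have ex g : cont g -> ex_RInt g 0 1 by move=> hg; apply: ex_RInt_continuous => t _; exact: hg.
apply: (@jensen _ (fun x => 0 < x < 1) cont (fun f => RInt f 0 1)) => //.
- by move=> u v c e hu hv; apply: cont_plus; apply: cont_mult => //; exact: cont_const.
- move=> u v c e hu hv; rewrite RInt_plusR ?RInt_scalR //; apply: ex => //;
  by apply: cont_mult => //; exact: cont_const.
- by move=> u v hu hv h; apply: RInt_le => //; [lra|exact: ex|exact: ex].
- exact: cont_const.
- by rewrite RInt_const /scal /= /mult /=; ring.
- apply: cont_powr => //; lra.
Qed.

Section Sobolev.
Variables (n : nat) (p : R) (K : nat).
Hypothesis hp : 2 < p.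
Hypothesis hK : (0 < K)%N.
Hypothesis hpK : INR K * (INR n * (/ 2 - / p)) <= INR K - 1.
Variables (w : pt n -> R) (dw : 'I_n -> pt n -> R).
Hypothesis w_cont : cont w.
Hypothesis w_per : periodic w.
Hypothesis w_ge0 : forall x, 0 <= w x.
Hypothesis dw_cont : forall i, cont (dw i).
Hypothesis dw_per : forall i, periodic (dw i).
Hypothesis w_der : forall i x, is_derive (fun r => w (upd x i r)) (x i) (dw i x).

Let h x := sumI (fun i => Rabs (dw i x)).
Let mv (x : pt n) (s : R) (y : pt n) : pt n := fun i => x i + s ^ K * y i.

Let h_cont : cont h.
Proof. by apply: cont_sumI => i; apply: cont_Rabs. Qed.

Let h_per : periodic h.
Proof. by move=> x i; apply: sumI_ext => j; rewrite dw_per. Qed.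

Let h_ge0 x : 0 <= h x.
Proof. by apply: sumI_ge0 => i; exact: Rabs_pos. Qed.

Let pow_cont k : cont (fun s : R => s ^ k).
Proof. by move=> s; apply: ex_derive_continuous; auto_derive. Qed.

Let mv_cont {U : UniformSpace} (x : U -> pt n) (s : U -> R) (y : U -> pt n) :
  (forall z, continuous x z) -> cont s -> (forall z, continuous y z) ->
  forall z, continuous (fun u => mv (x u) (s u) (y u)) z.
Proof.
move=> hx hs hy z; apply: continuous_pt => i; move: z.
apply: cont_plus; first by move=> z; exact: continuous_coord_comp.
apply: cont_mult; first exact: (cont_comp (f := fun s => s ^ K)).
by move=> z; exact: continuous_coord_comp.
Qed.

(** Bounds the speed in [s] of the mean of [w] over the cube at [x] of side [s ^ K]: its points move
    with velocity [INR K * s ^ K.-1 * y], and every coordinate of [y] lies in [[0, 1]]. *)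
Let phi (s : R) x := INR K * s ^ K.-1 * boxint 0 1 (fun y => h (mv x s y)).

Let phi_cont : cont (fun q : pt n * R => phi q.2 q.1).
Proof.
apply: cont_mult.
  apply: cont_mult; first exact: cont_const.
  apply: (cont_comp (f := fun s => s ^ K.-1)) => //; move=> z; exact: cont_snd.
apply: (@boxint_cont _ n 0 1 (fun q y => h (mv q.1 q.2 y))); first lra.
apply: cont_comp => //; apply: mv_cont.
- by move=> z; apply: continuous_fst_comp; exact: cont_fst.
- by move=> z; apply: continuous_snd_comp; exact: cont_fst.
- by move=> z; exact: cont_snd.
Qed.

Let pointwise_bound x : w x <= torint w + RInt (fun s => phi s x) 0 1.
Proof.
pose W' s := boxint 0 1 (fun y => sumI (fun i => dw i (mv x s y) * (INR K * s ^ K.-1 * y i))).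
have cF' : cont (fun z : R * pt n => sumI (fun i => dw i (mv x z.1 z.2) * (INR K * z.1 ^ K.-1 * z.2 i))).
  apply: cont_sumI => i; apply: cont_mult.
    apply: (cont_comp (f := dw i)) => //; apply: mv_cont => z; [exact: continuous_const|exact: cont_fst|exact: cont_snd].
  apply: cont_mult; last by move=> z; apply: continuous_coord_comp; exact: cont_snd.
  apply: cont_mult; first exact: cont_const.
  by apply: (@cont_comp _ _ (fun z : R * pt n => z.1) (fun s => s ^ K.-1)) => // z; exact: cont_fst.
have hd s : -1 < s < 2 -> is_derive (fun s => boxint 0 1 (fun y => w (mv x s y))) s (W' s).
  move=> hs; apply: (@is_derive_boxint n (fun s y => w (mv x s y))
      (fun s y => sumI (fun i => dw i (mv x s y) * (INR K * s ^ K.-1 * y i))) 0 1 (-1) 2) => //; first lra.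
    move=> s' _; apply: cont_comp => //; apply: mv_cont => z; try exact: continuous_const.
    exact: cont_id.
  move=> s' y _; apply: (chain_rule dw_cont w_der) => i.
  rewrite /mv; auto_derive => //; ring.
have cW' : cont W'.
  by apply: (@boxint_cont _ n 0 1 (fun s y => sumI (fun i => dw i (mv x s y) * (INR K * s ^ K.-1 * y i)))) => //; lra.
have h1 := is_RInt_derive (fun s => boxint 0 1 (fun y => w (mv x s y))) W' 0 1.
rewrite Rmin_left ?Rmax_right in h1; try lra.
have h2 := is_RInt_unique _ _ _ _ (h1 (fun s hs => hd s ltac:(lra)) (fun s _ => cW' s)).
have e0 : boxint 0 1 (fun y => w (mv x 0 y)) = w x.
  rewrite -[RHS](@boxint_const n (w x)); congr (boxint _ _ _).
  apply: functional_extensionality => y; congr w; apply: functional_extensionality => i.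
  by rewrite /mv pow_ne_zero; [ring|case: (K) hK].
have e1 : boxint 0 1 (fun y => w (mv x 1 y)) = torint w.
  rewrite -(torint_shift x w_cont w_per); congr (boxint _ _ _).
  apply: functional_extensionality => y; congr w; apply: functional_extensionality => i.
  by rewrite /mv pow1; ring.
rewrite e0 e1 /minus /plus /opp /= in h2.
have cphi : cont (fun s => phi s x) by apply: (@cont_slice _ _ (fun x s => phi s x) x phi_cont).
have h3 : RInt (fun s => - phi s x) 0 1 <= RInt W' 0 1.
  apply: RInt_le; [lra| | |].
  - by apply: ex_RInt_continuous => t _; apply: cont_opp.
  - by apply: ex_RInt_continuous => t _; exact: cW'.
  move=> s hs.
  have cI : cont (fun y => h (mv x s y)).
    by apply: cont_comp => //; apply: mv_cont => z; [exact: continuous_const|exact: continuous_const|exact: cont_id].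
  rewrite /phi -boxint_scal //; try lra.
  have cI2 := cont_mult (@cont_const _ (INR K * s ^ K.-1)) cI.
  rewrite -boxint_opp //; try lra.
  apply: boxint_le; [lra|exact: cont_opp| |].
    exact: (@cont_slice _ _ (fun (s : R) (y : pt n) => sumI (fun i => dw i (mv x s y) * (INR K * s ^ K.-1 * y i))) s cF').
  move=> y hy; rewrite /h -sumI_scal -sumI_opp; apply: sumI_le => i.
  have k0 : 0 <= INR K * s ^ K.-1 by apply: Rmult_le_pos; [exact: pos_INR|apply: pow_le; lra].
  have := hy i; move: k0; set k := INR K * _ => k0 hyi.
  have := Rabs_pos (dw i (mv x s y)); have : - dw i (mv x s y) <= Rabs (dw i (mv x s y)).
    by rewrite -Rabs_Ropp; exact: Rle_abs.
  set A := Rabs _; set B := dw i _ => hA1 hA2.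
  have : 0 <= k * (A + B * y i); last by move=> ?; lra.
  apply: Rmult_le_pos => //; nra.
have e4 : RInt (fun s => - phi s x) 0 1 = - RInt (fun s => phi s x) 0 1.
  by apply: (@RInt_opp R_CompleteNormedModule); apply: ex_RInt_continuous => t _; exact: cphi.
have : RInt W' 0 1 = torint w + - w x by exact: h2.
lra.
Qed.

Let N := torint (fun x => h x * h x).

Let h2_cont : cont (fun x => h x * h x).
Proof. exact: cont_mult. Qed.

Let N_ge0 : 0 <= N.
Proof. apply: boxint_ge0 => //; [lra|move=> x _; have := h_ge0 x; nra]. Qed.

(** The mean [H] of [h] satisfies [H^2 <= H2], where [H2] is at most [N] divided by the volume of
    the cube and has integral [N]. So [p - 2] of the [p] powers of [H] are estimated by a supremum
    and the other two by the integral. The resulting exponent of [s], [(K - 1) p - K n (p / 2 - 1)],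
    is nonnegative by [hpK]. *)
Let layer_bound s : 0 < s < 1 -> torint (fun x => powr (phi s x) p) <= powr (INR K) p * powr N (p / 2).
Proof.
move=> hs.
pose H x := boxint 0 1 (fun y => h (mv x s y)).
pose H2 x := boxint 0 1 (fun y => h (mv x s y) * h (mv x s y)).
have cmv : cont (fun q : pt n * pt n => h (mv q.1 s q.2)).
  by apply: cont_comp => //; apply: mv_cont => z; [exact: cont_fst|exact: continuous_const|exact: cont_snd].
have cmv2 : cont (fun q : pt n * pt n => h (mv q.1 s q.2) * h (mv q.1 s q.2)) by exact: cont_mult.
have cH : cont H by apply: (@boxint_cont _ n 0 1 (fun x y => h (mv x s y))) => //; lra.
have cH2 : cont H2 by apply: (@boxint_cont _ n 0 1 (fun x y => h (mv x s y) * h (mv x s y))) => //; lra.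
have H0 x : 0 <= H x.
  by apply: boxint_ge0; [lra|exact: (@cont_slice _ _ (fun x y => h (mv x s y)) x cmv)|move=> y _; exact: h_ge0].
have sK : 0 < s ^ K <= 1.
  split; first by apply: pow_lt; lra.
  by rewrite -(pow1 K); apply: pow_incr; lra.
have HH2 x : H x * H x <= H2 x.
  rewrite -powr_2 //; apply: Rle_trans (@torint_jensen n (fun y => h (mv x s y)) 2 _ _ _) _; [lra| | |].
  - exact: (@cont_slice _ _ (fun x y => h (mv x s y)) x cmv).
  - by move=> y; exact: h_ge0.
  right; congr (boxint _ _ _); apply: functional_extensionality => y.
  by rewrite powr_2.
have H2N x : H2 x <= / (s ^ K) ^ n * N.
  apply: (@boxint_scaled_le n (fun x => h x * h x)) => //.
    by move=> y i; rewrite h_per.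
  by move=> y; have := h_ge0 y; nra.
have tH2 : torint H2 = N.
  rewrite /torint /H2 boxint_swap //; try lra.
  rewrite (_ : (fun y => _) = fun _ => N); first exact: boxint_const.
  apply: functional_extensionality => y.
  apply: (@torint_shift n (fun x => h x * h x) (fun i => s ^ K * y i)) => //.
  by move=> z i; rewrite h_per.
set Q := / (s ^ K) ^ n * N in H2N.
have Q0 : 0 <= Q.
  by apply: Rmult_le_pos => //; left; apply: Rinv_0_lt_compat; apply: pow_lt; lra.
have p21 : 0 < p / 2 - 1 by lra.
have b1 x : powr (H x) p <= powr Q (p / 2 - 1) * H2 x.
  rewrite (_ : powr (H x) p = powr (H x * H x) (p / 2)); last first.
    by rewrite -powr_2 // powr_powr //; congr powr; field.
  have HHx : 0 <= H x * H x by have := H0 x; nra.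
  rewrite (_ : p / 2 = (p / 2 - 1) + 1); last ring.
  rewrite powr_plus0; try lra.
  rewrite powr_1 // (_ : p / 2 - 1 + 1 - 1 = p / 2 - 1); last ring.
  apply: Rmult_le_compat => //; first exact: powr_ge0.
  by apply: powr_le; [lra|apply: Rle_trans (HH2 x) (H2N x)].
have k0 : 0 <= INR K * s ^ K.-1 by apply: Rmult_le_pos; [exact: pos_INR|apply: pow_le; lra].
have b2 : torint (fun x => powr (phi s x) p) <=
    powr (INR K * s ^ K.-1) p * (powr Q (p / 2 - 1) * N).
  rewrite -tH2 /torint -boxint_scal //; [|lra].
  rewrite -boxint_scal; [|lra|apply: cont_mult => //; exact: cont_const].
  apply: boxint_le; [lra| | |].
  - apply: cont_powr; first lra.
    exact: (@cont_mult _ (fun _ => INR K * s ^ K.-1) H (@cont_const _ _) cH).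
  - apply: cont_mult; first exact: cont_const.
    by apply: cont_mult => //; exact: cont_const.
  move=> x _; rewrite /phi -/(H x) powr_mult //.
  by apply: Rmult_le_compat_l; [exact: powr_ge0|exact: b1].
apply: Rle_trans b2 _.
rewrite powr_mult; [|exact: pos_INR|by apply: pow_le; lra].
rewrite /Q powr_mult //; last by left; apply: Rinv_0_lt_compat; apply: pow_lt; lra.
have -> : powr N (p / 2) = powr N (p / 2 - 1) * N.
  rewrite -{3}(powr_1 N_ge0) -powr_plus0; try lra; congr powr; ring.
have pows k : s ^ k = powr s (INR k).
  by rewrite powr_Rpower ?Rpower_pow //; lra.
have inv a : / powr s a = powr s (- a).
  by rewrite !powr_Rpower; try lra; rewrite Rpower_Ropp.
rewrite -pow_mult !pows inv !powr_powr; try lra.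
have key : powr s (INR K.-1 * p) * powr s (- INR (K * n) * (p / 2 - 1)) <= 1.
  rewrite -powr_plus; last lra.
  have e0 : 0 <= INR K.-1 * p + - INR (K * n) * (p / 2 - 1).
    have -> : INR K.-1 = INR K - 1 by case: (K) hK => [//|k] _; rewrite S_INR /=; ring.
    rewrite mult_INR.
    have : p * (INR K * (INR n * (/ 2 - / p))) <= p * (INR K - 1) by apply: Rmult_le_compat_l; lra.
    rewrite (_ : p * (INR K * (INR n * (/ 2 - / p))) = INR K * INR n * (p / 2 - 1)); last by field; lra.
    lra.
  case: e0 => e0; last by rewrite -e0 powr_exp0; lra.
  apply: Rle_trans (_ : powr 1 (INR K.-1 * p + - INR (K * n) * (p / 2 - 1)) <= _).
    by apply: powr_le; lra.
  by rewrite powr_base1; lra.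
move: key; set A := powr s _; set B := powr s _ => key.
set C := powr (INR K) p; set D := powr N _.
have C0 : 0 <= C by exact: powr_ge0.
have D0 : 0 <= D * N by apply: Rmult_le_pos => //; exact: powr_ge0.
have -> : C * A * (B * D * N) = (C * (D * N)) * (A * B) by ring.
have : 0 <= C * (D * N) by exact: Rmult_le_pos.
nra.
Qed.

Let E := torint (fun x => sumI (fun i => dw i x * dw i x) + w x * w x).

Lemma sobolev_aux : torint (fun x => powr (w x) p) <=
  powr 2 p * (1 + powr (INR K) p * powr (INR n) (p / 2)) * powr E (p / 2).
Proof.
have cphix x : cont (fun s => phi s x) by apply: (@cont_slice _ _ (fun x s => phi s x) x phi_cont).
have cw2 : cont (fun x => w x * w x) by exact: cont_mult.
have cd2 : cont (fun x => sumI (fun i => dw i x * dw i x)) by apply: cont_sumI => i; exact: cont_mult.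
have cI : cont (fun x => RInt (fun s => phi s x) 0 1) by apply: (@cont_RInt _ (fun x s => phi s x)) => //; lra.
have cpp : cont (fun q : pt n * R => powr (phi q.2 q.1) p) by apply: cont_powr => //; lra.
have cIp : cont (fun x => RInt (fun s => powr (phi s x) p) 0 1).
  by apply: (@cont_RInt _ (fun x s => powr (phi s x) p)) => //; lra.
have phi0 s x : 0 <= s -> 0 <= phi s x.
  move=> hs; apply: Rmult_le_pos.
    by apply: Rmult_le_pos; [exact: pos_INR|exact: pow_le].
  apply: boxint_ge0; [lra| |by move=> y _; exact: h_ge0].
  by apply: cont_comp => //; apply: mv_cont => z; [exact: continuous_const|exact: continuous_const|exact: cont_id].
have tw0 : 0 <= torint w by apply: boxint_ge0 => //; lra.
have I0 x : 0 <= RInt (fun s => phi s x) 0 1.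
  apply: RInt_ge_0; [lra|by apply: ex_RInt_continuous => t _; exact: cphix|].
  by move=> s hs; apply: phi0; lra.
have E1 : torint (fun x => w x * w x) <= E.
  apply: boxint_le => //; [lra|exact: cont_plus|].
  move=> x _; have := @sumI_ge0 n (fun i => dw i x * dw i x) (fun i => Rle_0_sqr _); lra.
have E2 : N <= INR n * E.
  rewrite /E /torint -boxint_scal //; [|lra|exact: cont_plus].
  apply: boxint_le => //; [lra|by apply: cont_mult; [exact: cont_const|exact: cont_plus]|].
  move=> x _; apply: Rle_trans (sumI_sqr _) _.
  apply: Rmult_le_compat_l; first exact: pos_INR.
  rewrite (sumI_ext (g := fun i => dw i x * dw i x)); last by move=> i; rewrite -Rabs_mult Rabs_pos_eq //; nra.
  nra.
have E0 : 0 <= E by apply: Rle_trans E1; apply: boxint_ge0 => //; [lra|move=> x _; nra].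
have b1 x : powr (w x) p <= powr 2 p * (powr (torint w) p + RInt (fun s => powr (phi s x) p) 0 1).
  apply: Rle_trans (_ : powr (torint w + RInt (fun s => phi s x) 0 1) p <= _).
    by apply: powr_le; [lra|exact: pointwise_bound].
  apply: Rle_trans (powr_sum_le _ _ _) _ => //; first lra.
  apply: Rmult_le_compat_l; first exact: powr_ge0.
  apply: Rplus_le_compat_l; apply: RInt01_jensen => //; first lra.
  by move=> s hs; apply: phi0; lra.
apply: Rle_trans (_ : torint (fun x => powr 2 p * (powr (torint w) p + RInt (fun s => powr (phi s x) p) 0 1)) <= _).
  apply: boxint_le; [lra|by apply: cont_powr => //; lra| |by move=> x _; exact: b1].
  apply: cont_mult; first exact: cont_const.
  by apply: cont_plus => //; exact: cont_const.
have c0 : cont (fun x : pt n => powr (torint w) p) by exact: cont_const.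
rewrite /torint boxint_scal; [|lra|exact: cont_plus].
rewrite boxint_plus //; [|lra]; rewrite boxint_const -/(torint w).
rewrite (boxint_RInt_swap (G := fun x s => powr (phi s x) p)) //; try lra.
rewrite Rmult_assoc; apply: Rmult_le_compat_l; first exact: powr_ge0.
rewrite Rmult_plus_distr_r Rmult_1_l; apply: Rplus_le_compat.
  rewrite (_ : powr (torint w) p = powr (powr (torint w) 2) (p / 2)); last first.
    by rewrite powr_powr //; congr powr; field.
  apply: powr_le; first lra.
  apply: Rle_trans (@torint_jensen n w 2 _ _ _) _ => //; first lra.
  rewrite (_ : (fun x => powr (w x) 2) = fun x => w x * w x) //.
  by apply: functional_extensionality => x; rewrite powr_2.
apply: Rle_trans (_ : RInt (fun _ => powr (INR K) p * powr N (p / 2)) 0 1 <= _).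
  apply: RInt_le; [lra| |exact: ex_RInt_const|exact: layer_bound].
  apply: ex_RInt_continuous => t _.
  apply: (@boxint_cont _ n 0 1 (fun s x => powr (phi s x) p)); first lra.
  by apply: (cont_comp2 (c := fun q : R * pt n => q.2) (e := fst) (f := fun x s => powr (phi s x) p)) => // z;
    [exact: cont_snd|exact: cont_fst].
rewrite RInt_const /scal /= /mult /= Rminus_0_r Rmult_1_l Rmult_assoc.
apply: Rmult_le_compat_l; first exact: powr_ge0.
rewrite -powr_mult //; last exact: pos_INR.
by apply: powr_le; lra.
Qed.

End Sobolev.

(* With [f_s(x)] the mean of [w] over [x + [0, s^K]^n], write [w = f_0] as [f_1]
   minus the integral of [d/ds f_s]; the exponent [K] absorbs the singularity of
   the layers at [s = 0]. *)
Lemma sobolev n p : 2 < p -> INR n * (/ 2 - / p) < 1 ->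
  exists C, 0 < C /\ forall (w : pt n -> R) (dw : 'I_n -> pt n -> R),
    cont w -> periodic w -> (forall x, 0 <= w x) ->
    (forall i, cont (dw i)) -> (forall i, periodic (dw i)) ->
    (forall i x, is_derive (fun r => w (upd x i r)) (x i) (dw i x)) ->
    torint (fun x => powr (w x) p) <=
      C * powr (torint (fun x => sumI (fun i => dw i x * dw i x) + w x * w x)) (p / 2).
Proof.
move=> hp hn.
set g := INR n * (/ 2 - / p) in hn.
(* [g] measures the singularity of a layer; [K > / (1 - g)] means [K * g < K - 1], so that the
   weight [s ^ K.-1] absorbs it. *)
have [K hK] := INR_unbounded (/ (1 - g)).
have K0 : 0 < INR K by apply: Rlt_trans hK; apply: Rinv_0_lt_compat; lra.
have hpK : INR K * g <= INR K - 1.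
  have : 1 < INR K * (1 - g); last lra.
  apply: (Rmult_lt_reg_r (/ (1 - g))); first by apply: Rinv_0_lt_compat; lra.
  by rewrite Rmult_assoc Rinv_r ?Rmult_1_r ?Rmult_1_l //; lra.
exists (powr 2 p * (1 + powr (INR K) p * powr (INR n) (p / 2))); split.
  apply: Rmult_lt_0_compat; first by apply: powr_gt0; lra.
  have := Rmult_le_pos _ _ (powr_ge0 (INR K) p) (powr_ge0 (INR n) (p / 2)); lra.
move=> w dw *; apply: sobolev_aux => //.
by apply/ltP; apply: INR_lt; rewrite /=.
Qed.

(** * Smooth functions on a space-time slab *)

Definition slabcont {d} (g : pt d -> R -> R) : Prop := cont (fun z : pt d * R => g z.1 z.2).

(* Directions of space-time: [Some i] is the i-th space variable, [None] is time. *)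
Definition mvx {d} (o : option 'I_d) (r : R) (x : pt d) : pt d :=
  match o with Some i => upd x i r | None => x end.
Definition mvt {d} (o : option 'I_d) (r t : R) : R :=
  match o with Some _ => t | None => r end.
Definition cor {d} (o : option 'I_d) (x : pt d) (t : R) : R :=
  match o with Some i => x i | None => t end.
Definition DD {d} (o : option 'I_d) (f : pt d -> R -> R) (x : pt d) (t : R) : R :=
  Derive (fun r => f (mvx o r x) (mvt o r t)) (cor o x t).
Definition exD {d} (o : option 'I_d) (f : pt d -> R -> R) (x : pt d) (t : R) : Prop :=
  ex_derive (fun r => f (mvx o r x) (mvt o r t)) (cor o x t).

Lemma mvx_cor {d} (o : option 'I_d) x t : mvx o (cor o x t) x = x.
Proof. by case: o => [i|] //=; rewrite upd_id. Qed.

Lemma mvt_cor {d} (o : option 'I_d) x t : mvt o (cor o x t) t = t.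
Proof. by case: o. Qed.

Section Slab.
Variables (d : nat) (T : R).
Implicit Types (f g : pt d -> R -> R) (o : option 'I_d).

(* Solutions are controlled only for [0 < t < T]: there [f] must be periodic and
   agree with a function continuous on the whole space, which bounds it and gives
   sense to time integrals up to the ends; [SM k] asks this of [f] and of all its
   derivatives up to order [k]. *)
Definition ext0 f : Prop :=
  (forall x t i, 0 < t < T -> f (upd x i (x i + 1)) t = f x t) /\
  exists g, slabcont g /\ forall x t, 0 < t < T -> f x t = g x t.

Fixpoint SM (k : nat) f : Prop :=
  ext0 f /\
  match k with
  | O => True
  | S k' => (forall o x t, 0 < t < T -> exD o f x t) /\ forall o, SM k' (DD o f)
  end.

Lemma near_slab o (x : pt d) t : 0 < t < T -> locally (cor o x t) (fun r => 0 < mvt o r t < T).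
Proof.
move=> ht; case: o => [i|] /=; first exact: filter_forall.
have h1 : 0 < Rmin t (T - t) by apply: Rmin_pos; lra.
exists (mkposreal _ h1) => y; rewrite /ball /= /AbsRing_ball /abs /minus /plus /opp /=.
have := Rmin_l t (T - t); have := Rmin_r t (T - t); move=> ? ? /Rabs_def2; lra.
Qed.

Lemma DD_ext o f g x t : (forall x t, 0 < t < T -> f x t = g x t) -> 0 < t < T ->
  DD o f x t = DD o g x t.
Proof.
move=> h ht; apply: Derive_ext_loc.
by apply: filter_imp (near_slab o x ht) => r hr; apply: h.
Qed.

Lemma exD_ext o f g x t : (forall x t, 0 < t < T -> f x t = g x t) -> 0 < t < T ->
  exD o f x t -> exD o g x t.
Proof.
move=> h ht; apply: ex_derive_ext_loc.
by apply: filter_imp (near_slab o x ht) => r hr; apply: h.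
Qed.

Lemma ext0_ext f g : (forall x t, 0 < t < T -> f x t = g x t) -> ext0 f -> ext0 g.
Proof.
move=> h [hp [k [hk e]]]; split.
  by move=> x t i ht; rewrite -!h //; apply: hp.
by exists k; split => // x t ht; rewrite -h //; apply: e.
Qed.

Lemma SM_ext k f g : (forall x t, 0 < t < T -> f x t = g x t) -> SM k f -> SM k g.
Proof.
elim: k f g => [|k IH] f g h [h0 h1]; first by split => //; apply: ext0_ext h0.
case: h1 => h1 h2; split; first by apply: ext0_ext h0.
split; first by move=> o x t ht; apply: (exD_ext h) => //; apply: h1.
move=> o; apply: IH (h2 o) => x t ht; exact: DD_ext.
Qed.

Lemma SM_ext0 k f : SM k f -> ext0 f.
Proof. by case: k => [|k] []. Qed.

Lemma SM_S k f : SM k.+1 f -> SM k f.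
Proof.
elim: k f => [|k IH] f; first by case.
by move=> [h0 [h1 h2]]; split => //; split => // o; apply: IH; apply: h2.
Qed.

Lemma SM_le k j f : (j <= k)%N -> SM k f -> SM j f.
Proof.
elim: k => [|k IH]; first by case: j.
rewrite leq_eqVlt => /orP [/eqP -> //|h] hf.
by apply: IH => //; apply: SM_S.
Qed.

Lemma SM_ex k f o x t : SM k.+1 f -> 0 < t < T -> exD o f x t.
Proof. by move=> [_ [h _]]; apply: h. Qed.

Lemma SM_DD k f o : SM k.+1 f -> SM k (DD o f).
Proof. by move=> [_ [_ h]]; apply: h. Qed.

Lemma SM_intro k f (Df : option 'I_d -> pt d -> R -> R) : ext0 f ->
  (forall o x t, 0 < t < T ->
     is_derive (fun r => f (mvx o r x) (mvt o r t)) (cor o x t) (Df o x t)) ->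
  (forall o, SM k (Df o)) -> SM k.+1 f.
Proof.
move=> h0 hd hD; split => //; split; first by move=> o x t ht; eexists; apply: hd.
move=> o; apply: SM_ext (hD o) => x t ht; symmetry; apply: is_derive_unique; exact: hd.
Qed.

Lemma SM_der k f o x t : SM k.+1 f -> 0 < t < T ->
  is_derive (fun r => f (mvx o r x) (mvt o r t)) (cor o x t) (DD o f x t).
Proof. by move=> h ht; apply: Derive_correct; exact: (SM_ex o x h ht). Qed.

Lemma ext0_const c : ext0 (fun _ _ => c).
Proof. split => //; exists (fun _ _ => c); split => //; exact: cont_const. Qed.

Lemma ext0_comp2 (phi : R -> R -> R) f g : cont (fun z : R * R => phi z.1 z.2) ->
  ext0 f -> ext0 g -> ext0 (fun x t => phi (f x t) (g x t)).
Proof.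
move=> hphi [p1 [f' [h1 e1]]] [p2 [g' [h2 e2]]]; split.
  by move=> x t i ht; rewrite p1 // p2.
exists (fun x t => phi (f' x t) (g' x t)); split; last by move=> x t ht; rewrite e1 // e2.
exact: (cont_comp2 (c := fun z : pt d * R => f' z.1 z.2) (e := fun z => g' z.1 z.2) (f := phi)).
Qed.

Lemma ext0_plus f g : ext0 f -> ext0 g -> ext0 (fun x t => f x t + g x t).
Proof.
apply: ext0_comp2; apply: (cont_plus (f := fst) (g := snd)); [exact: cont_fst|exact: cont_snd].
Qed.

Lemma ext0_mult f g : ext0 f -> ext0 g -> ext0 (fun x t => f x t * g x t).
Proof.
apply: ext0_comp2; apply: (cont_mult (f := fst) (g := snd)); [exact: cont_fst|exact: cont_snd].
Qed.

Lemma ext0_comp (phi : R -> R) f : cont phi -> ext0 f -> ext0 (fun x t => phi (f x t)).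
Proof.
move=> hphi hf; apply: (@ext0_comp2 (fun a _ => phi a) f f) => //.
apply: (cont_comp (c := fst)) => // z; exact: cont_fst.
Qed.

Lemma ext0_Rabs f : ext0 f -> ext0 (fun x t => Rabs (f x t)).
Proof. apply: ext0_comp => z; exact: continuous_Rabs. Qed.

Lemma ext0_powr f a : 0 < a -> ext0 f -> ext0 (fun x t => powr (f x t) a).
Proof. move=> ha; apply: (@ext0_comp (fun y => powr y a)) => z; exact: continuous_powr. Qed.

Lemma continuous_powr_pos y a : 0 < y -> continuous (fun y => powr y a) y.
Proof. move=> hy; apply: ex_derive_continuous; eexists; exact: is_derive_powr_pos. Qed.

Lemma ext0_powr_pos f a k : 0 < k -> (forall x t, 0 < t < T -> k <= f x t) -> ext0 f ->
  ext0 (fun x t => powr (f x t) a).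
Proof.
move=> hk hf h0.
(* The continuous extension of [f] may fail to be positive outside the slab; truncation from below
   by [k] changes nothing inside and keeps the power continuous everywhere. *)
apply: (@ext0_ext (fun x t => powr (Rmax k (f x t)) a)).
  by move=> x t ht; rewrite Rmax_right //; apply: hf.
apply: (@ext0_comp (fun y => powr (Rmax k y) a)) => // y.
apply: (@continuous_comp _ _ _ (Rmax k) (fun y => powr y a)).
  by move: y; apply: (cont_Rmax (f := fun _ => k) (g := fun y => y)) => z; [exact: continuous_const|exact: continuous_id].
by apply: continuous_powr_pos; apply: Rlt_le_trans hk _; exact: Rmax_l.
Qed.

Lemma ext0_sumI n (F : 'I_n -> pt d -> R -> R) : (forall i, ext0 (F i)) ->
  ext0 (fun x t => sumI (fun i => F i x t)).
Proof.
move=> h; rewrite /sumI; elim: (index_enum _) => [|i s IH].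
  by apply: ext0_ext (ext0_const 0) => x t _; rewrite big_nil.
apply: ext0_ext (ext0_plus (h i) IH) => x t _; by rewrite big_cons.
Qed.

Lemma SM_const k c : SM k (fun _ _ => c).
Proof.
elim: k c => [|k IH] c; first by split => //; exact: ext0_const.
apply: (@SM_intro k _ (fun _ _ _ => 0)) => [|o x t _|o]; [exact: ext0_const| |exact: IH].
exact: (@is_derive_const _ _ c).
Qed.

Lemma SM_plus k f g : SM k f -> SM k g -> SM k (fun x t => f x t + g x t).
Proof.
elim: k f g => [|k IH] f g hf hg.
  by split => //; apply: ext0_plus; [case: hf|case: hg].
apply: (@SM_intro k _ (fun o x t => DD o f x t + DD o g x t)).
- by apply: ext0_plus; [exact: SM_ext0 hf|exact: SM_ext0 hg].
- move=> o x t ht; apply: (@is_derive_plus _ _ (fun r => f (mvx o r x) (mvt o r t)));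
  [exact: (SM_der o x hf ht)|exact: (SM_der o x hg ht)].
- by move=> o; apply: IH; apply: SM_DD.
Qed.

Lemma SM_mult k f g : SM k f -> SM k g -> SM k (fun x t => f x t * g x t).
Proof.
elim: k f g => [|k IH] f g hf hg.
  by split => //; apply: ext0_mult; [case: hf|case: hg].
apply: (@SM_intro k _ (fun o x t => DD o f x t * g x t + f x t * DD o g x t)).
- by apply: ext0_mult; [exact: SM_ext0 hf|exact: SM_ext0 hg].
- move=> o x t ht.
  have := @is_derive_mult _ (fun r => f (mvx o r x) (mvt o r t)) (fun r => g (mvx o r x) (mvt o r t))
    _ _ _ (SM_der o x hf ht) (SM_der o x hg ht) Rmult_comm.
  by rewrite !mvx_cor !mvt_cor.
- move=> o; apply: SM_plus; apply: IH; try (by apply: SM_DD); exact: SM_S.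
Qed.

Lemma SM_scal k c f : SM k f -> SM k (fun x t => c * f x t).
Proof. by apply: SM_mult; apply: SM_const. Qed.

Lemma SM_opp k f : SM k f -> SM k (fun x t => - f x t).
Proof. by move=> h; apply: SM_ext (SM_scal (-1) h) => x t _; ring. Qed.

Lemma SM_minus k f g : SM k f -> SM k g -> SM k (fun x t => f x t - g x t).
Proof. by move=> hf hg; apply: SM_plus => //; apply: SM_opp. Qed.

Lemma SM_sumI k n (F : 'I_n -> pt d -> R -> R) : (forall i, SM k (F i)) ->
  SM k (fun x t => sumI (fun i => F i x t)).
Proof.
move=> h; rewrite /sumI; elim: (index_enum _) => [|i s IH].
  by apply: SM_ext (SM_const k 0) => x t _; rewrite big_nil.
apply: SM_ext (SM_plus (h i) IH) => x t _; by rewrite big_cons.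
Qed.

Lemma SM_powr_pos k f a c : 0 < c -> (forall x t, 0 < t < T -> c <= f x t) -> SM k f ->
  SM k (fun x t => powr (f x t) a).
Proof.
move=> hc hf; elim: k a => [|k IH] a h.
  by split => //; apply: (ext0_powr_pos a hc hf); case: h.
apply: (@SM_intro k _ (fun o x t => a * powr (f x t) (a - 1) * DD o f x t)).
- by apply: (ext0_powr_pos a hc hf); exact: SM_ext0 h.
- move=> o x t ht; rewrite Rmult_comm.
  apply: (@is_derive_comp _ _ (fun y => powr y a) (fun r => f (mvx o r x) (mvt o r t))).
    by rewrite mvx_cor mvt_cor; apply: is_derive_powr_pos; have := hf x t ht; lra.
  exact: (SM_der o x h ht).
- move=> o; apply: SM_mult; last exact: SM_DD.
  by apply: SM_scal; apply: IH; exact: SM_S.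
Qed.

Lemma SM_powr k f a : INR k < a -> SM k f -> SM k (fun x t => powr (f x t) a).
Proof.
elim: k a => [|k IH] a ha h.
  by split => //; apply: ext0_powr; [|case: h].
rewrite S_INR in ha; have := pos_INR k => k0.
apply: (@SM_intro k _ (fun o x t => a * powr (f x t) (a - 1) * DD o f x t)).
- by apply: ext0_powr; [lra|exact: SM_ext0 h].
- move=> o x t ht; rewrite Rmult_comm.
  apply: (@is_derive_comp _ _ (fun y => powr y a) (fun r => f (mvx o r x) (mvt o r t))).
    by rewrite mvx_cor mvt_cor; apply: is_derive_powr; lra.
  exact: (SM_der o x h ht).
- move=> o; apply: SM_mult; last exact: SM_DD.
  by apply: SM_scal; apply: IH; [lra|exact: SM_S].
Qed.

Lemma SM_exp k c e : SM k (fun _ t => c * exp (e * t)).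
Proof.
elim: k c => [|k IH] c.
  split => //; split => //; exists (fun _ t => c * exp (e * t)); split => //.
  apply: (cont_comp (c := snd) (f := fun t => c * exp (e * t))) => t; first exact: cont_snd.
  by apply: ex_derive_continuous; auto_derive.
apply: (@SM_intro k _ (fun o x t => match o with Some _ => 0 | None => (c * e) * exp (e * t) end)).
- exact: SM_ext0 (IH c).
- move=> [i|] x t ht /=; first exact: (@is_derive_const _ _ (c * exp (e * t))).
  by auto_derive => //; ring.
- by case=> [i|]; [exact: SM_const|exact: IH].
Qed.

Lemma ext0_bounded f : ext0 f -> exists M, forall x t, 0 < t < T -> Rabs (f x t) <= M.
Proof.
move=> [hp [g [hg e]]]; have [M hM] := slab_bounded T hg.
exists M => x t ht; have [y [hy ey]] := periodic_reduce x.
rewrite (ey (fun x => f x t)); last by move=> z i; apply: hp.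
by rewrite e //; apply: hM => //; lra.
Qed.

Lemma ext0_slice f t : ext0 f -> 0 < t < T -> cont (fun x => f x t).
Proof.
move=> [_ [g [hg e]]] ht.
have -> : (fun x => f x t) = fun x => g x t by apply: functional_extensionality => x; apply: e.
by apply: (cont_comp2 (c := fun x => x) (e := fun _ => t) (f := g)) => // x; [exact: continuous_id|exact: continuous_const].
Qed.

Lemma ext0_periodic f t : ext0 f -> 0 < t < T -> periodic (fun x => f x t).
Proof. by move=> [h _] ht x i; apply: h. Qed.

Definition sp f t : R := torint (fun x => f x t).
Definition sint f a b : R := RInt (sp f) a b.

Lemma sp_cont g : slabcont g -> cont (sp g).
Proof.
move=> hg; apply: (@boxint_cont _ d 0 1 (fun t x => g x t)); first lra.
by apply: (cont_comp2 (c := snd) (e := fst) (f := g)) => // z; [exact: cont_snd|exact: cont_fst].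
Qed.

Lemma sp_eq f g t : (forall x t, 0 < t < T -> f x t = g x t) -> 0 < t < T -> sp f t = sp g t.
Proof. by move=> h ht; congr (boxint _ _ _); apply: functional_extensionality => x; apply: h. Qed.

Lemma sp_plus f g t : ext0 f -> ext0 g -> 0 < t < T ->
  sp (fun x t => f x t + g x t) t = sp f t + sp g t.
Proof.
by move=> hf hg ht; apply: boxint_plus; [lra|apply: (ext0_slice hf ht)|apply: (ext0_slice hg ht)].
Qed.

Lemma sp_scal f c t : ext0 f -> 0 < t < T -> sp (fun x t => c * f x t) t = c * sp f t.
Proof. by move=> hf ht; apply: boxint_scal; [lra|apply: (ext0_slice hf ht)]. Qed.

Lemma sp_le f g t : ext0 f -> ext0 g -> 0 < t < T -> (forall x, f x t <= g x t) -> sp f t <= sp g t.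
Proof.
move=> hf hg ht h; apply: boxint_le; [lra|exact: (ext0_slice hf ht)|exact: (ext0_slice hg ht)|].
by move=> x _; apply: h.
Qed.

Lemma sp_const c t : sp (fun _ _ => c) t = c.
Proof. exact: boxint_const. Qed.


Lemma sp_DD i f t : SM 1 f -> 0 < t < T -> sp (DD (Some i) f) t = 0.
Proof.
move=> hf ht; apply: (@torint_pd d i (fun x => f x t)).
- exact: ext0_slice (SM_ext0 hf) ht.
- exact: ext0_periodic (SM_ext0 hf) ht.
- exact: ext0_slice (SM_ext0 (SM_DD (Some i) hf)) ht.
- by move=> x; exact: (SM_der (Some i) x hf ht).
Qed.

Lemma sp_div n (P : 'I_n -> pt d -> R -> R) (s : 'I_n -> 'I_d) t : (forall i, SM 1 (P i)) -> 0 < t < T ->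
  sp (fun x t => sumI (fun i => DD (Some (s i)) (P i) x t)) t = 0.
Proof.
move=> h ht; rewrite /sumI; elim: (index_enum _) => [|i l IH].
  rewrite -[RHS](sp_const 0 t); apply: sp_eq => // x r _; by rewrite big_nil.
have h2 : ext0 (fun x t => \big[Rplus/0]_(j <- l) DD (Some (s j)) (P j) x t).
  elim: l {IH} => [|j l IH].
    by apply: ext0_ext (ext0_const 0) => x r _; rewrite big_nil.
  apply: ext0_ext (ext0_plus (SM_ext0 (SM_DD (Some (s j)) (h j))) IH) => x r _; by rewrite big_cons.
transitivity (sp (DD (Some (s i)) (P i)) t + sp (fun x t => \big[Rplus/0]_(j <- l) DD (Some (s j)) (P j) x t) t).
  rewrite -sp_plus //; last exact: SM_ext0 (SM_DD _ (h i)).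
  by apply: sp_eq => // x r _; rewrite big_cons.
by rewrite IH sp_DD //; ring.
Qed.

Lemma sp_is_derive f t : SM 1 f -> 0 < t < T -> is_derive (sp f) t (sp (DD None f) t).
Proof.
move=> hf ht.
have [_ [g1 [hg1 e1]]] := SM_ext0 (SM_DD None hf).
rewrite (_ : sp (DD None f) t = sp g1 t); last exact: sp_eq.
apply: (@is_derive_boxint d (fun t x => f x t) (fun t x => g1 x t) 0 1 0 T) => //; first lra.
- by move=> s hs; exact: ext0_slice (SM_ext0 hf) hs.
- by apply: (cont_comp2 (c := snd) (e := fst) (f := g1)) => // z; [exact: cont_snd|exact: cont_fst].
- by move=> s x hs; rewrite -e1 //; exact: (SM_der None x hf hs).
Qed.

(** [Q] is a source and [P] a flux: the divergence of a periodic flux has integral zero. *)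
Lemma sp_balance f Q (P : 'I_d -> pt d -> R -> R) t : SM 1 f -> ext0 Q -> (forall i, SM 1 (P i)) ->
  (forall x t, 0 < t < T -> DD None f x t = Q x t + sumI (fun i => DD (Some i) (P i) x t)) ->
  0 < t < T -> is_derive (sp f) t (sp Q t).
Proof.
move=> hf hQ hP e ht.
have := sp_is_derive hf ht.
rewrite (sp_eq (g := fun x t => Q x t + sumI (fun i => DD (Some i) (P i) x t)) e ht).
rewrite sp_plus //; last by apply: ext0_sumI => i; exact: SM_ext0 (SM_DD _ (hP i)).
by rewrite (@sp_div d P id) // Rplus_0_r.
Qed.

Lemma sint_eq f g a b : 0 <= a <= b -> b <= T -> (forall x t, 0 < t < T -> f x t = g x t) ->
  sint f a b = sint g a b.
Proof.
move=> hab hb e; apply: RInt_ext; rewrite Rmin_left ?Rmax_right; try lra.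
move=> t ht; apply: sp_eq => //; lra.
Qed.

Lemma ext0_ex_RInt f a b : 0 <= a <= b -> b <= T -> ext0 f -> ex_RInt (sp f) a b.
Proof.
move=> hab hb [_ [g [hg e]]].
apply: (ex_RInt_ext (sp g)).
  rewrite Rmin_left ?Rmax_right; try lra; move=> t ht; symmetry; apply: sp_eq => //; lra.
apply: ex_RInt_continuous => t _; exact: sp_cont.
Qed.

Lemma sint_plus f g a b : 0 <= a <= b -> b <= T -> ext0 f -> ext0 g ->
  sint (fun x t => f x t + g x t) a b = sint f a b + sint g a b.
Proof.
move=> hab hb hf hg; rewrite /sint -RInt_plusR; try exact: ext0_ex_RInt.
apply: RInt_ext; rewrite Rmin_left ?Rmax_right; try lra.
move=> t ht; apply: sp_plus => //; lra.
Qed.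

Lemma sint_scal f c a b : 0 <= a <= b -> b <= T -> ext0 f ->
  sint (fun x t => c * f x t) a b = c * sint f a b.
Proof.
move=> hab hb hf; rewrite /sint -RInt_scalR; try exact: ext0_ex_RInt.
apply: RInt_ext; rewrite Rmin_left ?Rmax_right; try lra.
move=> t ht; apply: sp_scal => //; lra.
Qed.

Lemma sint_sp_le f g a b : 0 <= a <= b -> b <= T -> ext0 f -> ext0 g ->
  (forall t, 0 < t < T -> sp f t <= sp g t) -> sint f a b <= sint g a b.
Proof.
move=> hab hb hf hg h; apply: RInt_le; try exact: ext0_ex_RInt; first lra.
move=> t ht; apply: h; lra.
Qed.

Lemma sint_le f g a b : 0 <= a <= b -> b <= T -> ext0 f -> ext0 g ->
  (forall x t, 0 < t < T -> f x t <= g x t) -> sint f a b <= sint g a b.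
Proof.
move=> hab hb hf hg h; apply: sint_sp_le => // t ht; apply: sp_le => // x; exact: h.
Qed.

Lemma sint_const c a b : sint (fun _ _ => c) a b = c * (b - a).
Proof.
rewrite /sint (RInt_ext _ (fun _ => c)); last by move=> t _; exact: sp_const.
by rewrite RInt_const /scal /= /mult /= Rmult_comm.
Qed.

Lemma sint_mono_b f b : 0 <= b <= T -> ext0 f -> (forall x t, 0 < t < T -> 0 <= f x t) ->
  sint f 0 b <= sint f 0 T.
Proof.
move=> hb hf h.
have <- : sint f 0 b + sint f b T = sint f 0 T.
  by apply: (RInt_Chasles (sp f)); apply: ext0_ex_RInt => //; lra.
have : sint (fun _ _ => 0) b T <= sint f b T.
  apply: sint_le => //; try lra; exact: ext0_const.
rewrite sint_const; lra.
Qed.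

(** The conservation law integrated up to the end times. As [f] is controlled only inside, its
    values at [a] and [b] are read from the continuous representative [g]: [sp g] minus the
    primitive of the source is continuous up to the ends and has zero derivative inside. *)
Lemma balance f Q (P : 'I_d -> pt d -> R -> R) g a b : SM 1 f -> ext0 Q -> (forall i, SM 1 (P i)) ->
  (forall x t, 0 < t < T -> DD None f x t = Q x t + sumI (fun i => DD (Some i) (P i) x t)) ->
  slabcont g -> (forall x t, 0 < t < T -> f x t = g x t) -> 0 <= a <= b -> b <= T ->
  sp g b - sp g a = sint Q a b.
Proof.
move=> hf hQ hP e hg efg hab hb.
have [_ [q [hq eq]]] := hQ.
rewrite (sint_eq hab hb eq).
have hd t : 0 < t < T -> is_derive (sp g) t (sp q t).
  move=> ht; rewrite -(sp_eq eq ht).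
  apply: is_derive_ext_loc (sp_balance hf hQ hP e ht).
  by apply: filter_imp (near_slab None (fun _ => 0) ht) => s hs; apply: sp_eq.
pose psi t := sp g t - RInt (sp q) a t.
have cq := sp_cont hq.
have hdpsi t : is_derive (fun t => RInt (sp q) a t) t (sp q t) by exact: is_derive_RInt_cont.
have [||c [hc]] := MVT_gen psi a b (fun _ => 0).
- rewrite Rmin_left ?Rmax_right; try lra; move=> t ht.
  rewrite -(Rminus_diag (sp q t)); apply: (@is_derive_minus _ _ (sp g)) => //; apply: hd; lra.
- move=> t _; apply/continuity_pt_filterlim.
  apply: (cont_minus (f := sp g) (g := fun t => RInt (sp q) a t)); first exact: sp_cont.
  by move=> s; apply: ex_derive_continuous; eexists; exact: hdpsi.
rewrite /psi RInt_point /zero /= /sint; lra.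
Qed.

Lemma DD_comm o o' f x t : SM 2 f -> 0 < t < T -> DD o (DD o' f) x t = DD o' (DD o f) x t.
Proof.
move=> hf ht.
case: (eqVneq o o') => [->//|ne].
have mvxC a b y : mvx o a (mvx o' b y) = mvx o' b (mvx o a y).
  case: (o) (o') ne => [i|] [j|] //= ne; rewrite upd_comm //.
  by apply: contraNneq ne => ->.
have mvtC a b s : mvt o a (mvt o' b s) = mvt o' b (mvt o a s) by case: (o) (o') ne => [i|] [j|].
have corx a y s : cor o' (mvx o a y) (mvt o a s) = cor o' y s.
  case: (o) (o') ne => [i|] [j|] //= ne; rewrite /upd; case: eqP => // e.
  by case/eqP: ne; rewrite e.
have corx' a y s : cor o (mvx o' a y) (mvt o' a s) = cor o y s.
  case: (o) (o') ne => [i|] [j|] //= ne; rewrite /upd; case: eqP => // e.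
  by case/eqP: ne; rewrite e.
have mvx2 oo a b (y : pt d) : mvx oo a (mvx oo b y) = mvx oo a y.
  by case: oo => [i|] //=; rewrite upd_upd.
have mvt2 oo a b s : @mvt d oo a (mvt oo b s) = mvt oo a s by case: oo.
have corm oo a (y : pt d) s : cor oo (mvx oo a y) (mvt oo a s) = a.
  by case: oo => [i|] //=; rewrite upd_same.
(* [X] and [S] displace the point in both directions at once, which turns the mixed derivatives into
   those of a function [phi] of two real variables, as Schwarz's theorem requires. *)
pose X u v := mvx o u (mvx o' v x).
pose S u v := mvt o u (mvt o' v t).
pose phi u v := f (X u v) (S u v).
have near : locally_2d (fun u v => 0 < S u v < T) (cor o x t) (cor o' x t).
  have [e1 h1] := near_slab o x ht; have [e2 h2] := near_slab o' x ht.
  have e0 : 0 < Rmin e1 e2 by apply: Rmin_pos; exact: cond_pos.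
  exists (mkposreal _ e0) => u v hu hv.
  have k1 : 0 < mvt o u t < T by apply: h1; apply: Rlt_le_trans hu _; exact: Rmin_l.
  have k2 : 0 < mvt o' v t < T by apply: h2; apply: Rlt_le_trans hv _; exact: Rmin_r.
  by move: k1 k2; rewrite /S; case: (o) (o') ne => [i|] [j|].
have d1 u v : Derive (fun z => phi z v) u = DD o f (X u v) (S u v).
  rewrite /DD /phi /X /S corm; apply: Derive_ext => z; by rewrite mvx2 mvt2.
have d2 u v : Derive (fun z => phi u z) v = DD o' f (X u v) (S u v).
  rewrite /DD /phi /X /S mvxC mvtC corm; apply: Derive_ext => z.
  by rewrite mvxC mvtC mvx2 mvt2.
have x1 u v : 0 < S u v < T -> ex_derive (fun z => phi z v) u.
  move=> h; have := SM_ex o (X u v) hf h; rewrite /exD /X /S corm.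
  by apply: ex_derive_ext => z; rewrite mvx2 mvt2.
have x2 u v : 0 < S u v < T -> ex_derive (fun z => phi u z) v.
  move=> h; have := SM_ex o' (X u v) hf h; rewrite /exD /X /S mvxC mvtC corm.
  by apply: ex_derive_ext => z; rewrite /phi /X /S mvxC mvtC mvx2 mvt2.
have d12 u v : Derive (fun z => Derive (fun y => phi z y) v) u = DD o (DD o' f) (X u v) (S u v).
  rewrite {1}/DD corm; apply: Derive_ext => z; by rewrite d2 /X /S mvx2 mvt2.
have d21 u v : Derive (fun z => Derive (fun y => phi y z) u) v = DD o' (DD o f) (X u v) (S u v).
  rewrite {1}/DD {2}/X {2}/S mvxC mvtC corm; apply: Derive_ext => z.
  by rewrite d1 /X /S (mvxC u v) (mvtC u v) mvx2 mvt2 mvxC mvtC.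
have x12 u v : 0 < S u v < T -> ex_derive (fun z => Derive (fun y => phi z y) v) u.
  move=> h; have := SM_ex o (X u v) (SM_DD o' hf) h; rewrite /exD /X /S corm.
  by apply: ex_derive_ext => z; rewrite d2 mvx2 mvt2.
have x21 u v : 0 < S u v < T -> ex_derive (fun z => Derive (fun y => phi y z) u) v.
  move=> h; have := SM_ex o' (X u v) (SM_DD o hf) h; rewrite /exD /X /S mvxC mvtC corm.
  by apply: ex_derive_ext => z; rewrite d1 /X /S mvx2 mvt2 mvxC mvtC.
have cX : forall z : R * R, continuous (fun z : R * R => X z.1 z.2 : pt d) z.
  move=> z; apply: continuous_pt => k; rewrite /X.
  case: (o) => [i|]; case: (o') => [j|]; rewrite /= /upd;
    repeat (match goal with |- context [if ?b then _ else _] => case: b end);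
    try exact: continuous_const; try exact: cont_fst; exact: cont_snd.
have cS : forall z : R * R, continuous (fun z : R * R => S z.1 z.2) z.
  move=> z; rewrite /S; case: (o) => [i|]; case: (o') => [j|] /=;
    try exact: continuous_const; try exact: cont_fst; exact: cont_snd.
have cc oa ob : continuity_2d_pt (fun u v => DD oa (DD ob f) (X u v) (S u v)) (cor o x t) (cor o' x t).
  have [_ [g [hg e]]] := SM_ext0 (SM_DD oa (SM_DD ob hf)).
  apply: (continuity_2d_pt_ext_loc (fun u v => g (X u v) (S u v))).
    by case: near => ep h; exists ep => u v hu hv; symmetry; apply: e; apply: h.
  apply/continuity_2d_pt_filterlim.
  have H : cont (fun z : R * R => g (X z.1 z.2) (S z.1 z.2)).
    by apply: (cont_comp2 (c := fun z : R * R => X z.1 z.2) (e := fun z => S z.1 z.2) (f := g)).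
  exact: (H (cor o x t, cor o' x t)).
have := @Schwarz phi (cor o x t) (cor o' x t).
rewrite d12 d21 /X /S !mvx_cor !mvt_cor; apply.
- by case: near => ep h; exists ep => u v hu hv; have h' := h u v hu hv;
  split; [exact: x1|split; [exact: x2|split; [exact: x12|exact: x21]]].
- apply: continuity_2d_pt_ext (cc o o') => u v; by rewrite d12.
- apply: continuity_2d_pt_ext (cc o' o) => u v; by rewrite d21.
Qed.

End Slab.

(** * Smooth functions on the closed slab and their continuous extensions *)

Lemma Derive_per1 (f : R -> R) a : (forall r, f (r + 1) = f r) -> ex_derive f (a + 1) ->
  Derive f (a + 1) = Derive f a.
Proof.
move=> hp hd; symmetry; apply: is_derive_unique.
apply: (is_derive_ext (fun r => f (r + 1))); first exact: hp.
rewrite -[Derive f (a + 1)]Rmult_1_l.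
apply: (@is_derive_comp _ _ f (fun r => r + 1)); first exact: Derive_correct.
by auto_derive.
Qed.

(** For [0 < T], the retraction of the line onto [[0, T]]: composition with it extends a function
    continuous on the closed slab to all times. *)
Definition clamp (T t : R) : R := Rmax 0 (Rmin T t).

Lemma clamp_in T t : 0 < T -> 0 <= clamp T t <= T.
Proof.
move=> hT; rewrite /clamp; split; first exact: Rmax_l.
by apply: Rmax_lub; [lra|exact: Rmin_l].
Qed.

Lemma clamp_id T t : 0 <= t <= T -> clamp T t = t.
Proof. by move=> h; rewrite /clamp Rmin_right ?Rmax_right; lra. Qed.

Lemma clamp_lip T s t : Rabs (clamp T s - clamp T t) <= Rabs (s - t).
Proof.
have h1 a b : Rabs (Rmax 0 a - Rmax 0 b) <= Rabs (a - b).
  by rewrite /Rmax; case: Rle_dec; case: Rle_dec => /= ? ?; split_Rabs; lra.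
apply: Rle_trans (h1 _ _) _.
by rewrite /Rmin; case: Rle_dec; case: Rle_dec => /= ? ?; split_Rabs; lra.
Qed.

Section SlabSmooth.
Variables (d : nat) (T : R).
Hypothesis hT : 0 < T.

Definition joinT (x : pt d) (t : R) : pt (d + 1) :=
  fun j => match split j with inl i => x i | inr _ => t end.

Lemma joinT_l x t i : joinT x t (lshift 1 i) = x i.
Proof. by rewrite /joinT (unsplitK (inl i)). Qed.

Lemma joinT_r x t : joinT x t (rshift d ord0) = t.
Proof. by rewrite /joinT (unsplitK (inr ord0)). Qed.

Lemma tjoint_joinT u x t : tjoint u (joinT x t) = u x t.
Proof.
rewrite /tjoint joinT_r; congr u; apply: functional_extensionality => i; exact: joinT_l.
Qed.

Definition dir (j : 'I_(d + 1)) : option 'I_d :=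
  match split j with inl i => Some i | inr _ => None end.

Lemma dir_l i : dir (lshift 1 i) = Some i.
Proof. by rewrite /dir (unsplitK (inl i)). Qed.

Lemma dir_r : dir (rshift d ord0) = None.
Proof. by rewrite /dir (unsplitK (inr ord0)). Qed.

Lemma pd_tjoint j (f : pt d -> R -> R) : pd j (tjoint f) = tjoint (DD (dir j) f).
Proof.
apply: functional_extensionality => z; rewrite /pd /tjoint /DD.
case: (split_ordP j) => [i ->|k ->].
  rewrite dir_l; apply: Derive_ext => r /=; congr f.
  by rewrite /upd eq_rlshift.
rewrite (ord1 k) dir_r; apply: Derive_ext => r /=; congr f; last by rewrite upd_same.
by apply: functional_extensionality => i'; rewrite /upd eq_lrshift.
Qed.

Definition iDD (l : seq (option 'I_d)) (u : pt d -> R -> R) := foldr DD u l.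

Lemma iterD_tjoint s u : iterD s (tjoint u) = tjoint (iDD (map dir s) u).
Proof. by elim: s => [|j s IH] //=; rewrite IH pd_tjoint. Qed.

Definition ridx (o : option 'I_d) : 'I_(d + 1) :=
  match o with Some i => lshift 1 i | None => rshift d ord0 end.

Lemma dir_ridx o : dir (ridx o) = o.
Proof. by case: o => [i|]; [exact: dir_l|exact: dir_r]. Qed.

Lemma map_dir_ridx l : map dir (map ridx l) = l.
Proof. by elim: l => [|o l IH] //=; rewrite dir_ridx IH. Qed.

Let O (z : pt (d + 1)) := 0 < z (rshift d ord0) < T.
Let K (z : pt (d + 1)) := 0 <= z (rshift d ord0) <= T.

Lemma slabcont_clamp (G : pt (d + 1) -> R) : (forall z, K z -> cont_within K G z) ->
  slabcont (fun x t => G (joinT x (clamp T t))).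
Proof.
move=> hG [x t]; apply/filterlim_locally => eps.
have hK s y : K (joinT y (clamp T s)) by rewrite /K joinT_r; exact: clamp_in.
have [e [he h]] := hG _ (hK t x) eps (cond_pos eps).
exists (mkposreal e he) => -[y s] [/= hy hs].
apply: h => // j; rewrite /joinT; case: split => [i|_].
  exact: (hy i).
by apply: Rle_lt_trans (clamp_lip _ _ _) _; exact: hs.
Qed.

Lemma smooth_slab_clamp (u : pt d -> R -> R) : smooth_slab T u -> slabcont (fun x t => u x (clamp T t)).
Proof.
move=> [h _] z.
apply: (continuous_ext (fun z : pt d * R => tjoint u (joinT z.1 (clamp T z.2)))).
  by move=> q; rewrite tjoint_joinT.
exact: (slabcont_clamp h).
Qed.

Lemma smooth_slab_iDD (u : pt d -> R -> R) l : smooth_slab T u ->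
  (exists g, slabcont g /\ forall x t, 0 < t < T -> iDD l u x t = g x t) /\
  forall o x t, 0 < t < T -> exD o (iDD l u) x t.
Proof.
move=> [_ /(_ (map ridx l)) []].
rewrite iterD_tjoint map_dir_ridx => hex [G [hG1 hG2]]; split.
  exists (fun x t => G (joinT x (clamp T t))); split; first exact: slabcont_clamp.
  move=> x t ht; rewrite clamp_id; last lra.
  by rewrite hG1 ?tjoint_joinT //; rewrite joinT_r.
move=> o x t ht.
have ho : O (joinT x t) by rewrite /O joinT_r.
have := hex _ ho (ridx o); rewrite /exD.
have -> : joinT x t (ridx o) = cor o x t by case: (o) => [i|] /=; rewrite ?joinT_l ?joinT_r.
apply: ex_derive_ext => r; rewrite -tjoint_joinT; congr tjoint.
apply: functional_extensionality => j; rewrite /upd /joinT /ridx.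
case: (split_ordP j) => [i ->|k ->]; case: (o) => [i'|] /=.
- by rewrite eq_lshift.
- by rewrite eq_lrshift.
- by rewrite eq_rlshift.
- by rewrite (ord1 k) eqxx.
Qed.

Lemma DD_periodic o (f : pt d -> R -> R) :
  (forall x t i, 0 < t < T -> f (upd x i (x i + 1)) t = f x t) ->
  (forall x t, 0 < t < T -> exD o f x t) ->
  forall x t i, 0 < t < T -> DD o f (upd x i (x i + 1)) t = DD o f x t.
Proof.
move=> hp hex x t i ht; rewrite /DD.
case: o hex => [j|] hex /=; last first.
  by apply: Derive_ext_loc; apply: filter_imp (near_slab None x ht) => r hr; exact: hp.
case: (eqVneq j i) => [e|ne]; last first.
  rewrite (_ : upd x i (x i + 1) j = x j); last by rewrite /upd (negbTE ne).
  apply: Derive_ext => r.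
  rewrite upd_comm 1?eq_sym //; have <- : upd x j r i = x i by rewrite /upd eq_sym (negbTE ne).
  exact: hp.
rewrite -e upd_same.
transitivity (Derive (fun r => f (upd x j r) t) (x j + 1)).
  by apply: Derive_ext => r; rewrite upd_upd.
apply: Derive_per1.
  by move=> r; rewrite -[RHS](hp _ _ j ht) upd_same upd_upd.
have := hex (upd x j (x j + 1)) t ht; rewrite /exD /= upd_same.
by apply: ex_derive_ext => r; rewrite upd_upd.
Qed.

Lemma smooth_slab_SM (u : pt d -> R -> R) k : smooth_slab T u -> periodic_t u -> SM T k u.
Proof.
move=> hs hp.
have per l : forall x t i, 0 < t < T -> iDD l u (upd x i (x i + 1)) t = iDD l u x t.
  elim: l => [|o l IH] /=; first by move=> x t i _; exact: hp.
  by apply: DD_periodic => // x t ht; apply: (smooth_slab_iDD l hs).2.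
suff: forall l, SM T k (iDD l u) by move=> /(_ [::]).
have e0 l : ext0 T (iDD l u) by split; [exact: per|exact: (smooth_slab_iDD l hs).1].
elim: k => [|k IH] l; split => //.
split; first exact: (smooth_slab_iDD l hs).2.
by move=> o; apply: (IH (o :: l)).
Qed.

End SlabSmooth.

(** * Smooth functions of space and composition with a gradient *)

Lemma smooth_iterD n (F : pt n -> R) s : smooth F ->
  cont (iterD s F) /\ forall i z, is_derive (fun r => iterD s F (upd z i r)) (z i) (iterD (i :: s) F z).
Proof.
move=> [_ /(_ s) [hex [G [e hG]]]]; split.
  move=> z; apply/cont_within_continuous.
  rewrite (_ : iterD s F = G); first exact: hG.
  by apply: functional_extensionality => w; rewrite e.
by move=> i z; apply: Derive_correct; exact: hex.
Qed.

Definition per_at n (j : 'I_n) (F : pt n -> R) := forall z, F (upd z j (z j + 1)) = F z.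

Lemma iterD_per n (F : pt n -> R) (j : 'I_n) s : smooth F -> per_at j F -> per_at j (iterD s F).
Proof.
move=> hF hp; elim: s => [|i s IH] //= z.
have hex y : ex_derive (fun r => iterD s F (upd y i r)) (y i).
  by eexists; apply: (smooth_iterD s hF).2.
rewrite /pd; case: (eqVneq i j) => [e|ne]; last first.
  rewrite (_ : upd z j (z j + 1) i = z i); last by rewrite /upd (negbTE ne).
  apply: Derive_ext => r.
  rewrite upd_comm 1?eq_sym //; have <- : upd z i r j = z j by rewrite /upd eq_sym (negbTE ne).
  exact: IH.
rewrite -{}e in IH *; rewrite upd_same.
transitivity (Derive (fun r => iterD s F (upd z i r)) (z i + 1)).
  by apply: Derive_ext => r; rewrite upd_upd.
apply: Derive_per1.
  by move=> r; rewrite -[RHS]IH upd_same upd_upd.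
have := hex (upd z i (z i + 1)); rewrite upd_same.
by apply: ex_derive_ext => r; rewrite upd_upd.
Qed.

Definition joinp {d} (x p : pt d) : pt (d + d) :=
  fun j => match split j with inl i => x i | inr i => p i end.

Lemma cat_l d (x p : pt d) i : joinp x p (lshift d i) = x i.
Proof. by rewrite /joinp (unsplitK (inl i)). Qed.

Lemma cat_r d (x p : pt d) i : joinp x p (rshift d i) = p i.
Proof. by rewrite /joinp (unsplitK (inr i)). Qed.

Lemma Hjoint_cat d (H : pt d -> pt d -> R) x p : Hjoint H (joinp x p) = H x p.
Proof.
rewrite /Hjoint; congr H; apply: functional_extensionality => i; [exact: cat_l|exact: cat_r].
Qed.

Lemma pd_Hjoint_l d i (H : pt d -> pt d -> R) : pd (lshift d i) (Hjoint H) = Hjoint (dHx i H).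
Proof.
apply: functional_extensionality => z; rewrite /pd /Hjoint /dHx.
apply: Derive_ext => r; congr H; apply: functional_extensionality => j; by rewrite /upd eq_rlshift.
Qed.

Lemma pd_Hjoint_r d i (H : pt d -> pt d -> R) : pd (rshift d i) (Hjoint H) = Hjoint (dHp i H).
Proof.
apply: functional_extensionality => z; rewrite /pd /Hjoint /dHp.
apply: Derive_ext => r; congr H; apply: functional_extensionality => j; rewrite /upd.
  by rewrite eq_lrshift.
by rewrite eq_rshift.
Qed.

Section Compose.
Variables (d : nat) (T : R) (F : pt (d + d) -> R).
Hypothesis F_smooth : smooth F.
Hypothesis F_per : forall i : 'I_d, per_at (lshift d i) F.

(** [F] will be the Hamiltonian and [V] the gradient of [u]. Carrying the list [s] of derivatives
    makes the family closed under differentiation, up to the factors in [Dcomp], so that one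
    induction gives all orders of smoothness. *)
Definition slabcomp s (V : 'I_d -> pt d -> R -> R) (x : pt d) (t : R) : R :=
  iterD s F (joinp x (fun i => V i x t)).

Definition Dcomp s V (o : option 'I_d) x t :=
  sumI (fun i => (if o == Some i then 1 else 0) * slabcomp (lshift d i :: s) V x t) +
  sumI (fun i => slabcomp (rshift d i :: s) V x t * DD o (V i) x t).

Lemma comp_is_derive s V o x t : (forall i, SM T 1 (V i)) -> 0 < t < T ->
  is_derive (fun r => slabcomp s V (mvx o r x) (mvt o r t)) (cor o x t) (Dcomp s V o x t).
Proof.
move=> hV ht.
have [_ hd] := smooth_iterD s F_smooth.
pose c r := joinp (mvx o r x) (fun i => V i (mvx o r x) (mvt o r t)).
pose c' : pt (d + d) := fun j => match split j with inl i => if o == Some i then 1 else 0 | inr i => DD o (V i) x t end.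
have hc j : is_derive (fun r => c r j) (cor o x t) (c' j).
  rewrite /c /c' /joinp; case: split => [i|i]; last exact: (SM_der o x (hV i) ht).
  case: o {c c'} => [k|] /=; last exact: (@is_derive_const _ _ (x i)).
  rewrite /upd; case: (eqVneq i k) => [->|ne]; first by rewrite eqxx; exact: is_derive_id.
  have -> : (Some k == Some i) = false by apply/eqP => -[] e; rewrite e eqxx in ne.
  exact: (@is_derive_const _ _ (x i)).
have := @chain_rule (d + d) (iterD s F) (fun j => iterD (j :: s) F) (fun j => (smooth_iterD (j :: s) F_smooth).1) hd c c' _ hc.
rewrite /Dcomp sumI_split.
have -> : c (cor o x t) = joinp x (fun i => V i x t) by rewrite /c mvx_cor mvt_cor.
congr is_derive; congr (_ + _); apply: sumI_ext => i.
  by rewrite /c' (unsplitK (inl i)) Rmult_comm.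
by rewrite /c' (unsplitK (inr i)).
Qed.

Lemma ext0_comp_F s V : (forall i, ext0 T (V i)) -> ext0 T (slabcomp s V).
Proof.
move=> hV; split.
  move=> x t i ht; rewrite /slabcomp -[RHS](iterD_per s F_smooth (F_per i)) cat_l; congr iterD.
  apply: functional_extensionality => j; rewrite /joinp /upd.
  case: (split_ordP j) => [k ->|k ->]; first by rewrite eq_lshift.
  by rewrite eq_rlshift (hV k).1.
pose g i := proj1_sig (constructive_indefinite_description _ (hV i).2).
have hg i : slabcont (g i) /\ forall x t, 0 < t < T -> V i x t = g i x t.
  by rewrite /g; case: constructive_indefinite_description.
exists (fun x t => iterD s F (joinp x (fun i => g i x t))); split; last first.
  move=> x t ht; rewrite /slabcomp; congr (iterD s F (joinp _ _)).
  by apply: functional_extensionality => i; apply (hg i).2.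
apply: (cont_comp (c := fun z : pt d * R => joinp z.1 (fun i => g i z.1 z.2)) (f := iterD s F)).
  move=> z; apply: continuous_pt => j; rewrite /joinp; case: split => i; last exact: (hg i).1.
  by apply: (@continuous_coord_comp _ d (fun z : pt d * R => z.1)); exact: cont_fst.
exact: (smooth_iterD s F_smooth).1.
Qed.

Lemma SM_comp k s V : (forall i, SM T k (V i)) -> SM T k (slabcomp s V).
Proof.
elim: k s => [|k IH] s hV.
  by split => //; apply: ext0_comp_F => i; exact: SM_ext0 (hV i).
apply: (@SM_intro _ _ k _ (Dcomp s V)).
- by apply: ext0_comp_F => i; exact: SM_ext0 (hV i).
- move=> o x t ht; apply: comp_is_derive => // i; exact: SM_le (hV i).
- have h s' : SM T k (slabcomp s' V) by apply: IH => i; exact: SM_S (hV i).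
  move=> o; apply: SM_plus; apply: SM_sumI => i.
    by apply: SM_mult; [exact: SM_const|exact: h].
  by apply: SM_mult; [exact: h|exact: SM_DD (hV i)].
Qed.

Lemma DD_comp s V k x t : (forall i, SM T 1 (V i)) -> 0 < t < T ->
  DD (Some k) (slabcomp s V) x t = slabcomp (lshift d k :: s) V x t +
    sumI (fun i => slabcomp (rshift d i :: s) V x t * DD (Some k) (V i) x t).
Proof.
move=> hV ht.
transitivity (Dcomp s V (Some k) x t); first by apply: is_derive_unique; exact: comp_is_derive.
rewrite /Dcomp; congr (_ + _).
rewrite -(sumI_delta (fun i => slabcomp (lshift d i :: s) V x t) k); apply: sumI_ext => i.
have -> : (Some k == Some i) = (i == k) by rewrite eq_sym.
by case: (i == k); ring.
Qed.

End Compose.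

Lemma SM_space d T k (psi : pt d -> R) : smooth psi -> periodic psi -> SM T k (fun x _ => psi x).
Proof.
move=> hs hp.
have per i s : per_at i (iterD s psi) by apply: iterD_per => // z; exact: hp.
suff: forall s, SM T k (fun x _ => iterD s psi x) by move=> /(_ [::]).
have e0 s : ext0 T (fun x (_ : R) => iterD s psi x).
  split; first by move=> x t i _; exact: per.
  exists (fun x _ => iterD s psi x); split => //.
  apply: (cont_comp (c := fst)) => [z|]; first exact: cont_fst.
  exact: (smooth_iterD s hs).1.
elim: k => [|k IH] s; first by split.
apply: (@SM_intro _ _ k _ (fun o x _ => match o with Some i => iterD (i :: s) psi x | None => 0 end)).
- exact: e0.
- move=> [i|] x t _ /=; last exact: (@is_derive_const _ _ (iterD s psi x)).
  exact: (smooth_iterD s hs).2.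
- by case=> [i|]; [exact: IH|exact: SM_const].
Qed.

(** * Mollification *)

Lemma cont_powr_pos {U : UniformSpace} (f : U -> R) a : (forall z, 0 < f z) -> cont f ->
  cont (fun z => powr (f z) a).
Proof.
move=> h0 hf z; apply: (@continuous_comp _ _ _ f (fun y => powr y a)) => //.
exact: continuous_powr_pos.
Qed.

Lemma gfun_powr a z : 0 < a -> gfun a z = powr z a.
Proof.
move=> ha; rewrite /gfun /powr; case: Rlt_dec => //= _.
by case: Req_EM_T => //= e; lra.
Qed.

Section Convolution.
Variables (d : nat) (eta : pt d -> R) (eps : R).
Hypothesis eta_cont : cont eta.
Hypothesis eta_ge0 : forall w, 0 <= eta w.
Hypothesis eta_int : boxint (-1) 1 eta = 1.
Hypothesis eta_sym : forall w, eta (fun i => - w i) = eta w.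

Let le11 : -1 <= 1. Proof. lra. Qed.

Let shift_cont {U : UniformSpace} (x w : U -> pt d) : (forall z, continuous x z) ->
  (forall z, continuous w z) -> forall z, continuous (fun u => (fun i => x u i - eps * w u i) : pt d) z.
Proof.
move=> hx hw z; apply: continuous_pt => i; move: z.
apply: (cont_minus (f := fun u => x u i)); first by move=> z; exact: continuous_coord_comp.
apply: cont_mult; first exact: cont_const.
by move=> z; exact: continuous_coord_comp.
Qed.

Let integrand_cont2 f : cont f ->
  cont (fun z : pt d * pt d => eta z.2 * f (fun i => z.1 i - eps * z.2 i)).
Proof.
move=> hf; apply: cont_mult; first by apply: (cont_comp (c := snd)) => // z; exact: cont_snd.
by apply: cont_comp => //; apply: shift_cont => z; [exact: cont_fst|exact: cont_snd].
Qed.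

Let integrand_cont f x : cont f -> cont (fun w => eta w * f (fun i => x i - eps * w i)).
Proof.
by move=> hf; apply: (@cont_slice _ _ (fun x w => eta w * f (fun i => x i - eps * w i)) x); exact: integrand_cont2.
Qed.

Lemma conv_cont f : cont f -> cont (conv eta eps f).
Proof.
by move=> hf; apply: (@boxint_cont _ d (-1) 1 (fun x w => eta w * f (fun i => x i - eps * w i))) => //;
  exact: integrand_cont2.
Qed.

Lemma conv_periodic f : periodic f -> periodic (conv eta eps f).
Proof.
move=> hf x i; congr (boxint _ _ _); apply: functional_extensionality => w; congr (_ * _).
rewrite -[RHS](hf _ i); congr f; apply: functional_extensionality => j; rewrite /upd.
by case: eqP => [->|//]; ring.
Qed.

Lemma conv_lin f g a b x : cont f -> cont g ->
  conv eta eps (fun y => a * f y + b * g y) x = a * conv eta eps f x + b * conv eta eps g x.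
Proof.
move=> hf hg; have cf := @integrand_cont f x hf; have cg := @integrand_cont g x hg.
rewrite /conv -(boxint_scal le11 a cf) // -(boxint_scal le11 b cg) // -boxint_plus //; last first.
- by apply: cont_mult => //; exact: cont_const.
- by apply: cont_mult => //; exact: cont_const.
congr (boxint _ _ _); apply: functional_extensionality => w; ring.
Qed.

Lemma conv_le f g x : cont f -> cont g -> (forall y, f y <= g y) ->
  conv eta eps f x <= conv eta eps g x.
Proof.
move=> hf hg h; apply: boxint_le => //; try exact: integrand_cont.
by move=> w _; apply: Rmult_le_compat_l.
Qed.

Lemma conv_const c x : conv eta eps (fun _ => c) x = c.
Proof.
rewrite /conv; rewrite (_ : (fun w => eta w * c) = fun w => c * eta w); last first.
  by apply: functional_extensionality => w; ring.
by rewrite boxint_scal // eta_int; ring.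
Qed.

Lemma conv_ge f c x : cont f -> (forall y, c <= f y) -> c <= conv eta eps f x.
Proof. by move=> hf h; rewrite -{1}(conv_const c x); apply: conv_le => //; exact: cont_const. Qed.

Lemma torint_conv f : cont f -> periodic f -> torint (conv eta eps f) = torint f.
Proof.
move=> hf hp; rewrite /torint /conv boxint_swap //; try lra; last exact: integrand_cont2.
transitivity (boxint (-1) 1 (fun w => torint f * eta w)).
  congr (boxint _ _ _); apply: functional_extensionality => w.
  rewrite boxint_scal; [|lra|]; last first.
    apply: (cont_comp (f := f)) => //; apply: shift_cont => z; [exact: cont_id|exact: continuous_const].
  rewrite Rmult_comm; congr (_ * _).
  exact: (torint_shift (fun i => - (eps * w i)) hf hp).
by rewrite boxint_scal // eta_int Rmult_1_r.
Qed.

(** Translating [x] by [eps * w] moves the displacement from [g] to [f] with the opposite sign; the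
    reflection of [w] restores the sign because [eta] is even. *)
Lemma conv_sym f g : cont f -> periodic f -> cont g -> periodic g ->
  torint (fun x => f x * conv eta eps g x) = torint (fun x => conv eta eps f x * g x).
Proof.
move=> hf pf hg pg.
pose J (u v : pt d -> R) (w : pt d) := torint (fun x => u x * v (fun i => x i - eps * w i)).
have key u v : cont u -> cont v ->
    torint (fun x => u x * conv eta eps v x) = boxint (-1) 1 (fun w => eta w * J u v w).
  move=> hu hv.
  have c2 : cont (fun z : pt d * pt d => u z.1 * (eta z.2 * v (fun i => z.1 i - eps * z.2 i))).
    apply: cont_mult; last exact: integrand_cont2.
    apply: (cont_comp (c := fst)) => // z; exact: cont_fst.
  transitivity (torint (fun x => boxint (-1) 1 (fun w => u x * (eta w * v (fun i => x i - eps * w i))))).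
    congr (boxint _ _ _); apply: functional_extensionality => x.
    by rewrite boxint_scal //; exact: integrand_cont.
  rewrite /torint boxint_swap //; try lra.
  congr (boxint _ _ _); apply: functional_extensionality => w.
  rewrite /J /torint -boxint_scal; [|lra|]; last first.
    apply: cont_mult => //.
    apply: (cont_comp (f := v)) => //; apply: shift_cont => z; [exact: cont_id|exact: continuous_const].
  by congr (boxint _ _ _); apply: functional_extensionality => x; ring.
rewrite key // (_ : torint (fun x => conv eta eps f x * g x) = torint (fun x => g x * conv eta eps f x)); last first.
  by congr (boxint _ _ _); apply: functional_extensionality => x; ring.
rewrite key //.
have cJ u v : cont u -> cont v -> cont (J u v).
  move=> hu hv; apply: (@boxint_cont _ d 0 1 (fun w x => u x * v (fun i => x i - eps * w i))); first lra.
  apply: cont_mult; first by apply: (cont_comp (c := snd)) => // z; exact: cont_snd.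
  by apply: (cont_comp (f := v)) => //; apply: shift_cont => z; [exact: cont_snd|exact: cont_fst].
rewrite -[LHS](@boxint_reflect d (fun w => eta w * J f g w) 1); [|lra|]; last first.
  by apply: cont_mult => //; exact: cJ.
congr (boxint _ _ _); apply: functional_extensionality => w; rewrite eta_sym; congr (_ * _).
pose h : pt d := fun i => - (eps * w i).
rewrite /J -(@torint_shift d (fun x => f x * g (fun i => x i - eps * - w i)) h).
- congr (boxint _ _ _); apply: functional_extensionality => x; rewrite Rmult_comm; congr (g _ * f _).
  apply: functional_extensionality => i.
  by change (x i + - (eps * w i) - eps * - w i = x i); ring.
- apply: cont_mult => //.
  apply: (cont_comp (f := g)) => //; apply: (@shift_cont _ (fun x => x) (fun _ => fun i => - w i)) => z; [exact: cont_id|exact: continuous_const].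
- move=> x i; rewrite pf; congr (_ * _); rewrite -[RHS](pg _ i); congr g.
  apply: functional_extensionality => j; rewrite /upd; case: eqP => [->|//].
  by change (x i + 1 - eps * - w i = x i - eps * - w i + 1); ring.
Qed.

Lemma conv_jensen f p x : 1 <= p -> cont f -> (forall y, 0 <= f y) ->
  powr (conv eta eps f x) p <= conv eta eps (fun y => powr (f y) p) x.
Proof.
move=> hp hf f0.
apply: (@jensen _ (fun _ => True) cont (fun f => conv eta eps f x)) => //.
- by move=> u v c e hu hv; apply: cont_plus; apply: cont_mult => //; exact: cont_const.
- by move=> u v c e hu hv; exact: conv_lin.
- by move=> u v hu hv h; apply: conv_le => // y; exact: h.
- exact: cont_const.
- exact: conv_const.
- by apply: cont_powr => //; lra.
Qed.

Lemma conv_is_derive f g i x : cont f -> cont g ->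
  (forall x, is_derive (fun r => f (upd x i r)) (x i) (g x)) ->
  is_derive (fun r => conv eta eps f (upd x i r)) (x i) (conv eta eps g x).
Proof.
move=> hf hg hd.
pose F r w := eta w * f (fun j => upd x i r j - eps * w j).
pose F' r w := eta w * g (fun j => upd x i r j - eps * w j).
have cu : forall z : R * pt d, continuous (fun z : R * pt d => upd x i z.1 : pt d) z.
  by move=> z; apply: continuous_upd; [exact: continuous_const|exact: cont_fst].
have -> : conv eta eps g x = boxint (-1) 1 (F' (x i)) by rewrite /F' upd_id.
apply: (@is_derive_boxint d F F' (-1) 1 (x i - 1) (x i + 1)) => //; first lra.
- move=> s _; exact: integrand_cont.
- apply: cont_mult; first by apply: (cont_comp (c := snd)) => // z; exact: cont_snd.
  by apply: (cont_comp (f := g)) => //; apply: shift_cont => // z; exact: cont_snd.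
- move=> s w _; apply: is_derive_scal.
  pose y : pt d := fun j => upd x i s j - eps * w j.
  have := hd y.
  have -> : y i = s - eps * w i by rewrite /y upd_same.
  move=> h; rewrite -/y -[g y]Rmult_1_l.
  apply: (is_derive_ext (fun r => f (upd y i (r - eps * w i)))).
    move=> r; congr f; apply: functional_extensionality => j; rewrite /y /upd.
    by case: eqP => [->|].
  apply: (@is_derive_comp _ _ (fun r => f (upd y i r)) (fun r => r - eps * w i)) => //.
  by auto_derive.
Qed.

Section Coupling.
Variables (alpha kappa : R) (m : pt d -> R).
Hypothesis alpha_gt0 : 0 < alpha.
Hypothesis kappa_gt0 : 0 < kappa.
Hypothesis m_cont : cont m.
Hypothesis m_per : periodic m.
Hypothesis m_ge : forall x, kappa <= m x.

Let M := conv eta eps m.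
Let gM x := powr (M x) alpha.

Definition coupling := conv eta eps (fun y => gfun alpha (conv eta eps m y)).

Lemma couplingE : coupling = conv eta eps gM.
Proof.
rewrite /coupling; congr conv; apply: functional_extensionality => y; exact: gfun_powr.
Qed.

Let M_cont : cont M. Proof. exact: conv_cont. Qed.
Let M_per : periodic M. Proof. exact: conv_periodic. Qed.
Let M_ge x : kappa <= M x. Proof. exact: conv_ge. Qed.
Let M_gt0 x : 0 < M x. Proof. apply: Rlt_le_trans (M_ge x) => //. Qed.
Let gM_cont : cont gM. Proof. exact: cont_powr. Qed.
Let gM_per : periodic gM. Proof. by move=> x i; rewrite /gM M_per. Qed.

Lemma coupling_ge0 x : 0 <= coupling x.
Proof. rewrite couplingE; apply: conv_ge => // y; exact: powr_ge0. Qed.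

(** Self-adjointness moves the outer mollifier onto [m], where it meets the inner one; this is what
    mollifying twice is for. *)
Lemma torint_coupling_m : torint (fun x => coupling x * m x) = torint (fun x => powr (M x) (alpha + 1)).
Proof.
rewrite couplingE -conv_sym //; congr (boxint _ _ _); apply: functional_extensionality => x.
by rewrite powr_plus // powr_1 //; apply: Rlt_le; exact: M_gt0.
Qed.

Lemma torint_coupling : torint coupling = torint (fun x => powr (M x) alpha).
Proof. by rewrite couplingE torint_conv. Qed.

(** Serves to absorb a multiple of the coupling into half of its pairing with [m]. Where
    [M <= 2 * K] the power [M^alpha] is bounded; elsewhere [K * M^alpha] is at most half of
    [M^(alpha + 1)]. *)
Lemma torint_coupling_young (K : R) : 0 < K ->
  K * torint coupling <= / 2 * torint (fun x => coupling x * m x) + K * powr (2 * K) alpha.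
Proof.
move=> hK; rewrite torint_coupling torint_coupling_m.
have c1 : cont (fun x => powr (M x) (alpha + 1)) by apply: cont_powr => //; lra.
rewrite /torint -boxint_scal //; [|lra].
rewrite -boxint_scal //; [|lra].
rewrite -[X in _ + X](@boxint_const d) -boxint_plus; [|lra| |exact: cont_const]; last first.
  by apply: cont_mult => //; exact: cont_const.
apply: boxint_le; [lra|by apply: cont_mult => //; exact: cont_const| |].
  by apply: cont_plus; [apply: cont_mult => //|]; exact: cont_const.
move=> x _; rewrite powr_plus // powr_1; last by apply: Rlt_le; exact: M_gt0.
have p0 := powr_ge0 (M x) alpha; have hM := M_gt0 x.
case: (Rle_dec (M x) (2 * K)) => h.
  have : powr (M x) alpha <= powr (2 * K) alpha by apply: powr_le; lra.
  nra.
have p1 := powr_ge0 (2 * K) alpha.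
have : powr (M x) alpha * (2 * K) <= powr (M x) alpha * M x by apply: Rmult_le_compat_l; lra.
nra.
Qed.

(* Moving the outer mollifier onto [m2] and integrating by parts turns the
   integral into that of [- alpha * M^(alpha - 1) * M1^2], [M1] mollifying [m1]. *)
Lemma torint_coupling_D2 i (m1 m2 : pt d -> R) : cont m1 -> periodic m1 -> cont m2 -> periodic m2 ->
  (forall x, is_derive (fun r => m (upd x i r)) (x i) (m1 x)) ->
  (forall x, is_derive (fun r => m1 (upd x i r)) (x i) (m2 x)) ->
  torint (fun x => coupling x * m2 x) <= 0.
Proof.
move=> h1 p1 h2 p2 d1 d2; rewrite couplingE -conv_sym //.
pose M1 := conv eta eps m1; pose M2 := conv eta eps m2.
have cM1 : cont M1 by exact: conv_cont.
have cM2 : cont M2 by exact: conv_cont.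
pose A x := alpha * powr (M x) (alpha - 1) * (M1 x * M1 x).
have cA : cont A.
  apply: cont_mult; last exact: cont_mult.
  by apply: cont_mult; [exact: cont_const|exact: cont_powr_pos].
have e0 : torint (fun x => A x + gM x * M2 x) = 0.
  apply: (@torint_pd d i (fun x => gM x * M1 x)).
  - exact: cont_mult.
  - by move=> x j; rewrite gM_per /M1 conv_periodic.
  - by apply: cont_plus => //; exact: cont_mult.
  move=> x.
  have dM := conv_is_derive x m_cont h1 d1.
  have dM1 := conv_is_derive x h1 h2 d2.
  have dg : is_derive (fun r => gM (upd x i r)) (x i) (M1 x * (alpha * powr (M x) (alpha - 1))).
    apply: (@is_derive_comp _ _ (fun y => powr y alpha) (fun r => M (upd x i r))) => //.
    by rewrite upd_id; exact: is_derive_powr_pos.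
  have := @is_derive_mult _ (fun r => gM (upd x i r)) (fun r => M1 (upd x i r)) _ _ _ dg dM1 Rmult_comm.
  rewrite !upd_id /plus /mult /=.
  by rewrite (_ : M1 x * (alpha * powr (M x) (alpha - 1)) * M1 x + gM x * conv eta eps m2 x = A x + gM x * M2 x); last by rewrite /A /M2; ring.
rewrite /torint boxint_plus // in e0; [|lra|exact: cont_mult].
have : 0 <= boxint 0 1 A.
  apply: boxint_ge0 => //; first lra.
  move=> x _; apply: Rmult_le_pos; last by nra.
  by apply: Rmult_le_pos; [lra|exact: powr_ge0].
move=> A0; have e1 : boxint 0 1 (fun x => gM x * M2 x) <= 0 by lra.
exact: e1.
Qed.

(** Jensen's inequality twice, with exponent [p] for the outer mollifier and [alpha * p] for the
    inner one; [alpha] itself may be below 1. *)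
Lemma torint_coupling_powr p : 1 <= p -> 1 <= alpha * p ->
  torint (fun x => powr (coupling x) p) <= torint (fun x => powr (m x) (alpha * p)).
Proof.
move=> hp hap; rewrite couplingE.
have m0 x : 0 <= m x by apply: Rle_trans (m_ge x); lra.
have cg : cont (fun x => powr (gM x) p) by apply: cont_powr => //; lra.
have cm : cont (fun x => powr (m x) (alpha * p)) by apply: cont_powr => //; lra.
apply: Rle_trans (_ : torint (conv eta eps (fun x => powr (gM x) p)) <= _).
  apply: boxint_le; [lra| |exact: conv_cont|].
    by apply: cont_powr; [lra|exact: conv_cont].
  by move=> x _; apply: conv_jensen => // y; exact: powr_ge0.
rewrite torint_conv //; last by move=> x i; rewrite gM_per.
apply: Rle_trans (_ : torint (conv eta eps (fun x => powr (m x) (alpha * p))) <= _).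
  apply: boxint_le => //; [lra|exact: conv_cont|].
  move=> x _; rewrite /gM powr_powr; last by apply: Rlt_le; exact: M_gt0.
  exact: conv_jensen.
by rewrite torint_conv //; [lra|move=> x i; rewrite m_per].
Qed.

End Coupling.
End Convolution.

Create HintDb sm.

(** Proves smoothness by following the syntax of the function; an [ext0] goal is read as [SM] of
    order 0, and the atoms come from the hint base. *)
Ltac sm :=
  lazymatch goal with
  | |- ext0 _ _ => apply: (@SM_ext0 _ _ 0%N); sm
  | |- forall _, _ => intro; sm
  | |- SM _ _ (fun _ _ => ?c) => exact: SM_const
  | |- SM _ _ (fun x t => @?f x t + @?g x t) => apply: (@SM_plus _ _ _ f g); sm
  | |- SM _ _ (fun x t => @?f x t - @?g x t) => apply: (@SM_minus _ _ _ f g); sm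
  | |- SM _ _ (fun x t => - @?f x t) => apply: (@SM_opp _ _ _ f); sm
  | |- SM _ _ (fun x t => @?f x t * @?g x t) => apply: (@SM_mult _ _ _ f g); sm
  | |- SM _ _ (fun x t => sumI (@?f x t)) => apply: SM_sumI => ?; sm
  | |- SM ?T ?k (fun x t => ?f x t) => first [solve [auto with sm] | change (SM T k f); sm]
  | |- SM _ _ (DD _ _) => first [solve [auto with sm] | apply: SM_DD; sm]
  | |- _ => auto with sm
  end.

Section Rules.
Variables (d : nat) (T : R).
Implicit Types f g : pt d -> R -> R.

Lemma DD_plus o f g x t : SM T 1 f -> SM T 1 g -> 0 < t < T ->
  DD o (fun x t => f x t + g x t) x t = DD o f x t + DD o g x t.
Proof.
move=> hf hg ht; apply: is_derive_unique.
exact: (@is_derive_plus _ _ _ _ _ _ _ (SM_der o x hf ht) (SM_der o x hg ht)).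
Qed.

Lemma DD_mult o f g x t : SM T 1 f -> SM T 1 g -> 0 < t < T ->
  DD o (fun x t => f x t * g x t) x t = DD o f x t * g x t + f x t * DD o g x t.
Proof.
move=> hf hg ht; apply: is_derive_unique.
have := @is_derive_mult _ _ _ _ _ _ (SM_der o x hf ht) (SM_der o x hg ht) Rmult_comm.
by rewrite !mvx_cor !mvt_cor.
Qed.

Lemma DD_const o c x t : DD o (fun (_ : pt d) _ => c) x t = 0.
Proof. exact: Derive_const. Qed.

Lemma DD_scal o c f x t : SM T 1 f -> 0 < t < T ->
  DD o (fun x t => c * f x t) x t = c * DD o f x t.
Proof. by move=> hf ht; rewrite DD_mult //; [rewrite DD_const; ring|sm]. Qed.

Lemma DD_opp o f x t : SM T 1 f -> 0 < t < T -> DD o (fun x t => - f x t) x t = - DD o f x t.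
Proof.
move=> hf ht; apply: is_derive_unique.
exact: (@is_derive_opp _ _ _ _ _ (SM_der o x hf ht)).
Qed.

Lemma DD_minus o f g x t : SM T 1 f -> SM T 1 g -> 0 < t < T ->
  DD o (fun x t => f x t - g x t) x t = DD o f x t - DD o g x t.
Proof.
move=> hf hg ht; apply: is_derive_unique.
exact: (@is_derive_minus _ _ _ _ _ _ _ (SM_der o x hf ht) (SM_der o x hg ht)).
Qed.

Lemma DD_sumI o n (F : 'I_n -> pt d -> R -> R) x t : (forall i, SM T 1 (F i)) -> 0 < t < T ->
  DD o (fun x t => sumI (fun i => F i x t)) x t = sumI (fun i => DD o (F i) x t).
Proof.
move=> h ht; rewrite /sumI; elim: (index_enum _) => [|i s IH].
  rewrite big_nil; transitivity (DD o (fun _ _ => 0) x t); last exact: DD_const.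
  by apply: (@DD_ext d T o) => // y r _; rewrite big_nil.
rewrite big_cons -IH -DD_plus //.
  by apply: (@DD_ext d T o) => // y r _; rewrite big_cons.
elim: s {IH} => [|j s IH]; first by apply: SM_ext (@SM_const d T 1 0) => y r _; rewrite big_nil.
apply: SM_ext (SM_plus (h j) IH) => y r _; by rewrite big_cons.
Qed.

Lemma DD_powr_pos o f a x t : SM T 1 f -> 0 < t < T -> 0 < f x t ->
  DD o (fun x t => powr (f x t) a) x t = a * powr (f x t) (a - 1) * DD o f x t.
Proof.
move=> hf ht h0; apply: is_derive_unique; rewrite Rmult_comm.
apply: (@is_derive_comp _ _ (fun y => powr y a) (fun r => f (mvx o r x) (mvt o r t))).
  by rewrite mvx_cor mvt_cor; apply: is_derive_powr_pos.
exact: (SM_der o x hf ht).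
Qed.

Lemma DD_powr o f a x t : 1 < a -> SM T 1 f -> 0 < t < T ->
  DD o (fun x t => powr (f x t) a) x t = a * powr (f x t) (a - 1) * DD o f x t.
Proof.
move=> ha hf ht; apply: is_derive_unique; rewrite Rmult_comm.
apply: (@is_derive_comp _ _ (fun y => powr y a) (fun r => f (mvx o r x) (mvt o r t))).
  by rewrite mvx_cor mvt_cor; apply: is_derive_powr.
exact: (SM_der o x hf ht).
Qed.

(** Makes a time slice of [m] admissible as a test function independent of time, as the boundary
    term at [T] in [second_order] requires. *)
Lemma SM_freeze k f s : SM T k f -> 0 < s < T -> SM T k (fun x _ => f x s).
Proof.
elim: k f => [|k IH] f hf hs.
  have [[hp [g [hg e]]] _] := hf; split => //; split; first by move=> x t i _; exact: hp.
  exists (fun x _ => g x s); split; last by move=> x t _; exact: e.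
  by apply: (cont_comp2 (c := fun z : pt d * R => z.1) (e := fun _ => s) (f := g)) => // z;
    [exact: cont_fst|exact: continuous_const].
apply: (@SM_intro _ _ k _ (fun o x _ => match o with Some i => DD (Some i) f x s | None => 0 end)).
- exact: (SM_ext0 (IH f (SM_S hf) hs)).
- move=> [i|] x t _; first exact: (SM_der (Some i) x hf hs).
  exact: (@is_derive_const _ _ (f x s)).
- by case=> [i|]; [apply: (IH (DD (Some i) f)) => //; exact: SM_DD|exact: SM_const].
Qed.

End Rules.

(** * Limits at the end times, monotonicity and vanishing integrals *)

Lemma limit_le (T c : R) (phi : R -> R) : 0 < T -> cont phi -> (forall t, 0 < t < T -> phi t <= c) ->
  forall t, 0 <= t <= T -> phi t <= c.
Proof.
move=> hT hc h t ht; apply: Rnot_lt_le => hlt.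
have e0 : 0 < phi t - c by lra.
have /filterlim_locally /(_ (mkposreal _ e0)) [e he] := hc t.
pose k := Rmin (e / 2) (T / 3).
have k0 : 0 < k by apply: Rmin_pos; have := cond_pos e; lra.
have k1 : k <= e / 2 by exact: Rmin_l.
have k2 : k <= T / 3 by exact: Rmin_r.
have [s [hs1 hs2]] : exists s, 0 < s < T /\ Rabs (s - t) < e.
  case: (Rle_dec t (T / 2)) => h2.
    by exists (t + k); split; [lra|rewrite Rabs_pos_eq; lra].
  by exists (t - k); split; [lra|rewrite Rabs_left1; lra].
have := he s hs2; rewrite /ball /= /AbsRing_ball /abs /minus /plus /opp /=.
move=> /Rabs_def2 [_ h3]; have := h s hs1; lra.
Qed.

Lemma limit_eq (T : R) (phi psi : R -> R) : 0 < T -> cont phi -> cont psi ->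
  (forall t, 0 < t < T -> phi t = psi t) -> forall t, 0 <= t <= T -> phi t = psi t.
Proof.
move=> hT h1 h2 h t ht; apply: Rle_antisym.
  suff : phi t - psi t <= 0 by lra.
  apply: (@limit_le T 0 (fun t => phi t - psi t) hT (cont_minus h1 h2)) => // s hs.
  by rewrite h //; lra.
suff : psi t - phi t <= 0 by lra.
apply: (@limit_le T 0 (fun t => psi t - phi t) hT (cont_minus h2 h1)) => // s hs.
by rewrite h //; lra.
Qed.

Lemma slab_limit_ge d (T c : R) (g : pt d -> R -> R) : 0 < T -> slabcont g ->
  (forall x t, 0 < t < T -> c <= g x t) -> forall x t, 0 <= t <= T -> c <= g x t.
Proof.
move=> hT hg h x t ht.
suff : - g x t <= - c by lra.
apply: (@limit_le T (- c) (fun t => - g x t)) => //; last by move=> s hs; have := h x s hs; lra.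
apply: cont_opp; exact: (@cont_slice _ _ g x hg).
Qed.

Lemma nonincreasing (phi dphi : R -> R) a b : a <= b -> cont phi ->
  (forall t, a < t < b -> is_derive phi t (dphi t)) -> (forall t, a < t < b -> dphi t <= 0) ->
  phi b <= phi a.
Proof.
move=> hab hc hd hneg.
(* The mean value point may be an end of the interval, where nothing is known of [dphi]; the default
   0 has the right sign. *)
pose df t := if Rlt_dec a t then if Rlt_dec t b then dphi t else 0 else 0.
have [||c [hc1 hc2]] := MVT_gen phi a b df.
- rewrite Rmin_left ?Rmax_right //; move=> t ht; rewrite /df.
  case: Rlt_dec => /= ?; last lra.
  by case: Rlt_dec => /= ?; [exact: hd|lra].
- by move=> t _; apply/continuity_pt_filterlim; exact: hc.
have : df c <= 0.
  rewrite /df; case: Rlt_dec => /= h1; last lra.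
  by case: Rlt_dec => /= h2; [apply: hneg|lra].
nra.
Qed.

Lemma gronwall0 (phi dphi : R -> R) C T : 0 < T -> cont phi -> phi 0 <= 0 ->
  (forall t, 0 < t < T -> is_derive phi t (dphi t)) -> (forall t, 0 < t < T -> dphi t <= C * phi t) ->
  forall t, 0 <= t <= T -> phi t <= 0.
Proof.
move=> hT hc h0 hd hle t ht.
have hde s : is_derive (fun s => exp (- C * s)) s (- C * exp (- C * s)) by auto_derive => //; ring.
have : exp (- C * t) * phi t <= exp (- C * 0) * phi 0.
  apply: (@nonincreasing (fun s => exp (- C * s) * phi s)
    (fun s => - C * exp (- C * s) * phi s + exp (- C * s) * dphi s)); first lra.
  - apply: cont_mult => // s; apply: ex_derive_continuous; eexists; exact: hde.
  - move=> s hs; apply: (@is_derive_mult _ (fun s => exp (- C * s))) => //; [apply: hd; lra|exact: Rmult_comm].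
  - move=> s hs; have e0 := exp_pos (- C * s).
    have : exp (- C * s) * (dphi s - C * phi s) <= 0; last lra.
    have := hle s ltac:(lra); nra.
rewrite Rmult_0_r exp_0 Rmult_1_l => h.
have := exp_pos (- C * t); nra.
Qed.

Lemma RInt_zero (G : R -> R) : cont G -> (forall r, 0 <= G r) -> RInt G 0 1 <= 0 ->
  forall r, 0 <= r <= 1 -> G r = 0.
Proof.
move=> hG G0 hI r hr; apply: Rle_antisym => //; apply: Rnot_lt_le => hlt.
have /filterlim_locally /(_ (mkposreal _ hlt)) [e he] := hG r.
pose a := Rmax 0 (r - e / 2); pose b := Rmin 1 (r + e / 2).
have e0 := cond_pos e.
have ha : 0 <= a <= r by split; [exact: Rmax_l|apply: Rmax_lub; lra].
have ha2 : r - e / 2 <= a by exact: Rmax_r.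
have hb : r <= b <= 1 by split; [apply: Rmin_glb; lra|exact: Rmin_l].
have hb2 : b <= r + e / 2 by exact: Rmin_r.
have hab : a < b.
  rewrite /a /b; apply: Rmax_lub_lt; apply: Rmin_glb_lt; lra.
have ex u v : ex_RInt G u v by apply: ex_RInt_continuous => t _; exact: hG.
have p : 0 < RInt G a b.
  apply: RInt_gt_0 => // t ht.
  have bt : ball r e t.
    by rewrite /ball /= /AbsRing_ball /abs /minus /plus /opp /=; apply: Rabs_def1; lra.
  have := he t bt; rewrite /ball /= /AbsRing_ball /abs /minus /plus /opp /= => /Rabs_def2; lra.
have e1 : RInt G 0 a + RInt G a b = RInt G 0 b by exact: (RInt_Chasles G).
have e2 : RInt G 0 b + RInt G b 1 = RInt G 0 1 by exact: (RInt_Chasles G).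
have p1 : 0 <= RInt G 0 a by apply: RInt_ge_0 => //; lra.
have p2 : 0 <= RInt G b 1 by apply: RInt_ge_0 => //; lra.
lra.
Qed.

(** From the outermost integral inwards: a nonnegative continuous function of one variable with zero
    integral vanishes, so each inner integral is zero in turn. *)
Lemma torint_zero n (f : pt n -> R) : cont f -> periodic f -> (forall x, 0 <= f x) -> torint f <= 0 ->
  forall x, f x = 0.
Proof.
move=> hf hp f0 hI.
have key : forall k z, itint k 0 1 f z <= 0 ->
    forall w, (forall j : 'I_n, (j < k)%N -> 0 <= w j <= 1) -> (forall j : 'I_n, (k <= j)%N -> w j = z j) -> f w = 0.
  have pos k z : 0 <= itint k 0 1 f z.
    apply: Rle_trans (_ : itint k 0 1 (fun _ => 0 * 0) z <= _).
      by rewrite itint_scal ?Rmult_0_l //; [lra|lra|exact: cont_const].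
    apply: itint_le => //; [lra|exact: cont_const|].
    by move=> w _ _; rewrite Rmult_0_l.
  elim=> [|k IH] z hz w h1 h2.
    rewrite (_ : w = z); first by apply: Rle_antisym.
    by apply: functional_extensionality => j; exact: h2.
  have line r : 0 <= r <= 1 -> itint k 0 1 f (updn z k r) <= 0.
    move=> hr; right; apply: (@RInt_zero (fun r => itint k 0 1 f (updn z k r))) => //.
    by apply: itint_line => //; lra.
  case: (ltnP k n) => hk; last first.
    apply: (IH (updn z k 0)); first by apply: line; lra.
    - by move=> j hj; apply: h1; exact: ltnW.
    - by move=> j hj; have := leq_ltn_trans (leq_trans hk hj) (ltn_ord j); rewrite ltnn.
  pose i := Ordinal hk.
  apply: (IH (updn z k (w i))); first by apply: line; exact: h1.
  - by move=> j hj; apply: h1; exact: ltnW.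
  - move=> j hj; rewrite /updn; case: eqP => e.
      by congr w; apply: ord_inj.
    by apply: h2; rewrite ltn_neqAle hj andbT; apply/eqP => e'; exact: e.
move=> x; have [y [hy e]] := periodic_reduce x; rewrite (e f hp).
apply: (key n _ hI) => [j _|j]; first exact: hy.
by rewrite leqNgt ltn_ord.
Qed.

(** * Solutions of the regularized system *)

Definition hamil {d} (H : pt d -> pt d -> R) (u : pt d -> R -> R) : pt d -> R -> R :=
  slabcomp (Hjoint H) [::] (fun i => DD (Some i) u).
Definition drift {d} (H : pt d -> pt d -> R) (u : pt d -> R -> R) (i : 'I_d) : pt d -> R -> R :=
  slabcomp (Hjoint H) [:: rshift d i] (fun i => DD (Some i) u).

Record mfg_data d (T : R) (H : pt d -> pt d -> R) (uT m0 : pt d -> R) (alpha : R)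
    (eta : pt d -> R) (kappa0 : R) : Prop := MfgData {
  T_gt0 : 0 < T;
  H_smooth : smooth (Hjoint H);
  H_per : forall p, periodic (fun x => H x p);
  H_ge1 : forall x p, 1 <= H x p;
  uT_smooth : smooth uT;
  uT_per : periodic uT;
  m0_smooth : smooth m0;
  m0_per : periodic m0;
  m0_mass : torint m0 = 1;
  alpha_gt0 : 0 < alpha;
  kappa0_gt0 : 0 < kappa0;
  m0_ge : forall x, kappa0 <= m0 x;
  eta_mollifier : is_mollifier eta
}.

Lemma smooth_cont n (F : pt n -> R) : smooth F -> cont F.
Proof. by move=> h; exact: (smooth_iterD [::] h).1. Qed.

Section Solution.
Variables (d : nat) (T : R) (H : pt d -> pt d -> R) (uT m0 : pt d -> R) (alpha : R)
  (eta : pt d -> R) (kappa0 : R).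
Hypothesis data : mfg_data T H uT m0 alpha eta kappa0.
Variables (eps : R) (u m : pt d -> R -> R).
Hypothesis sol : is_solution T H uT m0 alpha eta eps u m.

Let hT : 0 < T := T_gt0 data.
Let F_per i : per_at (lshift d i) (Hjoint H).
Proof.
move=> z; rewrite /Hjoint -[RHS](H_per data _ _ i); congr H.
by apply: functional_extensionality => j; rewrite /upd eq_rlshift.
Qed.

Lemma SM_u k : SM T k u.
Proof. by case: sol => h1 [h2 _]; apply: smooth_slab_SM. Qed.

Lemma SM_m k : SM T k m.
Proof. by case: sol => _ [_ [h1 [h2 _]]]; apply: smooth_slab_SM. Qed.

Lemma SM_V i k : SM T k (DD (Some i) u).
Proof. exact: SM_DD (SM_u k.+1). Qed.

Lemma SM_hess s k : SM T k (slabcomp (Hjoint H) s (fun i => DD (Some i) u)).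
Proof.
apply: SM_comp => [||i]; [exact: H_smooth data|exact: F_per|exact: SM_V].
Qed.

Lemma SM_hamil k : SM T k (hamil H u). Proof. exact: SM_hess. Qed.
Lemma SM_drift i k : SM T k (drift H u i). Proof. exact: SM_hess. Qed.

Lemma hamilE x t : hamil H u x t = H x (grad u x t).
Proof. exact: Hjoint_cat. Qed.

Lemma driftE i x t : drift H u i x t = dHp i H x (grad u x t).
Proof. by rewrite /drift /slabcomp /= pd_Hjoint_r Hjoint_cat. Qed.

Let g := geps eta eps alpha m.

Lemma u_eq x t : 0 < t < T ->
  DD None u x t = hamil H u x t - sumI (fun i => DD (Some i) (DD (Some i) u) x t) - g x t.
Proof.
move=> ht; case: sol => _ [_ [_ [_ [/(_ x t ht) e _]]]].
rewrite hamilE /g; change (- DD None u x t + H x (grad u x t) =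
  sumI (fun i => DD (Some i) (DD (Some i) u) x t) + geps eta eps alpha m x t) in e.
lra.
Qed.

#[local] Hint Resolve SM_u SM_m SM_V SM_hess SM_hamil SM_drift : sm.

(** Read off the equation for [u], whose other terms are already known to be smooth; the double
    mollification is not differentiated. *)
Lemma SM_geps k : SM T k (geps eta eps alpha m).
Proof.
apply: (@SM_ext _ T k (fun x t => hamil H u x t - sumI (fun i => DD (Some i) (DD (Some i) u) x t) - DD None u x t)); last by sm.
move=> x t ht; rewrite u_eq // /g; ring.
Qed.
#[local] Hint Resolve SM_geps : sm.

Lemma m_eq x t : 0 < t < T ->
  DD None m x t = sumI (fun i => DD (Some i) (drift H u i) x t * m x t +
    drift H u i x t * DD (Some i) m x t + DD (Some i) (DD (Some i) m) x t).
Proof.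
move=> ht; case: sol => _ [_ [_ [_ [_ [/(_ x t ht) e _]]]]].
change (DD None m x t - sumI (fun i => DD (Some i) (fun y s => dHp i H y (grad u y s) * m y s) x t) =
  sumI (fun i => DD (Some i) (DD (Some i) m) x t)) in e.
rewrite sumI_plus -e.
rewrite (sumI_ext (g := fun i => DD (Some i) (fun y s => dHp i H y (grad u y s) * m y s) x t)); first ring.
move=> i; rewrite -(@DD_mult _ T) //; try by sm.
congr (DD (Some i) _ x t); apply: functional_extensionality => y; apply: functional_extensionality => s.
by rewrite driftE.
Qed.

Lemma u_T x : u x T = uT x.
Proof. by case: sol => _ [_ [_ [_ [_ [_ [h _]]]]]]. Qed.

Lemma m_0 x : m x 0 = m0 x.
Proof. by case: sol => _ [_ [_ [_ [_ [_ [_ h]]]]]]. Qed.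

Definition cl (f : pt d -> R -> R) x t := f x (clamp T t).

Lemma cl_in f x t : 0 <= t <= T -> cl f x t = f x t.
Proof. by move=> h; rewrite /cl clamp_id. Qed.

Lemma u_cl_cont : slabcont (cl u).
Proof. by apply: smooth_slab_clamp => //; case: sol. Qed.

Lemma m_cl_cont : slabcont (cl m).
Proof. by apply: smooth_slab_clamp => //; case: sol => _ [_ []]. Qed.

(* [e(t) = kappa0 exp(- K t)] is a subsolution for [K >= |div D_pH|]: apply
   Gronwall to the integral of [powr (e - m) 3], where [powr] vanishes on
   negative numbers and so takes the positive part. *)
Lemma m_positive : exists k, 0 < k /\ forall x t, 0 < t < T -> k <= m x t.
Proof.
have k0 := kappa0_gt0 data.
have [K0 hK0] := ext0_bounded (ltac:(sm) : ext0 T (fun x t => sumI (fun i => DD (Some i) (drift H u i) x t))).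
have [B hB] := ext0_bounded (ltac:(sm) : ext0 T (fun x t => sumI (fun i => drift H u i x t * drift H u i x t))).
pose K := Rabs K0.
have hK x t : 0 < t < T -> - K <= sumI (fun i => DD (Some i) (drift H u i) x t) <= K.
  move=> ht; apply/Rabs_le_between; apply: Rle_trans (hK0 x t ht) (Rle_abs _).
have K_ge0 : 0 <= K by exact: Rabs_pos.
pose e t := kappa0 * exp (- K * t).
have e0 t : 0 < e t by apply: Rmult_lt_0_compat => //; exact: exp_pos.
have SMe k : SM T k (fun _ : pt d => e) by exact: SM_exp.
pose N x t := e t - m x t.
have SMN k : SM T k N by apply: SM_minus => //; exact: SM_m.
(* The flux of [powr N 3] contains [powr N 2], which must be differentiable across 0; starting from
   a square would leave [powr N 1] there. *)
have SMN1 : SM T 1 (fun x t => powr (N x t) 2) by apply: SM_powr => //; rewrite /INR; lra.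
have SMN3 : SM T 1 (fun x t => powr (N x t) 3) by apply: SM_powr => //; rewrite /INR; lra.
pose P i x t := 3 * (powr (N x t) 2 * DD (Some i) N x t).
pose Q x t := 3 * powr (N x t) 2 * (- K * e t - sumI (fun i => DD (Some i) (drift H u i) x t) * m x t)
   + sumI (fun i => 3 * powr (N x t) 2 * (drift H u i x t * DD (Some i) N x t)
                    - 6 * (powr (N x t) 1 * (DD (Some i) N x t * DD (Some i) N x t))).
have SMP i : SM T 1 (P i).
  by apply: SM_scal; apply: SM_mult => //; exact: SM_DD (SMN 2%N).
have ext1 : ext0 T (fun x t => powr (N x t) 1) by apply: ext0_powr; [lra|exact: SM_ext0 (SMN 0%N)].
have ext2 : ext0 T (fun x t => powr (N x t) 2) by exact: SM_ext0 SMN1.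
have extQ : ext0 T Q.
  apply: ext0_plus.
    apply: ext0_mult; first by apply: ext0_mult => //; exact: ext0_const.
    apply: (SM_ext0 (k := 0)); apply: SM_minus; last by sm.
    by apply: SM_mult; [exact: SM_const|exact: SMe].
  apply: ext0_sumI => i.
  apply: (@ext0_plus _ _ _ (fun x t => - (6 * _))).
    apply: ext0_mult; first by apply: ext0_mult => //; exact: ext0_const.
    by apply: (SM_ext0 (k := 0)); apply: SM_mult; [exact: SM_drift|exact: SM_DD (SMN 1%N)].
  have h6 : ext0 T (fun x t => -6 * (powr (N x t) 1 * (DD (Some i) N x t * DD (Some i) N x t))).
    apply: ext0_mult; first exact: ext0_const.
    apply: ext0_mult => //; apply: (SM_ext0 (k := 0)); apply: SM_mult; exact: SM_DD (SMN 1%N).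
  by apply: ext0_ext h6 => x t _; ring.
have DN i x t : 0 < t < T -> DD (Some i) N x t = - DD (Some i) m x t.
  move=> ht; rewrite /N (@DD_minus _ T) //; [|exact: SM_m].
  by rewrite (_ : DD (Some i) (fun _ => e) x t = 0); [ring|exact: (DD_const (Some i) (e t) x t)].
have DDN i x t : 0 < t < T -> DD (Some i) (DD (Some i) N) x t = - DD (Some i) (DD (Some i) m) x t.
  move=> ht; rewrite (@DD_ext _ T (Some i) _ (fun x t => - DD (Some i) m x t)) //; last by move=> *; exact: DN.
  by rewrite (@DD_opp _ T) //; sm.
have DtN x t : 0 < t < T -> DD None N x t = - K * e t - DD None m x t.
  move=> ht; rewrite /N (@DD_minus _ T) //; [|exact: SM_m]; congr (_ - _).
  by apply: is_derive_unique; rewrite /= /e; auto_derive => //; ring.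
have eqn x t : 0 < t < T -> DD None (fun x t => powr (N x t) 3) x t =
    Q x t + sumI (fun i => DD (Some i) (P i) x t).
  move=> ht; rewrite (@DD_powr _ T) //; last lra.
  rewrite DtN // m_eq //.
  have -> : 3 - 1 = 2 by ring.
  have eP i : DD (Some i) (P i) x t = 6 * (powr (N x t) 1 * (DD (Some i) N x t * DD (Some i) N x t))
      - 3 * powr (N x t) 2 * DD (Some i) (DD (Some i) m) x t.
    rewrite /P (@DD_scal _ T) //; last by apply: SM_mult => //; exact: SM_DD (SMN 2%N).
    rewrite (@DD_mult _ T) //; last exact: SM_DD (SMN 2%N).
    rewrite (@DD_powr _ T) //; last lra.
    rewrite DDN // (_ : 2 - 1 = 1); [ring|ring].
  rewrite (sumI_ext eP) /Q Rplus_assoc -sumI_plus.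
  rewrite (sumI_ext (f := fun i => DD (Some i) (drift H u i) x t * m x t +
    drift H u i x t * DD (Some i) m x t + DD (Some i) (DD (Some i) m) x t)
    (g := fun i => m x t * DD (Some i) (drift H u i) x t +
    (drift H u i x t * DD (Some i) m x t + DD (Some i) (DD (Some i) m) x t))); last by move=> i; ring.
  rewrite sumI_plus sumI_scal.
  rewrite [X in _ = _ + X](sumI_ext (g := fun i => (- 3 * powr (N x t) 2) *
     (drift H u i x t * DD (Some i) m x t + DD (Some i) (DD (Some i) m) x t))); last by move=> i; rewrite DN //; ring.
  rewrite sumI_scal; ring.
(* [3 * K] comes from the divergence of the drift, [B] from completing the square between the drift
   term and the gradient of [N]. *)
pose C := 3 * K + B.
have Qle x t : 0 < t < T -> Q x t <= C * powr (N x t) 3.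
  move=> ht.
  have p2 := powr_ge0 (N x t) 2; have p1 := powr_ge0 (N x t) 1; have p3 := powr_ge0 (N x t) 3.
  have p23 : powr (N x t) 3 = powr (N x t) 2 * powr (N x t) 1.
    by rewrite -powr_plus0; [congr powr; ring|lra|lra].
  have p22 : powr (N x t) 2 = powr (N x t) 1 * powr (N x t) 1.
    by rewrite -powr_plus0; [congr powr; ring|lra|lra].
  have pN : powr (N x t) 2 * N x t = powr (N x t) 3.
    case: (Rle_dec (N x t) 0) => h; first by rewrite !powr_neg; lra.
    by rewrite p23 (@powr_1 (N x t)) //; lra.
  have b1 : sumI (fun i => 3 * powr (N x t) 2 * (drift H u i x t * DD (Some i) N x t)
                    - 6 * (powr (N x t) 1 * (DD (Some i) N x t * DD (Some i) N x t)))
     <= B * powr (N x t) 3.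
    apply: Rle_trans (_ : sumI (fun i => powr (N x t) 3 * (drift H u i x t * drift H u i x t)) <= _).
      apply: sumI_le => i; rewrite p23 {1}p22 p22.
      set a := powr _ 1 in p1 *; set b := drift _ _ _ _ _; set D := DD _ _ _ _.
      have : 0 <= a * ((a * b - 3 / 2 * D) * (a * b - 3 / 2 * D)) by apply: Rmult_le_pos => //; exact: Rle_0_sqr.
      have : 0 <= a * (D * D) by apply: Rmult_le_pos => //; exact: Rle_0_sqr.
      move=> h1 h2; nra.
    rewrite sumI_scal Rmult_comm; apply: Rmult_le_compat_r => //.
    exact: Rle_trans (Rle_abs _) (hB x t ht).
  have [hK1 hK2] := hK x t ht.
  rewrite /Q; set S := sumI (fun i => DD _ _ _ _) in hK1 hK2 *.
  have -> : 3 * powr (N x t) 2 * (- K * e t - S * m x t) =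
     3 * (- ((K + S) * e t) * powr (N x t) 2 + S * powr (N x t) 3) by rewrite -pN /N; ring.
  have : 0 <= (K + S) * e t * powr (N x t) 2.
    by apply: Rmult_le_pos => //; apply: Rmult_le_pos; [lra|apply: Rlt_le].
  have : S * powr (N x t) 3 <= K * powr (N x t) 3 by apply: Rmult_le_compat_r.
  rewrite /C; lra.
pose G x t := powr (e t - cl m x t) 3.
have cG : slabcont G.
  apply: cont_powr; first lra.
  apply: cont_minus; last exact: m_cl_cont.
  apply: (cont_comp (c := snd) (f := e)) => [z|z]; first exact: cont_snd.
  by apply: ex_derive_continuous; rewrite /e; auto_derive.
have GN x t : 0 < t < T -> powr (N x t) 3 = G x t by move=> ht; rewrite /G cl_in //; lra.
have le0 t : 0 <= t <= T -> sp G t <= 0.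
  apply: (@gronwall0 (sp G) (fun t => sp Q t) C T hT); first exact: sp_cont.
  - right; rewrite -[RHS](@sp_const d 0 0); congr (boxint _ _ _).
    apply: functional_extensionality => x; rewrite /G cl_in; last lra.
    rewrite m_0 powr_neg //; [lra|].
    have := m0_ge data x; rewrite /e Rmult_0_r exp_0; lra.
  - move=> s hs.
    apply: is_derive_ext_loc (sp_balance SMN3 extQ SMP eqn hs).
    have hl : locally s (fun r => 0 < r < T) := @near_slab d T None (fun _ => 0) s hs.
    by apply: filter_imp hl => r hr; apply: sp_eq hr.
  - move=> s hs; rewrite -(sp_eq GN hs) -(@sp_scal _ T) //; last exact: SM_ext0 SMN3.
    apply: (@sp_le _ T) => //; last by move=> x; exact: Qle.
    by apply: ext0_mult; [exact: ext0_const|exact: SM_ext0 SMN3].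
exists (kappa0 * exp (- K * T)); split; first by apply: Rmult_lt_0_compat => //; exact: exp_pos.
move=> x t ht.
have hz : powr (N x t) 3 = 0.
  apply: (@torint_zero d (fun x => powr (N x t) 3)).
  - exact: ext0_slice (SM_ext0 SMN3) ht.
  - exact: ext0_periodic (SM_ext0 SMN3) ht.
  - by move=> y; exact: powr_ge0.
  - have := le0 t; rewrite -(sp_eq GN ht) /sp; apply; lra.
apply: Rle_trans (_ : e t <= _).
  apply: Rmult_le_compat_l; first lra.
  case: (Req_dec (- K * T) (- K * t)) => [->|ne]; first lra.
  left; apply: exp_increasing; nra.
apply: Rnot_lt_le => hlt.
have : 0 < powr (N x t) 3 by apply: powr_gt0; rewrite /N; lra.
lra.
Qed.

Lemma mass t : 0 <= t <= T -> sp (cl m) t = 1.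
Proof.
move=> ht; rewrite -(m0_mass data).
have e0 : sp (cl m) 0 = torint m0.
  congr (boxint _ _ _); apply: functional_extensionality => x; rewrite cl_in ?m_0 //; lra.
have := @balance d T m (fun _ _ => 0) (fun i x t => drift H u i x t * m x t + DD (Some i) m x t) (cl m) 0 t.
rewrite e0 sint_const => h.
suff : sp (cl m) t - torint m0 = 0 * (t - 0) by lra.
apply: h => //; try lra; try by sm.
- move=> x s hs; rewrite m_eq // Rplus_0_l; apply: sumI_ext => i.
  by rewrite (@DD_plus _ T) ?(@DD_mult _ T) //; sm.
- exact: m_cl_cont.
- by move=> x s hs; rewrite cl_in //; lra.
Qed.

End Solution.

Lemma iterD_comm n (F : pt n -> R) i j s : smooth F ->
  iterD [:: i, j & s] F = iterD [:: j, i & s] F.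
Proof.
move=> hF; apply: functional_extensionality => z.
case: (eqVneq i j) => [->//|ne].
pose X u v := upd (upd z j v) i u.
have Xc u v : X u v = upd (upd z i u) j v by rewrite /X upd_comm // eq_sym.
have Xi u v : X u v i = u by rewrite /X upd_same.
have Xj u v : X u v j = v by rewrite Xc upd_same.
have Xiu u v a : upd (X u v) i a = X a v by rewrite /X upd_upd.
have Xju u v a : upd (X u v) j a = X u a by rewrite !Xc upd_upd.
have Xz : X (z i) (z j) = z by rewrite /X upd_id upd_id.
have dI s' u v : is_derive (fun a => iterD s' F (X a v)) u (iterD (i :: s') F (X u v)).
  have := (smooth_iterD s' hF).2 i (X u v); rewrite Xi.
  by apply: is_derive_ext => a; rewrite Xiu.
have dJ s' u v : is_derive (fun a => iterD s' F (X u a)) v (iterD (j :: s') F (X u v)).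
  have := (smooth_iterD s' hF).2 j (X u v); rewrite Xj.
  by apply: is_derive_ext => a; rewrite Xju.
have cX s' : continuity_2d_pt (fun u v => iterD s' F (X u v)) (z i) (z j).
  apply/continuity_2d_pt_filterlim.
  have c : cont (fun q : R * R => iterD s' F (X q.1 q.2)).
    apply: (cont_comp (c := fun q : R * R => X q.1 q.2)); last exact: (smooth_iterD s' hF).1.
    move=> q; apply: continuous_upd; last exact: cont_fst.
    by apply: continuous_upd; [exact: continuous_const|exact: cont_snd].
  exact: (c (z i, z j)).
have e1 u v : Derive (fun a => iterD s F (X a v)) u = iterD (i :: s) F (X u v) by exact: is_derive_unique.
have e2 u v : Derive (fun a => iterD s F (X u a)) v = iterD (j :: s) F (X u v) by exact: is_derive_unique.
have e12 u v : Derive (fun a => Derive (fun b => iterD s F (X a b)) v) u = iterD [:: i, j & s] F (X u v).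
  by rewrite (Derive_ext _ (fun a => iterD (j :: s) F (X a v))) //; exact: is_derive_unique.
have e21 u v : Derive (fun a => Derive (fun b => iterD s F (X b a)) u) v = iterD [:: j, i & s] F (X u v).
  by rewrite (Derive_ext _ (fun a => iterD (i :: s) F (X u a))) //; exact: is_derive_unique.
have := @Schwarz (fun u v => iterD s F (X u v)) (z i) (z j).
rewrite e12 e21 Xz; apply.
- exists (mkposreal 1 Rlt_0_1) => u v _ _; split; first by eexists; exact: dI.
  split; first by eexists; exact: dJ.
  split.
    by apply: (ex_derive_ext (fun a => iterD (j :: s) F (X a v))) => //; eexists; exact: dI.
  by apply: (ex_derive_ext (fun a => iterD (i :: s) F (X u a))) => //; eexists; exact: dJ.
- by apply: continuity_2d_pt_ext (cX [:: i, j & s]) => u v; rewrite e12.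
- by apply: continuity_2d_pt_ext (cX [:: j, i & s]) => u v; rewrite e21.
Qed.

(** * Duality identities *)

Section Pairing.
Variables (d : nat) (T : R) (H : pt d -> pt d -> R) (uT m0 : pt d -> R) (alpha : R)
  (eta : pt d -> R) (kappa0 : R).
Hypothesis data : mfg_data T H uT m0 alpha eta kappa0.
Variables (eps : R) (u m : pt d -> R -> R).
Hypothesis sol : is_solution T H uT m0 alpha eta eps u m.

Let hT : 0 < T := T_gt0 data.
Let g := geps eta eps alpha m.
Let h := hamil H u.
Let b := drift H u.
Let lapu (x : pt d) t := sumI (fun k => DD (Some k) (DD (Some k) u) x t).

Let SMu k : SM T k u := SM_u data sol k.
Let SMm k : SM T k m := SM_m data sol k.
Let SMh k : SM T k h := SM_hamil data sol k.
Let SMb i k : SM T k (b i) := SM_drift data sol i k.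
Let SMg k : SM T k g := SM_geps data sol k.
Let SMs s k : SM T k (slabcomp (Hjoint H) s (fun i => DD (Some i) u)) := SM_hess data sol s k.
#[local] Hint Resolve SMu SMm SMh SMb SMg SMs : sm.

Let SMlap k : SM T k lapu. Proof. rewrite /lapu; sm. Qed.
#[local] Hint Resolve SMlap : sm.

(** Taken at [psi = m0] for the first order estimate, and at second derivatives of [m0] to bound the
    Laplacian of [u] tested against [m0] at time 0. *)
Lemma pair_u psi : smooth psi -> periodic psi ->
  torint (fun x => uT x * psi x) - torint (fun x => u x 0 * psi x) =
  sint (fun x t => (h x t - g x t) * psi x + sumI (fun i => DD (Some i) u x t * pd i psi x)) 0 T.
Proof.
move=> hpsi ppsi.
have SMpsi k : SM T k (fun x _ => psi x) by exact: SM_space.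
have SMdpsi i k : SM T k (fun x _ => pd i psi x) by exact: (SM_DD (Some i) (SMpsi k.+1)).
have bal := @balance d T (fun x t => u x t * psi x)
  (fun x t => (h x t - g x t) * psi x + sumI (fun i => DD (Some i) u x t * pd i psi x))
  (fun i x t => - (DD (Some i) u x t * psi x)) (fun x t => cl T u x t * psi x) 0 T.
rewrite -{}bal; try lra; try by sm.
- congr (_ - _); congr (boxint _ _ _); apply: functional_extensionality => x.
    by rewrite cl_in ?(u_T sol) //; lra.
  by rewrite cl_in //; lra.
- move=> x t ht; rewrite (@DD_mult _ T) //; try by sm.
  rewrite (u_eq sol x ht) (_ : DD None (fun y _ => psi y) x t = 0); last exact: (DD_const None (psi x) x t).
  rewrite [X in _ = _ + X](sumI_ext (g := fun i => - (DD (Some i) u x t * pd i psi x) -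
     psi x * DD (Some i) (DD (Some i) u) x t)).
    by rewrite sumI_minus sumI_opp sumI_scal /h /g; ring.
  move=> i; rewrite (@DD_opp _ T) // ?(@DD_mult _ T) //; try by sm.
  change (DD (Some i) (fun y _ => psi y) x t) with (pd i psi x); ring.
- apply: cont_mult; first exact: (u_cl_cont data sol).
  by apply: (cont_comp (c := fst)); [move=> z; exact: cont_fst|exact: smooth_cont].
- by move=> x t ht; rewrite cl_in //; lra.
Qed.

Lemma pair_um :
  torint (fun x => uT x * m x T) - torint (fun x => u x 0 * m0 x) =
  sint (fun x t => (h x t - g x t - sumI (fun i => b i x t * DD (Some i) u x t)) * m x t) 0 T.
Proof.
have bal := @balance d T (fun x t => u x t * m x t)
  (fun x t => (h x t - g x t - sumI (fun i => b i x t * DD (Some i) u x t)) * m x t)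
  (fun i x t => u x t * DD (Some i) m x t - DD (Some i) u x t * m x t + u x t * b i x t * m x t)
  (fun x t => cl T u x t * cl T m x t) 0 T.
rewrite -{}bal; try lra; try by sm.
- congr (_ - _); congr (boxint _ _ _); apply: functional_extensionality => x.
    by rewrite !cl_in ?(u_T sol) //; lra.
  by rewrite !cl_in ?(m_0 sol) //; lra.
- move=> x t ht; rewrite (@DD_mult _ T) //; try by sm.
  rewrite (u_eq sol x ht) (m_eq data sol x ht).
  rewrite [X in _ = _ + X](sumI_ext (g := fun i =>
     u x t * (DD (Some i) (drift H u i) x t * m x t + drift H u i x t * DD (Some i) m x t +
       DD (Some i) (DD (Some i) m) x t) - m x t * DD (Some i) (DD (Some i) u) x t
       + m x t * (b i x t * DD (Some i) u x t))).
    by rewrite [in RHS]sumI_plus [in RHS]sumI_minus !sumI_scal /h /g; ring.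
  move=> i; rewrite (@DD_plus _ T) // ?(@DD_minus _ T) //; try by sm.
  rewrite (@DD_mult _ T (Some i) (fun x t => u x t * b i x t) m) //; try by sm.
  rewrite !(@DD_mult _ T) //; try by sm.
  rewrite /b; ring.
- by apply: cont_mult; [exact: (u_cl_cont data sol)|exact: (m_cl_cont data sol)].
- by move=> x t ht; rewrite !cl_in //; lra.
Qed.

Let Zfun (x : pt d) t := sumI (fun k => DD (Some k) (DD (Some k) h) x t - b k x t * DD (Some k) lapu x t).

Lemma SM_Z k : SM T k Zfun. Proof. rewrite /Zfun; sm. Qed.

(** The Laplacian of the equation for [u], tested with [m]. The last part of the flux moves both
    derivatives from the coupling onto [m], where [torint_coupling_D2] gives a sign. [L] supplies
    values at the end times, where [lapu] itself is not controlled. *)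
Lemma pair_lap (L : pt d -> R -> R) : slabcont L -> (forall x t, 0 < t < T -> lapu x t = L x t) ->
  sp (fun x t => L x t * cl T m x t) T - sp (fun x t => L x t * cl T m x t) 0 =
  sint (fun x t => Zfun x t * m x t - g x t * sumI (fun k => DD (Some k) (DD (Some k) m) x t)) 0 T.
Proof.
move=> cL eL; have SMZ := SM_Z.
apply: (@balance d T (fun x t => lapu x t * m x t) _
  (fun i x t => lapu x t * DD (Some i) m x t - DD (Some i) lapu x t * m x t
     + lapu x t * b i x t * m x t + (g x t * DD (Some i) m x t - DD (Some i) g x t * m x t))); try lra; try by sm.
- move=> x t ht; rewrite (@DD_mult _ T) //; try by sm.
  have -> : DD None lapu x t = sumI (fun k => DD (Some k) (DD (Some k) h) x t -
      DD (Some k) (DD (Some k) lapu) x t - DD (Some k) (DD (Some k) g) x t).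
    rewrite /lapu (@DD_sumI _ T) //; [|by sm]; apply: sumI_ext => k.
    rewrite (@DD_comm _ T None (Some k)) //; [|by sm].
    rewrite (@DD_ext _ T (Some k) _ (DD (Some k) (DD None u))) //; last first.
      by move=> y s hs; apply: (@DD_comm _ T None (Some k)) => //; sm.
    rewrite (@DD_ext _ T (Some k) _ (DD (Some k) (fun x t => h x t - lapu x t - g x t))) //; last first.
      move=> y s hs; apply: (@DD_ext _ T) => // y' s' hs'; exact: (u_eq sol y' hs').
    rewrite (@DD_ext _ T (Some k) _ (fun x t => DD (Some k) h x t - DD (Some k) lapu x t - DD (Some k) g x t)) //; last first.
      by move=> y s hs; rewrite !(@DD_minus _ T) //; sm.
    by rewrite !(@DD_minus _ T) //; sm.
  (* The summands of the equation for [m] are hidden behind [A], so that the sum rules used next do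
     not split them. *)
  have [A [hA eA]] : exists A : 'I_d -> R, (forall i, A i = DD (Some i) (drift H u i) x t * m x t +
      drift H u i x t * DD (Some i) m x t + DD (Some i) (DD (Some i) m) x t) /\ DD None m x t = sumI A.
    by eexists; split; last exact: (m_eq data sol x ht).
  rewrite eA /Zfun.
  rewrite [X in _ = _ + X](sumI_ext (g := fun i => lapu x t * A i + m x t * (b i x t * DD (Some i) lapu x t -
         DD (Some i) (DD (Some i) lapu) x t - DD (Some i) (DD (Some i) g) x t)
       + g x t * DD (Some i) (DD (Some i) m) x t)).
    rewrite !sumI_plus !sumI_scal !sumI_minus !sumI_opp; ring.
  move=> i; rewrite hA (@DD_plus _ T) //; try by sm.
  rewrite (@DD_plus _ T _ (fun x t => lapu x t * DD (Some i) m x t - DD (Some i) lapu x t * m x t)) //; try by sm.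
  rewrite !(@DD_minus _ T) //; try by sm.
  rewrite (@DD_mult _ T _ (fun x t => lapu x t * b i x t) m) //; try by sm.
  rewrite !(@DD_mult _ T) //; try by sm.
  rewrite /b; ring.
- by apply: cont_mult => //; exact: (m_cl_cont data sol).
- by move=> x t ht; rewrite eL // cl_in //; lra.
Qed.

Definition hessu x t : mat d := fun i j => DD (Some i) (DD (Some j) u) x t.

Lemma hessu_sym x t : 0 < t < T -> msym (hessu x t).
Proof. move=> ht i j; apply: (@DD_comm _ T) => //; sm. Qed.

(* The third derivatives of [u] cancel. *)
Lemma ZE x t : 0 < t < T -> Zfun x t =
  mtr (fun i j => dHx i (dHx j H) x (grad u x t)) +
  2 * mtr (mmul (fun i j => dHp i (dHx j H) x (grad u x t)) (hessu x t)) +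
  mtr (mmul (fun i j => dHp i (dHp j H) x (grad u x t)) (mmul (hessu x t) (hessu x t))).
Proof.
move=> ht.
have V1 i : SM T 1 (DD (Some i) u) by sm.
pose V := fun i => DD (Some i) u.
pose F := Hjoint H.
have Fs : smooth F := H_smooth data.
have cE s (G : pt d -> pt d -> R) : iterD s F = Hjoint G -> slabcomp F s V x t = G x (grad u x t).
  by move=> e; rewrite /slabcomp e Hjoint_cat.
have exx i j : slabcomp F [:: lshift d i; lshift d j] V x t = dHx i (dHx j H) x (grad u x t).
  by apply: cE; rewrite /= !pd_Hjoint_l.
have epx i j : slabcomp F [:: rshift d i; lshift d j] V x t = dHp i (dHx j H) x (grad u x t).
  by apply: cE; rewrite /= pd_Hjoint_l pd_Hjoint_r.
have epp i j : slabcomp F [:: rshift d i; rshift d j] V x t = dHp i (dHp j H) x (grad u x t).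
  by apply: cE; rewrite /= !pd_Hjoint_r.
have exp i j : slabcomp F [:: lshift d j; rshift d i] V x t = dHp i (dHx j H) x (grad u x t).
  by rewrite -epx /slabcomp iterD_comm.
have D1 k y s : 0 < s < T -> DD (Some k) h y s = slabcomp F [:: lshift d k] V y s +
     sumI (fun i => slabcomp F [:: rshift d i] V y s * DD (Some k) (V i) y s).
  by move=> hs; exact: (@DD_comp d T F Fs [::] V k y s V1 hs).
have D2 k : DD (Some k) (DD (Some k) h) x t = dHx k (dHx k H) x (grad u x t) +
    2 * sumI (fun i => dHp i (dHx k H) x (grad u x t) * hessu x t k i) +
    sumI (fun i => sumI (fun j => dHp j (dHp i H) x (grad u x t) * (hessu x t k j * hessu x t k i))) +
    sumI (fun i => b i x t * DD (Some i) (fun y s => DD (Some k) (DD (Some k) u) y s) x t).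
  rewrite (@DD_ext _ T (Some k) _ (fun y s => slabcomp F [:: lshift d k] V y s +
     sumI (fun i => slabcomp F [:: rshift d i] V y s * DD (Some k) (V i) y s))) //; last by move=> *; exact: D1.
  rewrite (@DD_plus _ T) //; try by (rewrite /V /F; sm).
  rewrite (@DD_comp d T F Fs [:: lshift d k] V k x t V1 ht) exx.
  rewrite (@DD_sumI _ T) //; last by rewrite /V /F; sm.
  rewrite (sumI_ext (f := fun i => DD (Some k) (fun y s => slabcomp F [:: rshift d i] V y s * DD (Some k) (V i) y s) x t)
    (g := fun i => dHp i (dHx k H) x (grad u x t) * hessu x t k i +
     sumI (fun j => dHp j (dHp i H) x (grad u x t) * (hessu x t k j * hessu x t k i)) +
     b i x t * DD (Some i) (fun y s => DD (Some k) (DD (Some k) u) y s) x t)); last first.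
    move=> i; rewrite (@DD_mult _ T) //; try by (rewrite /V /F; sm).
    rewrite (@DD_comp d T F Fs [:: rshift d i] V k x t V1 ht) exp Rmult_plus_distr_r.
    have -> : sumI (fun j => slabcomp F [:: rshift d j; rshift d i] V x t * DD (Some k) (V j) x t) *
       DD (Some k) (V i) x t = sumI (fun j => dHp j (dHp i H) x (grad u x t) * (hessu x t k j * hessu x t k i)).
      rewrite Rmult_comm -sumI_scal; apply: sumI_ext => j; rewrite epp /hessu /V; ring.
    have -> : DD (Some k) (DD (Some k) (V i)) x t = DD (Some i) (DD (Some k) (DD (Some k) u)) x t.
      rewrite /V (@DD_ext _ T (Some k) _ (DD (Some i) (DD (Some k) u))) //; last first.
        by move=> y s hs; apply: (@DD_comm _ T) => //; sm.
      by apply: (@DD_comm _ T) => //; sm.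
    by rewrite /hessu /V.
  rewrite !sumI_plus (sumI_ext (f := fun i => slabcomp F [:: rshift d i; lshift d k] V x t * DD (Some k) (V i) x t)
    (g := fun i => dHp i (dHx k H) x (grad u x t) * hessu x t k i)); last by move=> i; rewrite epx.
  ring.
rewrite /Zfun sumI_minus (sumI_ext D2) !sumI_plus sumI_scal.
have -> : sumI (fun k => sumI (fun i => b i x t * DD (Some i) (fun y s => DD (Some k) (DD (Some k) u) y s) x t)) =
    sumI (fun k => b k x t * DD (Some k) lapu x t).
  rewrite sumI_swap; apply: sumI_ext => i; rewrite sumI_scal; congr (_ * _).
  by rewrite /lapu (@DD_sumI _ T) //; sm.
rewrite /mtr /mmul.
have -> : sumI (fun k => sumI (fun i => dHp i (dHx k H) x (grad u x t) * hessu x t k i)) =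
   sumI (fun i => sumI (fun k => dHp i (dHx k H) x (grad u x t) * hessu x t k i)) by rewrite sumI_swap.
have -> : sumI (fun k => sumI (fun i => sumI (fun j => dHp j (dHp i H) x (grad u x t) * (hessu x t k j * hessu x t k i)))) =
   sumI (fun i => sumI (fun k => dHp i (dHp k H) x (grad u x t) * sumI (fun k0 => hessu x t k k0 * hessu x t k0 i))).
  rewrite sumI_swap (sumI_ext (g := fun i => sumI (fun j => sumI (fun k => dHp j (dHp i H) x (grad u x t) * (hessu x t k j * hessu x t k i))))); last by move=> i; rewrite sumI_swap.
  rewrite sumI_swap; apply: sumI_ext => j; apply: sumI_ext => i; rewrite -sumI_scal; apply: sumI_ext => k.
  by rewrite (hessu_sym x ht i k); ring.
ring.
Qed.

End Pairing.

(** * Uniform growth of the Hamiltonian *)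

Lemma sumI_Rabs_vnorm n (v : 'I_n -> R) : sumI (fun i => Rabs (v i)) <= INR n * vnorm v.
Proof. rewrite -sumI_const; apply: sumI_le => i; exact: vnorm_coord. Qed.

Lemma vnorm_scal n (v : 'I_n -> R) a : 0 <= a -> vnorm (fun i => a * v i) = a * vnorm v.
Proof.
move=> ha; rewrite /vnorm.
rewrite (sumI_ext (g := fun i => (a * a) * (v i * v i))); last by move=> i; ring.
by rewrite sumI_scal sqrt_mult ?sqrt_square //; [nra|apply: sumI_ge0 => i; nra].
Qed.

(* By compactness there is one radius beyond which [H] exceeds any given linear
   function; convexity carries the bound along rays, which makes coercivity at
   each [x] uniform in [x]. *)
Lemma superlinear d (H : pt d -> pt d -> R) : smooth (Hjoint H) ->
  (forall p, periodic (fun x => H x p)) ->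
  (forall x (p q : pt d) (lam : R), p <> q -> 0 < lam < 1 ->
     H x (fun i => lam * p i + (1 - lam) * q i) < lam * H x p + (1 - lam) * H x q) ->
  (forall x (M : R), exists Rad : R, forall p, Rad < vnorm p -> M * vnorm p < H x p) ->
  (forall x p, 1 <= H x p) ->
  forall L, exists C, forall x p, L * sumI (fun i => Rabs (p i)) <= H x p + C.
Proof.
move=> hs hper hconv hcoer H1 L0.
(* The extra 1 makes up for the term [- 1] in [P] below. *)
pose L := Rabs L0 + 1.
have L1 : 1 <= L by rewrite /L; have := Rabs_pos L0; lra.
have conv x (p q : pt d) lam : 0 < lam <= 1 ->
    H x (fun i => lam * p i + (1 - lam) * q i) <= lam * H x p + (1 - lam) * H x q.
  move=> [hl [hl1|->]]; last first.
    rewrite (_ : (fun i => _) = p); first lra.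
    by apply: functional_extensionality => i; ring.
  case: (excluded_middle_informative (p = q)) => [->|ne]; last by left; apply: hconv.
  rewrite (_ : (fun i => _) = q); first lra.
  by apply: functional_extensionality => i; ring.
have Hcont : cont (fun z : pt d * pt d => H z.1 z.2).
  move=> z; apply: (continuous_ext (fun z : pt d * pt d => Hjoint H (joinp z.1 z.2))).
    by move=> q; rewrite Hjoint_cat.
  move: z; apply: cont_comp; last exact: smooth_cont.
  move=> z; apply: continuous_pt => j; rewrite /joinp; case: split => i.
    by apply: (@continuous_coord_comp _ d (fun z : pt d * pt d => z.1)); exact: cont_fst.
  by apply: (@continuous_coord_comp _ d (fun z : pt d * pt d => z.2)); exact: cont_snd.
have [C0 hC0] : exists C0, forall x, H x (fun _ => 0) <= C0.
  have [M hM] := @periodic_bounded d (fun x => H x (fun _ => 0)) (cont_comp2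
    (c := fun x => x) (e := fun _ => (fun _ => 0) : pt d) (f := H) (fun z => continuous_id z) (fun z => continuous_const _ z) Hcont) (hper _).
  by exists M => x; exact: Rle_trans (Rle_abs _) (hM x).
have C01 : 1 <= C0 by apply: Rle_trans (hC0 (fun _ => 0)); exact: H1.
pose fs (z : pt (d + d)) : pt d := fun i => z (lshift d i).
pose sn (z : pt (d + d)) : pt d := fun i => z (rshift d i).
pose l1 (e : pt d) := sumI (fun i => Rabs (e i)).
(* Growth along the ray through [sn z] beyond radius [R]. The condition weakens as [R] increases, as
   [cube_uniform] requires; the cube used contains a period in [x] and all directions of [l1] norm
   1. *)
pose P z R := forall R', 0 < R' -> R <= R' -> R' * (L * l1 (sn z) - 1) <= H (fs z) (fun i => R' * sn z i).
have [R0 hR0] : exists R0, forall z, (forall i, -1 <= z i <= 1) -> P z R0.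
  apply: cube_uniform => [z M M' hM hP R' h1 h2|z _]; first by apply: hP => //; lra.
  have hd0 : 0 <= INR d by exact: pos_INR.
  case: (Rle_dec (vnorm (sn z)) 0) => hz.
    (* Near a zero direction [L * l1] is at most 1, so the lower bound in [P] is nonpositive. *)
    exists 0, (/ (L * INR d + 1)); have q : 0 < L * INR d + 1 by nra.
    split; first exact: Rinv_0_lt_compat.
    move=> w hw R' h1 h2; apply: Rle_trans (_ : 0 <= _); last by apply: Rle_trans (H1 _ _); lra.
    have : L * l1 (sn w) <= 1; last by nra.
    apply: Rle_trans (_ : L * (INR d * / (L * INR d + 1)) <= _); last first.
      by rewrite -Rmult_assoc; apply/Rle_div_l => //; lra.
    apply: Rmult_le_compat_l; first lra.
    rewrite -sumI_const; apply: sumI_le => i; left.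
    have := hw (rshift d i); rewrite (_ : z (rshift d i) = 0) ?Rminus_0_r //.
    have h3 : Rabs (sn z i) <= 0 by apply: Rle_trans hz; exact: vnorm_coord.
    by change (sn z i = 0); move: h3; split_Rabs; lra.
  have [Rad hRad] := hcoer (fs z) (L * INR d).
  (* Large enough for coercivity in the direction [sn z], and to dominate the values of [H] at
     [p = 0], which enter through the convex combination. *)
  pose rho := Rmax C0 (Rabs Rad / vnorm (sn z) + 1).
  have r1 : C0 <= rho by exact: Rmax_l.
  have r2 : Rad < rho * vnorm (sn z).
    have : Rabs Rad / vnorm (sn z) + 1 <= rho by exact: Rmax_r.
    move=> h; apply: Rle_lt_trans (Rle_abs _) _.
    have : Rabs Rad = Rabs Rad / vnorm (sn z) * vnorm (sn z) by field; lra.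
    nra.
  pose Phi (w : pt (d + d)) := H (fs w) (fun i => rho * sn w i) - L * rho * l1 (sn w).
  have cPhi : cont Phi.
    have cs : forall w, continuous sn w by move=> w; apply: continuous_pt => i; exact: continuous_coord.
    apply: cont_minus.
      apply: (cont_comp2 (c := fs) (e := fun w => (fun i => rho * sn w i) : pt d) (f := H)) => // w.
        by apply: continuous_pt => i; exact: continuous_coord.
      apply: continuous_pt => i; move: w; apply: cont_mult; first exact: cont_const.
      by move=> w; exact: continuous_coord.
    apply: cont_mult; first exact: cont_const.
    apply: cont_sumI => i; apply: cont_Rabs => w; exact: continuous_coord.
  have Phi0 : 0 < Phi z.
    have := hRad (fun i => rho * sn z i); rewrite vnorm_scal; last lra.
    move=> /(_ r2) h; rewrite /Phi.
    have h3 := sumI_Rabs_vnorm (sn z).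
    have : L * rho * l1 (sn z) <= L * rho * (INR d * vnorm (sn z)).
      apply: Rmult_le_compat_l => //; apply: Rmult_le_pos; lra.
    lra.
  have /cont_within_continuous /(_ (Phi z) Phi0) [dl [hdl hw]] := cPhi z.
  exists rho, dl; split => // w hw1 R' h1 h2.
  have := hw w I hw1 => /Rabs_def2 [_ hPhi].
  have {}hPhi : L * rho * l1 (sn w) < H (fs w) (fun i => rho * sn w i) by rewrite /Phi in hPhi *; lra.
  pose lam := rho / R'.
  have hlam : 0 < lam <= 1.
    by split; [apply: Rdiv_lt_0_compat; lra|apply/Rle_div_l; lra].
  have := conv (fs w) (fun i => R' * sn w i) (fun _ => 0) lam hlam.
  rewrite (_ : (fun i => lam * (R' * sn w i) + (1 - lam) * 0) = fun i => rho * sn w i); last first.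
    by apply: functional_extensionality => i; rewrite /lam; field; lra.
  have k0 := hC0 (fs w); move=> hc.
  have e1 : L * rho * l1 (sn w) - C0 <= lam * H (fs w) (fun i => R' * sn w i).
    have : (1 - lam) * H (fs w) (fun _ => 0) <= C0.
      apply: Rle_trans (_ : 1 * C0 <= _); last lra.
      apply: Rmult_le_compat; try lra; have := H1 (fs w) (fun _ => 0); lra.
    lra.
  have e2 : rho * (L * l1 (sn w) - 1) <= lam * H (fs w) (fun i => R' * sn w i) by lra.
  apply: (Rmult_le_reg_l lam); first lra.
  apply: Rle_trans e2; right; rewrite /lam; field; lra.
exists (Rabs L0 * Rmax R0 1) => x p.
pose s := l1 p.
have s0 : 0 <= s by apply: sumI_ge0 => i; exact: Rabs_pos.
have hL0 := Rle_abs L0; have pL0 := Rabs_pos L0; have pm := Rmax_r R0 1; have pm2 := Rmax_l R0 1.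
have hp1 := H1 x p.
rewrite -/(l1 p) -/s.
apply: Rle_trans (_ : Rabs L0 * s <= _); first by apply: Rmult_le_compat_r.
case: (Rle_dec s (Rmax R0 1)) => hsr.
  have : Rabs L0 * s <= Rabs L0 * Rmax R0 1 by apply: Rmult_le_compat_l.
  lra.
have [y [hy ey]] := periodic_reduce x.
have := hR0 (joinp y (fun i => p i / s)).
have -> : H x p = H y p by exact: (ey (fun x => H x p) (hper p)).
have sp0 : 0 < s by lra.
have hP : P (joinp y (fun i => p i / s)) R0.
  apply: hR0 => j; rewrite /joinp; case: split => i; first by have := hy i; lra.
  apply/Rabs_le_between; rewrite /Rdiv Rabs_mult (Rabs_pos_eq (/ s)); last by left; exact: Rinv_0_lt_compat.
  apply/Rle_div_l => //; rewrite Rmult_1_l.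
  by apply: (@sumI_ge_term d (fun i => Rabs (p i))) => k; exact: Rabs_pos.
move=> _; have := hP s sp0 ltac:(lra).
have -> : fs (joinp y (fun i => p i / s)) = y by apply: functional_extensionality => i; exact: cat_l.
have -> : sn (joinp y (fun i => p i / s)) = fun i => p i / s by apply: functional_extensionality => i; exact: cat_r.
have -> : (fun i => s * (p i / s)) = p by apply: functional_extensionality => i; field; lra.
have -> : l1 (fun i => p i / s) = 1.
  rewrite /l1 (sumI_ext (g := fun i => / s * Rabs (p i))).
    by rewrite sumI_scal -/(l1 p) -/s; field; lra.
  by move=> i; rewrite /Rdiv Rabs_mult (Rabs_pos_eq (/ s)); [ring|left; exact: Rinv_0_lt_compat].
rewrite /L; have : 0 <= Rabs L0 * Rmax R0 1 by apply: Rmult_le_pos; lra.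
lra.
Qed.

(** * Mass, sign and coupling of a single solution *)

Section SolutionFacts.
Variables (d : nat) (T : R) (H : pt d -> pt d -> R) (uT m0 : pt d -> R) (alpha : R)
  (eta : pt d -> R) (kappa0 : R).
Hypothesis data : mfg_data T H uT m0 alpha eta kappa0.
Variables (eps : R) (u m : pt d -> R -> R).
Hypothesis sol : is_solution T H uT m0 alpha eta eps u m.

Let hT : 0 < T := T_gt0 data.
Let g := geps eta eps alpha m.
Let SMu k : SM T k u := SM_u data sol k.
Let SMm k : SM T k m := SM_m data sol k.
Let SMg k : SM T k g := SM_geps data sol k.
#[local] Hint Resolve SMu SMm SMg : sm.

Lemma sp_m t : 0 < t < T -> sp m t = 1.
Proof.
move=> ht; rewrite -(mass data sol (t := t)); last lra.
by congr (boxint _ _ _); apply: functional_extensionality => x; rewrite cl_in //; lra.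
Qed.

Lemma sint_m : sint m 0 T = T.
Proof.
rewrite /sint (RInt_ext _ (fun _ => 1)).
  by rewrite RInt_const /scal /= /mult /=; ring.
by rewrite Rmin_left ?Rmax_right; try lra; exact: sp_m.
Qed.

Lemma m_ge0 x t : 0 <= t <= T -> 0 <= cl T m x t.
Proof.
have [k [k0 hk]] := m_positive data sol.
apply: slab_limit_ge => //; first exact: (m_cl_cont data sol).
by move=> y s hs; rewrite cl_in //; [have := hk y s hs; lra|lra].
Qed.

Lemma m_cl_slice t : cont (fun x => cl T m x t).
Proof.
apply: (cont_comp2 (c := fun x => x) (e := fun _ => t) (f := cl T m)) => [z|z|].
- exact: continuous_id.
- exact: continuous_const.
- exact: (m_cl_cont data sol).
Qed.

Lemma m_average_le phi B t : cont phi -> (forall x, phi x <= B) -> 0 <= t <= T ->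
  torint (fun x => phi x * cl T m x t) <= B.
Proof.
move=> hphi hB ht.
have cm := @m_cl_slice t.
apply: Rle_trans (_ : torint (fun x => B * cl T m x t) <= _).
  apply: boxint_le; [lra|exact: cont_mult|by apply: cont_mult => //; exact: cont_const|].
  by move=> x _; apply: Rmult_le_compat_r; [exact: m_ge0|].
rewrite /torint boxint_scal //; [|lra].
by have := mass data sol ht; rewrite /sp /torint => ->; lra.
Qed.

Let eta_c : cont eta. Proof. by apply: smooth_cont; case: (eta_mollifier data). Qed.
Let eta_0 w : 0 <= eta w. Proof. by case: (eta_mollifier data) => _ []. Qed.
Let eta_1 : boxint (-1) 1 eta = 1. Proof. by case: (eta_mollifier data) => _ [_ [_ []]]. Qed.
Let eta_s w : eta (fun i => - w i) = eta w. Proof. by case: (eta_mollifier data) => _ [_ [_ [_ h]]]. Qed.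
Let m_slice t : 0 < t < T -> cont (fun x => m x t). Proof. exact: ext0_slice (SM_ext0 (SMm 0%N)). Qed.
Let m_per t : 0 < t < T -> periodic (fun x => m x t). Proof. exact: ext0_periodic (SM_ext0 (SMm 0%N)). Qed.

Lemma g_ge0 x t : 0 < t < T -> 0 <= g x t.
Proof.
by move=> ht; exact: (@coupling_ge0 d eta eps eta_c eta_0 eta_1 alpha _ (alpha_gt0 data) (m_slice ht) x).
Qed.

Lemma sp_g_young K t : 0 < K -> 0 < t < T ->
  K * sp g t <= / 2 * sp (fun x t => g x t * m x t) t + K * powr (2 * K) alpha.
Proof.
move=> hK ht; have [k [k0 hk]] := m_positive data sol.
exact: (@torint_coupling_young d eta eps eta_c eta_0 eta_1 eta_s alpha k _ (alpha_gt0 data) k0 (m_slice ht) (m_per ht) (fun x => hk x t ht) K hK).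
Qed.

Lemma sp_g_D2 i t : 0 < t < T -> sp (fun x t => g x t * DD (Some i) (DD (Some i) m) x t) t <= 0.
Proof.
move=> ht; have [k [k0 hk]] := m_positive data sol.
have S1 : SM T 1 (DD (Some i) m) by sm.
have S0 : SM T 0 (DD (Some i) (DD (Some i) m)) by sm.
apply: (@torint_coupling_D2 d eta eps eta_c eta_0 eta_1 eta_s alpha k _ (alpha_gt0 data) k0 (m_slice ht) (m_per ht) (fun x => hk x t ht) i (fun x => DD (Some i) m x t)).
- exact: ext0_slice (SM_ext0 S1) ht.
- exact: ext0_periodic (SM_ext0 S1) ht.
- exact: ext0_slice (SM_ext0 S0) ht.
- exact: ext0_periodic (SM_ext0 S0) ht.
- by move=> x; exact: (SM_der (Some i) x (SMm 1%N) ht).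
- by move=> x; exact: (SM_der (Some i) x S1 ht).
Qed.

Lemma sp_g_powr p t : 1 <= p -> 1 <= alpha * p -> 0 < t < T ->
  torint (fun x => powr (g x t) p) <= torint (fun x => powr (m x t) (alpha * p)).
Proof.
move=> hp hap ht; have [k [k0 hk]] := m_positive data sol.
exact: (@torint_coupling_powr d eta eps eta_c eta_0 eta_1 alpha k _ (alpha_gt0 data) k0 (m_slice ht) (m_per ht) (fun x => hk x t ht) p hp hap).
Qed.

Lemma green (f phi : pt d -> R -> R) t : SM T 2 f -> SM T 2 phi -> 0 < t < T ->
  sp (fun x t => sumI (fun i => DD (Some i) (DD (Some i) f) x t) * phi x t) t =
  sp (fun x t => f x t * sumI (fun i => DD (Some i) (DD (Some i) phi) x t)) t.
Proof.
move=> hf hp ht.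
have f1 := SM_S hf; have p1 := SM_S hp; have f0 := SM_S f1; have p0 := SM_S p1.
have e : forall x s, 0 < s < T ->
    sumI (fun i => DD (Some i) (DD (Some i) f) x s) * phi x s =
    f x s * sumI (fun i => DD (Some i) (DD (Some i) phi) x s) +
    sumI (fun i => DD (Some i) (fun y r => DD (Some i) f y r * phi y r - f y r * DD (Some i) phi y r) x s).
  move=> x s hs.
  rewrite [X in _ = _ + X](sumI_ext (g := fun i => phi x s * DD (Some i) (DD (Some i) f) x s - f x s * DD (Some i) (DD (Some i) phi) x s)).
    by rewrite sumI_minus !sumI_scal; ring.
  move=> i; rewrite (@DD_minus _ T) //; try by sm.
  rewrite !(@DD_mult _ T) //; try by sm.
  ring.
rewrite (sp_eq e ht) (@sp_plus _ T) //; [|by sm|]; last first.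
  apply: (SM_ext0 (k := 0)); apply: SM_sumI => i; apply: SM_DD; sm.
rewrite (@sp_div d T d (fun i y r => DD (Some i) f y r * phi y r - f y r * DD (Some i) phi y r) id) //; first ring.
sm.
Qed.

End SolutionFacts.

Lemma sint_comb d T (f g k : pt d -> R -> R) a b c : 0 < T -> ext0 T f -> ext0 T g -> ext0 T k ->
  sint (fun x t => a * f x t + b * g x t + c * k x t) 0 T = a * sint f 0 T + b * sint g 0 T + c * sint k 0 T.
Proof.
move=> hT hf hg hk.
have sc q e : ext0 T q -> ext0 T (fun x t => e * q x t) by move=> h; apply: ext0_mult => //; exact: ext0_const.
have fg : ext0 T (fun x t => a * f x t + b * g x t) by apply: ext0_plus; exact: sc.
rewrite (@sint_plus _ T) //; try lra; last exact: sc.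
rewrite (@sint_plus _ T) //; try lra; try exact: sc.
by rewrite !(@sint_scal _ T) //; lra.
Qed.

Lemma sint_ge0 d T (f : pt d -> R -> R) : 0 < T -> ext0 T f -> (forall x t, 0 < t < T -> 0 <= f x t) ->
  0 <= sint f 0 T.
Proof.
move=> hT hf h; apply: Rle_trans (_ : sint (fun (_ : pt d) _ => 0) 0 T <= _).
  by rewrite sint_const Rmult_0_l; lra.
by apply: (@sint_le _ T) => //; try lra; exact: ext0_const.
Qed.

Lemma sp_sumI d T n (F : 'I_n -> pt d -> R -> R) t : (forall i, ext0 T (F i)) -> 0 < t < T ->
  sp (fun x t => sumI (fun i => F i x t)) t = sumI (fun i => sp (F i) t).
Proof.
move=> h ht.
have aux : forall s : seq 'I_n, ext0 T (fun x t => \big[Rplus/0]_(k <- s) F k x t) /\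
    sp (fun x t => \big[Rplus/0]_(k <- s) F k x t) t = \big[Rplus/0]_(k <- s) sp (F k) t.
  elim=> [|k s [IH1 IH2]].
    split; first by apply: ext0_ext (@ext0_const d T 0) => x r _; rewrite big_nil.
    by rewrite big_nil -[RHS](@sp_const d 0 t); apply: (@sp_eq _ T) => // x r _; rewrite big_nil.
  split; first by apply: ext0_ext (ext0_plus (h k) IH1) => x r _; rewrite big_cons.
  rewrite big_cons -IH2 -(@sp_plus _ T) //.
  by apply: (@sp_eq _ T) => // x r _; rewrite big_cons.
exact: (aux (index_enum _)).2.
Qed.

Lemma cont_torint_bounds n (f : pt n -> R) B : cont f -> (forall x, Rabs (f x) <= B) -> - B <= torint f <= B.
Proof.
move=> hf h; split.
  rewrite -(@boxint_const n (- B)); apply: boxint_le => //; [lra|exact: cont_const|].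
  by move=> x _; have := h x; split_Rabs; lra.
rewrite -(@boxint_const n B); apply: boxint_le => //; [lra|exact: cont_const|].
by move=> x _; have := h x; split_Rabs; lra.
Qed.

Lemma smooth_pd n (F : pt n -> R) i : smooth F -> smooth (pd i F).
Proof.
move=> hF.
have e s : iterD s (pd i F) = iterD (s ++ [:: i]) F by elim: s => [|j s IH] //=; rewrite IH.
split; first by move=> z _; apply/cont_within_continuous; exact: (smooth_iterD [:: i] hF).1.
move=> s; rewrite e; case: hF => _ /(_ (s ++ [:: i])) [h1 h2]; split => //.
Qed.

Lemma periodic_pd n (F : pt n -> R) i : smooth F -> periodic F -> periodic (pd i F).
Proof. move=> hF hp x j; apply: (@iterD_per n F j [:: i] hF) => z; exact: hp. Qed.

(** * First and second order estimates *)

Section Uniform.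
Variables (d : nat) (T : R) (H : pt d -> pt d -> R) (uT m0 : pt d -> R) (alpha : R)
  (eta : pt d -> R) (kappa0 : R).
Hypothesis data : mfg_data T H uT m0 alpha eta kappa0.
Hypothesis A3 : exists c C : R, 0 < c /\ 0 < C /\
  forall x p, sumI (fun i => dHp i H x p * p i) - H x p >= c * H x p - C.
Hypothesis H_superlinear : forall L, exists C, forall x p, L * sumI (fun i => Rabs (p i)) <= H x p + C.

Let hT : 0 < T := T_gt0 data.

(** [a] may be arbitrarily small because [H] grows faster than any linear function of [p]; gradient
    terms can thus be absorbed into [H]. *)
Lemma grad_pairing_bound (psi : 'I_d -> pt d -> R) a : 0 < a ->
  (forall i, cont (psi i)) -> (forall i, periodic (psi i)) ->
  exists C, 0 <= C /\ forall x p, Rabs (sumI (fun i => p i * psi i x)) <= a * H x p + C.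
Proof.
move=> ha hc hp.
have [B hB] := @periodic_bounded d (fun x => sumI (fun i => Rabs (psi i x)))
  (cont_sumI (fun i => cont_Rabs (hc i))) (fun x j => sumI_ext (fun i => f_equal Rabs (hp i x j))).
have [C hC] := H_superlinear (Rabs B / a).
have B0 := Rabs_pos B.
exists (Rabs (a * C)); split; first exact: Rabs_pos.
move=> x p; apply: Rle_trans (sumI_Rabs _) _.
apply: Rle_trans (_ : sumI (fun i => Rabs B * Rabs (p i)) <= _).
  apply: sumI_le => i; rewrite Rabs_mult Rmult_comm; apply: Rmult_le_compat_r; first exact: Rabs_pos.
  apply: Rle_trans (@sumI_ge_term d (fun i => Rabs (psi i x)) i (fun i => Rabs_pos _)) _.
  apply: Rle_trans (Rle_abs _) _; apply: Rle_trans (hB x) (Rle_abs _).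
rewrite sumI_scal.
have := hC x p => h; have := Rle_abs (a * C).
have : a * (Rabs B / a * sumI (fun i => Rabs (p i))) <= a * (H x p + C) by apply: Rmult_le_compat_l; lra.
rewrite (_ : a * (Rabs B / a * sumI (fun i => Rabs (p i))) = Rabs B * sumI (fun i => Rabs (p i))); last by field; lra.
lra.
Qed.

Lemma first_order : exists C, 0 <= C /\ forall eps u m, is_solution T H uT m0 alpha eta eps u m ->
  sint (fun x t => hamil H u x t * m x t) 0 T <= C /\ sint (hamil H u) 0 T <= C /\
  sint (geps eta eps alpha m) 0 T <= C.
Proof.
have [c [C3 [hc [hC3 A3']]]] := A3.
have k0 := kappa0_gt0 data.
have cuT : cont uT by exact: smooth_cont (uT_smooth data).
have cm0 : cont m0 by exact: smooth_cont (m0_smooth data).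
have [U hU] := periodic_bounded cuT (uT_per data).
have [M0 hM0] := periodic_bounded cm0 (m0_per data).
have M0p : 0 < M0.
  apply: Rlt_le_trans (hM0 (fun _ => 0)); apply: Rlt_le_trans (Rle_abs _).
  by have := m0_ge data (fun _ => 0); lra.
have [C1 [C10 hC1]] := @grad_pairing_bound (fun i => pd i m0) (kappa0 / 2) ltac:(lra)
  (fun i => smooth_cont (smooth_pd i (m0_smooth data))) (fun i => periodic_pd i (m0_smooth data) (m0_per data)).
(* [2 * U] bounds the two terms with [uT] that survive the subtraction. The other constants come,
   over the time [T], from (A3), from the gradient paired with that of [m0], and from the Young
   inequality for the coupling with factor [M0]. *)
pose K := 2 * U + (C3 + C1 + M0 * powr (2 * M0) alpha) * T.
exists (Rabs (K / c) + Rabs (2 / kappa0 * K) + Rabs (K + T * powr 2 alpha)); split.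
  have := Rabs_pos (K / c); have := Rabs_pos (2 / kappa0 * K); have := Rabs_pos (K + T * powr 2 alpha); lra.
move=> eps u m sol.
pose g := geps eta eps alpha m; pose h := hamil H u.
have SMh := SM_hamil data sol; have SMg := SM_geps data sol; have SMm := SM_m data sol.
have SMb := SM_drift data sol; have SMV := SM_V data sol.
have SMm0 k : SM T k (fun x _ => m0 x) by exact: SM_space (m0_smooth data) (m0_per data).
have SMdm0 i k : SM T k (fun x _ => pd i m0 x) by exact: (SM_DD (Some i) (SMm0 k.+1)).
have eh : ext0 T h by sm.
have eg : ext0 T g by sm.
have em : ext0 T m by sm.
have ehm : ext0 T (fun x t => h x t * m x t) by sm.
have egm : ext0 T (fun x t => g x t * m x t) by sm.
have e1 : ext0 T (fun (_ : pt d) _ => 1) by exact: ext0_const.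
have h1 x t : 1 <= h x t by rewrite /h hamilE; exact: (H_ge1 data).
have mpos x t : 0 < t < T -> 0 <= m x t.
  by move=> ht; have := m_ge0 data sol x (t := t); rewrite cl_in; [apply; lra|lra].
have gpos x t : 0 < t < T -> 0 <= g x t by move=> ht; exact: (g_ge0 data sol x ht).
have p1 := pair_um data sol; have p2 := pair_u data sol (m0_smooth data) (m0_per data).
rewrite -/g -/h in p1 p2.
have q1 : sint (fun x t => (h x t - g x t - sumI (fun i => drift H u i x t * DD (Some i) u x t)) * m x t) 0 T <=
    - c * sint (fun x t => h x t * m x t) 0 T + -1 * sint (fun x t => g x t * m x t) 0 T + C3 * sint m 0 T.
  rewrite -(@sint_comb d T) //; apply: (@sint_le _ T); try lra; try by sm.
  move=> x t ht.
  have := A3' x (grad u x t); rewrite -hamilE -/h.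
  rewrite (sumI_ext (g := fun i => drift H u i x t * DD (Some i) u x t)); last by move=> i; rewrite driftE.
  have := mpos x t ht; move=> ? ?; nra.
rewrite (sint_m data sol) in q1.
have q2 : kappa0 / 2 * sint h 0 T + - M0 * sint g 0 T + - C1 * sint (fun (_ : pt d) _ => 1) 0 T <=
    sint (fun x t => (h x t - g x t) * m0 x + sumI (fun i => DD (Some i) u x t * pd i m0 x)) 0 T.
  rewrite -(@sint_comb d T) //; apply: (@sint_le _ T); try lra; try by sm.
  move=> x t ht.
  have := hC1 x (grad u x t); rewrite -hamilE -/h => /Rabs_le_between [hb _].
  have hb' : - (kappa0 / 2 * h x t + C1) <= sumI (fun i => DD (Some i) u x t * pd i m0 x) by exact: hb.
  have m1 := m0_ge data x; have m2 : m0 x <= M0 by exact: Rle_trans (Rle_abs _) (hM0 x).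
  have g1 := gpos x t ht; have h2 := h1 x t.
  have : kappa0 * h x t <= h x t * m0 x by nra.
  have : g x t * m0 x <= M0 * g x t by nra.
  lra.
rewrite sint_const in q2.
(* Taken with [K' = M0] to absorb the coupling tested against [m0], and with [K' = 1] to bound the
   coupling itself. *)
have q3 K' : 0 < K' -> K' * sint g 0 T <= / 2 * sint (fun x t => g x t * m x t) 0 T + K' * powr (2 * K') alpha * T.
  move=> hK'.
  have : sint (fun x t => K' * g x t + 0 * 1 + 0 * 1) 0 T <=
      sint (fun x t => / 2 * (g x t * m x t) + K' * powr (2 * K') alpha * 1 + 0 * 1) 0 T.
    apply: (@sint_sp_le _ T); try lra; try by sm.
    move=> t ht.
    have a1 : sp (fun x t => K' * g x t + 0 * 1 + 0 * 1) t = K' * sp g t.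
      by rewrite -(@sp_scal _ T) //; apply: (@sp_eq _ T) => // x s _; ring.
    have a2 : sp (fun x t => / 2 * (g x t * m x t) + K' * powr (2 * K') alpha * 1 + 0 * 1) t =
        / 2 * sp (fun x t => g x t * m x t) t + K' * powr (2 * K') alpha.
      rewrite -(@sp_scal _ T) // -[X in _ = _ + X](@sp_const d (K' * powr (2 * K') alpha) t) -(@sp_plus _ T) //; try by sm.
      by apply: (@sp_eq _ T) => // x s _; ring.
    by rewrite a1 a2; exact: (sp_g_young data sol hK' ht).
  by rewrite !(@sint_comb d T _ _ _) // !sint_const; lra.
have u1 : torint (fun x => uT x * m0 x) <= U.
  have := m_average_le data sol (B := U) (t := 0) cuT (fun x => Rle_trans _ _ _ (Rle_abs _) (hU x)) ltac:(lra).
  rewrite (_ : (fun x => uT x * cl T m x 0) = fun x => uT x * m0 x) //.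
  by apply: functional_extensionality => x; rewrite cl_in ?(m_0 sol) //; lra.
have u2 : - U <= torint (fun x => uT x * m x T).
  have := m_average_le data sol (B := U) (t := T) (phi := fun x => - uT x) (cont_opp cuT) (fun x => Rle_trans _ _ _ (Rle_abs _) (Rle_trans _ _ _ (Req_le _ _ (Rabs_Ropp _)) (hU x))) ltac:(lra).
  rewrite (_ : (fun x => - uT x * cl T m x T) = fun x => - (uT x * m x T)); last first.
    by apply: functional_extensionality => x; rewrite cl_in; [ring|lra].
  rewrite /torint boxint_opp; [by move=> h3; apply: Ropp_le_cancel; rewrite Ropp_involutive; exact: h3|lra|].
  have cmT : cont (fun x => cl T m x T) by exact: (m_cl_slice data sol).
  rewrite (_ : (fun x => uT x * m x T) = fun x => uT x * cl T m x T); first exact: cont_mult.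
  by apply: functional_extensionality => x; rewrite cl_in //; lra.
have q3' := q3 M0 M0p; have q4 := q3 1 Rlt_0_1.
rewrite !Rmult_1_l Rmult_1_r in q4.
have n1 : 0 <= sint (fun x t => h x t * m x t) 0 T.
  by apply: sint_ge0 => // x t ht; apply: Rmult_le_pos; [have := h1 x t; lra|exact: mpos].
have n2 : 0 <= sint h 0 T by apply: sint_ge0 => // x t ht; have := h1 x t; lra.
have n3 : 0 <= sint (fun x t => g x t * m x t) 0 T.
  by apply: sint_ge0 => // x t ht; apply: Rmult_le_pos; [exact: gpos|exact: mpos].
have tot : kappa0 / 2 * sint h 0 T + c * sint (fun x t => h x t * m x t) 0 T + / 2 * sint (fun x t => g x t * m x t) 0 T <= K.
  rewrite /K; lra.
have r1 := Rle_abs (K / c); have r2 := Rle_abs (2 / kappa0 * K); have r3 := Rle_abs (K + T * powr 2 alpha).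
have s1 := Rabs_pos (K / c); have s2 := Rabs_pos (2 / kappa0 * K); have s3 := Rabs_pos (K + T * powr 2 alpha).
have z1 : sint (fun x t => h x t * m x t) 0 T <= K / c.
  apply/Rle_div_r => //.
  have : 0 <= kappa0 / 2 * sint h 0 T by apply: Rmult_le_pos; lra.
  lra.
have z2 : sint h 0 T <= 2 / kappa0 * K.
  have -> : sint h 0 T = 2 / kappa0 * (kappa0 / 2 * sint h 0 T) by field; lra.
  apply: Rmult_le_compat_l; first by apply: Rlt_le; apply: Rdiv_lt_0_compat; lra.
  have : 0 <= c * sint (fun x t => h x t * m x t) 0 T by apply: Rmult_le_pos; lra.
  lra.
have z3 : sint g 0 T <= K + T * powr 2 alpha.
  have : 0 <= kappa0 / 2 * sint h 0 T by apply: Rmult_le_pos; lra.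
  have : 0 <= c * sint (fun x t => h x t * m x t) 0 T by apply: Rmult_le_pos; lra.
  lra.
rewrite -/h -/g; split; first by lra.
by split; lra.
Qed.

(** The equation for [u] expresses the pairing through integrals of [H] and of the coupling, already
    bounded by [first_order]. No sign is asked of [psi], which will be a second derivative of
    [m0]. *)
Lemma u0_pairing psi : smooth psi -> periodic psi ->
  exists C, 0 <= C /\ forall eps u m, is_solution T H uT m0 alpha eta eps u m ->
    - C <= torint (fun x => u x 0 * psi x).
Proof.
move=> hpsi ppsi.
have [C1 [C10 hfo]] := first_order.
have cuT : cont uT by exact: smooth_cont (uT_smooth data).
have cpsi := smooth_cont hpsi.
have [U hU] := periodic_bounded (cont_mult cuT cpsi) (fun x j => f_equal2 Rmult (uT_per data x j) (ppsi x j)).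
have [B hB] := periodic_bounded cpsi ppsi.
have B0 : 0 <= B by apply: Rle_trans (hB (fun _ => 0)); exact: Rabs_pos.
have [C2 [C20 hC2]] := @grad_pairing_bound (fun i => pd i psi) 1 Rlt_0_1
  (fun i => smooth_cont (smooth_pd i hpsi)) (fun i => periodic_pd i hpsi ppsi).
have U0 : 0 <= U by apply: Rle_trans (hU (fun _ => 0)); exact: Rabs_pos.
exists (U + ((B + 1) * C1 + B * C1 + C2 * T)); split.
  have : 0 <= (B + 1) * C1 by apply: Rmult_le_pos; lra.
  have : 0 <= B * C1 by apply: Rmult_le_pos; lra.
  have : 0 <= C2 * T by apply: Rmult_le_pos; lra.
  lra.
move=> eps u m sol; have [_ [f1 f2]] := hfo eps u m sol.
pose g := geps eta eps alpha m; pose h := hamil H u.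
have SMh := SM_hamil data sol; have SMg := SM_geps data sol; have SMV := SM_V data sol.
have SMpsi k : SM T k (fun x _ => psi x) by exact: SM_space.
have SMdpsi i k : SM T k (fun x _ => pd i psi x) by exact: (SM_DD (Some i) (SMpsi k.+1)).
have eh : ext0 T h by sm.
have eg : ext0 T g by sm.
have e1 : ext0 T (fun (_ : pt d) _ => 1) by exact: ext0_const.
have p := pair_u data sol hpsi ppsi; rewrite -/g -/h in p.
have q : sint (fun x t => (h x t - g x t) * psi x + sumI (fun i => DD (Some i) u x t * pd i psi x)) 0 T <=
   (B + 1) * sint h 0 T + B * sint g 0 T + C2 * sint (fun (_ : pt d) _ => 1) 0 T.
  rewrite -(@sint_comb d T) //; apply: (@sint_le _ T); try lra; try by sm.
  move=> x t ht.
  have := hC2 x (grad u x t); rewrite -hamilE -/h => /Rabs_le_between [_ hb].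
  have hb' : sumI (fun i => DD (Some i) u x t * pd i psi x) <= 1 * h x t + C2 by exact: hb.
  have g1 : 0 <= g x t by exact: (g_ge0 data sol x ht).
  have h1 : 1 <= h x t by rewrite /h hamilE; exact: (H_ge1 data).
  have /Rabs_le_between [b1 b2] := hB x.
  have : h x t * psi x <= B * h x t by nra.
  have : - (g x t * psi x) <= B * g x t by nra.
  lra.
have [u1 u2] : - U <= torint (fun x : pt d => uT x * psi x) <= U := cont_torint_bounds (cont_mult cuT cpsi) hU.
rewrite sint_const in q.
have : (B + 1) * sint h 0 T <= (B + 1) * C1 by apply: Rmult_le_compat_l; [lra|exact: f1].
have : B * sint g 0 T <= B * C1 by apply: Rmult_le_compat_l.
lra.
Qed.

Hypothesis A5a : exists C : R, forall x p,
  vnorm (fun i => dHx i H x p) <= C * H x p + C /\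
  mnorm (fun i j => dHx i (dHx j H) x p) <= C * H x p + C.
Hypothesis A5b : forall delta : R, 0 < delta -> exists Cd : R, forall M : mat d, msym M -> forall x p,
  mtr (mmul (fun i j => dHp i (dHx j H) x p) M)
    <= delta * mtr (mmul (fun i j => dHp i (dHp j H) x p) (mmul M M)) + Cd * H x p.

Definition energyA (u : pt d -> R -> R) x t :=
  mtr (mmul (fun i j => dHp i (dHp j H) x (grad u x t)) (mmul (hessu u x t) (hessu u x t))).

Lemma mtr_scal (A : mat d) s : mtr (fun i j => s * A i j) = s * mtr A.
Proof. exact: sumI_scal. Qed.

Lemma mmul_scal (A B : mat d) s : mmul A (fun i j => s * B i j) = fun i j => s * mmul A B i j.
Proof.
apply: functional_extensionality => i; apply: functional_extensionality => j.
by rewrite /mmul -sumI_scal; apply: sumI_ext => k; ring.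
Qed.

Lemma mmul_scal2 (M : mat d) s : mmul (fun i j => s * M i j) (fun i j => s * M i j) =
  fun i j => (s * s) * mmul M M i j.
Proof.
apply: functional_extensionality => i; apply: functional_extensionality => j.
by rewrite /mmul -sumI_scal; apply: sumI_ext => k; ring.
Qed.

(* Scaling [M] in (A5) makes the quadratic term dominate, so it is nonnegative. *)
Lemma quadratic_ge0 (M : mat d) x p : msym M ->
  0 <= mtr (mmul (fun i j => dHp i (dHp j H) x p) (mmul M M)).
Proof.
move=> hM; set a := mtr _.
have [Cd hCd] := A5b Rlt_0_1.
(* (A5) for [s M] and for [- s M] are added, which cancels the linear term. *)
have key s : 0 <= (s * s) * a + Cd * H x p.
  have sy s' : msym (fun i j => s' * M i j) by move=> i j; rewrite hM.
  have := hCd _ (sy s) x p; have := hCd _ (sy (- s)) x p.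
  rewrite !mmul_scal2 !mmul_scal !mtr_scal -/a.
  rewrite (_ : - s * - s = s * s); last ring.
  lra.
apply: Rnot_lt_le => ha.
have := key 0; rewrite !Rmult_0_l Rplus_0_l => h0.
(* For this [s] the quantity [s^2 * - a] exceeds [Cd * H x p]. *)
have := key (1 + Cd * H x p / - a).
set q := Cd * H x p in h0 *.
have qa : 0 <= q / - a by apply: Rdiv_le_0_compat; lra.
have e : q = (q / - a) * - a by field; lra.
move=> h; have : (1 + q / - a) * (1 + q / - a) * - a <= q / - a * - a by lra.
move=> h2; have : (1 + q / - a) * (1 + q / - a) <= q / - a by apply: Rmult_le_reg_r h2; lra.
nra.
Qed.

Section WithSolution.
Variables (eps : R) (u m : pt d -> R -> R).
Hypothesis sol : is_solution T H uT m0 alpha eta eps u m.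

Lemma SM_energyA k : SM T k (energyA u).
Proof.
have SMs := SM_hess data sol; have SMV := SM_V data sol.
have -> : energyA u = fun x t => sumI (fun i => sumI (fun j =>
   slabcomp (Hjoint H) [:: rshift d i; rshift d j] (fun i => DD (Some i) u) x t *
   sumI (fun l => DD (Some j) (DD (Some l) u) x t * DD (Some l) (DD (Some i) u) x t))).
  apply: functional_extensionality => x; apply: functional_extensionality => t.
  apply: sumI_ext => i; apply: sumI_ext => j; congr (_ * _).
  by rewrite /slabcomp /= !pd_Hjoint_r Hjoint_cat.
sm.
Qed.

Lemma energyA_ge0 x t : 0 < t < T -> 0 <= energyA u x t.
Proof. by move=> ht; apply: quadratic_ge0; exact: (hessu_sym data sol). Qed.

End WithSolution.

Lemma second_order : exists C, 0 <= C /\ forall eps u m, is_solution T H uT m0 alpha eta eps u m ->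
  sint (fun x t => energyA u x t * m x t) 0 T <= C.
Proof.
have [C1 [C10 hfo]] := first_order.
have [C5 hC5] := A5a.
(* The mixed term carries a factor 2 in [ZE], so that [/ 4] leaves half of [A]. *)
have [Cd hCd] := A5b (ltac:(lra) : 0 < / 4).
have sm2 i : smooth (pd i (pd i m0)) by apply: smooth_pd; apply: smooth_pd; exact: m0_smooth data.
have per2 i : periodic (pd i (pd i m0)).
  by apply: periodic_pd; [apply: smooth_pd|apply: periodic_pd]; try exact: m0_smooth data; exact: m0_per data.
(* At time 0 both derivatives of the Laplacian go onto [m0], which turns the boundary term into this
   sum of pairings. *)
have [E [E0 hE]] : exists E, 0 <= E /\ forall eps u m, is_solution T H uT m0 alpha eta eps u m ->
    - E <= sumI (fun i => torint (fun x => u x 0 * pd i (pd i m0) x)).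
  pose f i := proj1_sig (constructive_indefinite_description _ (u0_pairing (sm2 i) (per2 i))).
  have hf i : 0 <= f i /\ forall eps u m, is_solution T H uT m0 alpha eta eps u m ->
    - f i <= torint (fun x => u x 0 * pd i (pd i m0) x).
    by rewrite /f; case: constructive_indefinite_description.
  exists (sumI f); split; first by apply: sumI_ge0 => i; exact: (hf i).1.
  by move=> eps u m sol; rewrite -sumI_opp; apply: sumI_le => i; exact: (hf i).2 sol.
pose lapT x := sumI (fun i => pd i (pd i uT) x).
have sT2 i : smooth (pd i (pd i uT)) by apply: smooth_pd; apply: smooth_pd; exact: uT_smooth data.
have clapT : cont lapT by apply: cont_sumI => i; exact: smooth_cont.
have plapT : periodic lapT.
  move=> x j; apply: sumI_ext => i.
  by apply: periodic_pd; [apply: smooth_pd|apply: periodic_pd]; try exact: uT_smooth data; exact: uT_per data.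
have [B hB] := periodic_bounded clapT plapT.
have B0 : 0 <= B by apply: Rle_trans (hB (fun _ => 0)); exact: Rabs_pos.
pose a1 := INR d * C5 + 2 * Cd.
pose a2 := INR d * C5.
exists (2 * (Rabs a1 * C1 + Rabs a2 * T + B + E)); split.
  have := Rmult_le_pos _ _ (Rabs_pos a1) C10.
  have := Rmult_le_pos _ _ (Rabs_pos a2) (Rlt_le _ _ hT); lra.
move=> eps u m sol; have [f0 [f1 f2]] := hfo eps u m sol.
pose g := geps eta eps alpha m; pose h := hamil H u.
pose lapu (x : pt d) t := sumI (fun k => DD (Some k) (DD (Some k) u) x t).
pose Z (x : pt d) t := sumI (fun k => DD (Some k) (DD (Some k) h) x t - drift H u k x t * DD (Some k) lapu x t).
have SMh := SM_hamil data sol; have SMg := SM_geps data sol; have SMm := SM_m data sol.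
have SMu := SM_u data sol; have SMA := SM_energyA sol.
have SMZ k : SM T k Z by exact: (SM_Z data sol k).
have SMl k : SM T k lapu by rewrite /lapu; sm.
have ehm : ext0 T (fun x t => h x t * m x t) by sm.
have eAm : ext0 T (fun x t => energyA u x t * m x t) by sm.
have em : ext0 T m by sm.
have [_ [L [cL eL]]] := SM_ext0 (SMl 0%N).
have pl := pair_lap data sol cL eL.
have q1 : / 2 * sint (fun x t => energyA u x t * m x t) 0 T + - a1 * sint (fun x t => h x t * m x t) 0 T +
     - a2 * sint m 0 T <= sint (fun x t => Z x t * m x t) 0 T.
  rewrite -(@sint_comb d T) //; apply: (@sint_le _ T); try lra; try by sm.
  move=> x t ht.
  have mp : 0 <= m x t by have := m_ge0 data sol x (t := t); rewrite cl_in; [apply; lra|lra].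
  suff hz : / 2 * energyA u x t - a1 * h x t - a2 <= Z x t.
    have := Rmult_le_compat_r _ _ _ mp hz; lra.
  have -> : Z x t = _ := ZE data sol x ht.
  rewrite -/(energyA u x t).
  (* The Hessian is taken with a minus sign: (A5) bounds traces from above, and the mixed term is to
     be bounded from below. *)
  have hsy : msym (fun i j => -1 * hessu u x t i j) by move=> i j; rewrite (hessu_sym data sol x ht).
  have := hCd _ hsy x (grad u x t).
  rewrite mmul_scal2 !mmul_scal !mtr_scal -/(energyA u x t) -hamilE -/h => k1.
  have [_ k2] := hC5 x (grad u x t); rewrite -hamilE -/h in k2.
  have k3 := mtr_mnorm (fun i j => dHx i (dHx j H) x (grad u x t)).
  have k4 : INR d * mnorm (fun i j => dHx i (dHx j H) x (grad u x t)) <= INR d * (C5 * h x t + C5).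
    by apply: Rmult_le_compat_l => //; exact: pos_INR.
  have /Rabs_le_between [k5 _] := Rle_trans _ _ _ k3 k4.
  rewrite /a1 /a2; lra.
have q2 : sint (fun x t => Z x t * m x t) 0 T <=
    sint (fun x t => Z x t * m x t - g x t * sumI (fun k => DD (Some k) (DD (Some k) m) x t)) 0 T.
  apply: (@sint_sp_le _ T); try lra; try by sm.
  move=> t ht.
  have eg k : ext0 T (fun x t => g x t * DD (Some k) (DD (Some k) m) x t) by sm.
  have eZ : ext0 T (fun x t => Z x t * m x t) by sm.
  have -> : sp (fun x t => Z x t * m x t - g x t * sumI (fun k => DD (Some k) (DD (Some k) m) x t)) t =
     sp (fun x t => Z x t * m x t) t + -1 * sumI (fun k => sp (fun x t => g x t * DD (Some k) (DD (Some k) m) x t) t).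
    rewrite -(@sp_sumI _ T) // -(@sp_scal _ T) //; last exact: ext0_sumI.
    rewrite -(@sp_plus _ T) //; last by apply: ext0_mult; [exact: ext0_const|exact: ext0_sumI].
    by apply: (@sp_eq _ T) => // x s _; rewrite sumI_scal; ring.
  have : sumI (fun k => sp (fun x t => g x t * DD (Some k) (DD (Some k) m) x t) t) <= sumI (fun _ : 'I_d => 0).
    by apply: sumI_le => k; exact: (sp_g_D2 data sol k ht).
  rewrite sumI_0; lra.
rewrite -pl in q2.
have cL0 : cont (fun x => L x 0) by apply: (cont_comp2 (c := fun x => x) (e := fun _ => 0) (f := L)) => // x; [exact: continuous_id|exact: continuous_const].
have cLT : cont (fun x => L x T) by apply: (cont_comp2 (c := fun x => x) (e := fun _ => T) (f := L)) => // x; [exact: continuous_id|exact: continuous_const].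
have cclu := u_cl_cont data sol.
(* At the ends of the time interval only [u] and [m] are known, so the Laplacian is moved to the other factor. *)
have bdry phi : SM T 2 (fun x _ => phi x) -> cont phi -> cont (fun x => sumI (fun i => pd i (pd i phi) x)) ->
    forall t, 0 <= t <= T -> torint (fun x => L x t * phi x) = torint (fun x => cl T u x t * sumI (fun i => pd i (pd i phi) x)).
  move=> hphi cphi cd2.
  apply: (@limit_eq T (sp (fun x t => L x t * phi x)) (sp (fun x t => cl T u x t * sumI (fun i => pd i (pd i phi) x)))) => //.
  - by apply: sp_cont; apply: cont_mult => //; apply: (cont_comp (c := fst)) => // z; exact: cont_fst.
  - by apply: sp_cont; apply: cont_mult => //; apply: (cont_comp (c := fst) (f := fun x => sumI (fun i => pd i (pd i phi) x))) => // z; exact: cont_fst.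
  move=> t ht.
  rewrite -(@sp_eq d T (fun x t => lapu x t * phi x)) //; last by move=> x s hs; rewrite eL.
  rewrite (@green d T u (fun x _ => phi x)) //.
  by apply: (@sp_eq _ T) => // x s hs; rewrite cl_in //; lra.
have y0 : - E <= sp (fun x t => L x t * cl T m x t) 0.
  have -> : sp (fun x t => L x t * cl T m x t) 0 = torint (fun x => L x 0 * m0 x).
    by congr (boxint _ _ _); apply: functional_extensionality => x; rewrite cl_in ?(m_0 sol) //; lra.
  rewrite bdry; try lra.
  - rewrite (_ : torint _ = sumI (fun i => torint (fun x => u x 0 * pd i (pd i m0) x))); first exact: hE sol.
    have e0 i : ext0 T (fun x _ => u x 0 * pd i (pd i m0) x).
      have cu0 : cont (fun x => u x 0).
        rewrite (_ : (fun x => u x 0) = fun x => cl T u x 0); last by apply: functional_extensionality => x; rewrite cl_in //; lra.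
        by apply: (cont_comp2 (c := fun x => x) (e := fun _ => 0) (f := cl T u)) => // x; [exact: continuous_id|exact: continuous_const].
      split; first by move=> x t j _; rewrite per2; congr (_ * _); case: sol => _ [hp _]; exact: (hp 0 x j).
      exists (fun x _ => u x 0 * pd i (pd i m0) x); split => //.
      apply: (cont_comp (c := fst) (f := fun x => u x 0 * pd i (pd i m0) x)) => [z|]; first exact: cont_fst.
      by apply: cont_mult => //; exact: smooth_cont.
    have := @sp_sumI d T d _ (T / 2) e0 ltac:(lra).
    rewrite /sp => <-; congr (boxint _ _ _); apply: functional_extensionality => x.
    by rewrite sumI_scal cl_in //; lra.
  - exact: SM_space (m0_smooth data) (m0_per data).
  - exact: smooth_cont (m0_smooth data).
  - by apply: cont_sumI => i; exact: smooth_cont.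
(* The spatial derivatives of [m] are not controlled at time [T]. So [L] is frozen at [T], the slice
   of [m] at [s < T] serves as test function, the derivatives pass through it to [uT], and [s] tends
   to [T]. *)
have yT : sp (fun x t => L x t * cl T m x t) T <= B.
  change (torint (fun x => L x T * cl T m x T) <= B).
  apply: (@limit_le T B (fun s => sp (fun x s => L x T * cl T m x s) s)) => //; last by lra.
    apply: sp_cont; apply: cont_mult; last exact: (m_cl_cont data sol).
    by apply: (cont_comp (c := fst) (f := fun x => L x T)) => // z; exact: cont_fst.
  move=> s hs.
  have SMfr k : SM T k (fun x _ => m x s) by exact: SM_freeze.
  have cfr : cont (fun x => m x s) by exact: ext0_slice (SM_ext0 (SMm 0%N)) hs.
  have e1 : sp (fun x s => L x T * cl T m x s) s = torint (fun x => L x T * m x s).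
    by congr (boxint _ _ _); apply: functional_extensionality => x; rewrite cl_in //; lra.
  have c2 : cont (fun x => sumI (fun i => pd i (pd i (fun x => m x s)) x)).
    have e2 : ext0 T (fun x t => sumI (fun i => DD (Some i) (DD (Some i) m) x t)) by sm.
    exact: (ext0_slice e2 hs).
  rewrite e1 (bdry (fun x => m x s)) //; last lra.
  have SMuT k : SM T k (fun x _ => uT x) by exact: SM_space (uT_smooth data) (uT_per data).
  have gr := @green d T (fun x _ => uT x) (fun x _ => m x s) (T / 2) (SMuT 2%N) (SMfr 2%N) ltac:(lra).
  have -> : torint (fun x => cl T u x T * sumI (fun i => pd i (pd i (fun x => m x s)) x)) =
     torint (fun x => lapT x * m x s).
    transitivity (torint (fun x => uT x * sumI (fun i => pd i (pd i (fun x => m x s)) x))); last by symmetry; exact: gr.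
    by congr (boxint _ _ _); apply: functional_extensionality => x; rewrite cl_in ?(u_T sol) //; lra.
  have := m_average_le data sol (t := s) clapT (fun x => Rle_trans _ _ _ (Rle_abs _) (hB x)) ltac:(lra).
  rewrite (_ : (fun x => lapT x * cl T m x s) = fun x => lapT x * m x s) //.
  by apply: functional_extensionality => x; rewrite cl_in //; lra.
rewrite (sint_m data sol) in q1.
have b1 : a1 * sint (fun x t => h x t * m x t) 0 T <= Rabs a1 * C1.
  apply: Rle_trans (_ : Rabs a1 * sint (fun x t => h x t * m x t) 0 T <= _).
    apply: Rmult_le_compat_r; last exact: Rle_abs.
    apply: sint_ge0 => // x t ht; apply: Rmult_le_pos.
      by have := H_ge1 data x (grad u x t); rewrite -hamilE -/h; lra.
    by have := m_ge0 data sol x (t := t); rewrite cl_in; [apply; lra|lra].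
  by apply: Rmult_le_compat_l => //; exact: Rabs_pos.
have b2 : a2 * T <= Rabs a2 * T by apply: Rmult_le_compat_r; [lra|exact: Rle_abs].
lra.
Qed.

End Uniform.

(** * Integrability of the density *)

Lemma slice_holder n (F G E : pt n -> R) a x y : 0 < a < 1 -> cont F -> cont G -> cont E ->
  (forall z, 0 <= F z) -> (forall z, 0 <= G z) ->
  (forall z, E z <= powr (F z) a * powr (G z) (1 - a)) ->
  0 < x -> 0 < y -> torint F <= x -> torint G <= y -> torint E <= powr x a * powr y (1 - a).
Proof.
move=> ha hF hG hE F0 G0 hle hx hy Fx Gy.
have cm f c : cont f -> cont (fun x : pt n => c * f x) by move=> hf; apply: cont_mult => //; exact: cont_const.
apply: (@holder _ (fun _ => True) cont (@torint n) _ _ _ a F G E x y) => //.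
- by move=> f g c e hf hg; apply: cont_plus; exact: cm.
- move=> f g c e hf hg; rewrite /torint boxint_plus; [|lra|exact: cm|exact: cm].
  by rewrite !boxint_scal //; lra.
- by move=> f g hf hg h; apply: boxint_le => //; [lra|move=> z _; exact: h].
Qed.

Lemma sint_holder d T (F G E : pt d -> R -> R) a x y : 0 < T -> 0 < a < 1 ->
  ext0 T F -> ext0 T G -> ext0 T E ->
  (forall z s, 0 < s < T -> 0 <= F z s) -> (forall z s, 0 < s < T -> 0 <= G z s) ->
  (forall z s, 0 < s < T -> E z s <= powr (F z s) a * powr (G z s) (1 - a)) ->
  0 < x -> 0 < y -> sint F 0 T <= x -> sint G 0 T <= y -> sint E 0 T <= powr x a * powr y (1 - a).
Proof.
move=> hT ha hF hG hE F0 G0 hle hx hy Fx Gy.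
have sc f c : ext0 T f -> ext0 T (fun x t => c * f x t) by move=> h; apply: ext0_mult => //; exact: ext0_const.
pose U (f : pt d * R -> R) (z : pt d) s := f (z, s).
apply: (@holder (pt d * R) (fun q => 0 < q.2 < T) (fun f => ext0 T (U f))
  (fun f => sint (U f) 0 T) _ _ _ a (fun q => F q.1 q.2) (fun q => G q.1 q.2) (fun q => E q.1 q.2) x y) => //.
- by move=> f g c e hf hg; apply: (@ext0_plus _ _ (fun z s => c * U f z s) (fun z s => e * U g z s)); exact: sc.
- move=> f g c e hf hg.
  rewrite (_ : U _ = fun z s => c * U f z s + e * U g z s) //.
  rewrite (@sint_plus _ T) //; try lra; try exact: sc.
  by rewrite !(@sint_scal _ T) //; lra.
- by move=> f g hf hg h; apply: (@sint_le _ T) => //; try lra; move=> z s hs; exact: (h (z, s) hs).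
- by move=> [z s] hs; exact: F0.
- by move=> [z s] hs; exact: G0.
- by move=> [z s] hs; exact: hle.
Qed.

(** Above the threshold [powr (2 * B) (/ (1 - e))] the power term is at most half of [x]. *)
Lemma sublinear_bound x A B e : 0 <= x -> 0 <= A -> 0 < B -> 0 <= e < 1 -> x <= A + B * powr x e ->
  x <= 2 * A + powr (2 * B) (/ (1 - e)).
Proof.
move=> hx hA hB he h.
have p0 := powr_ge0 (2 * B) (/ (1 - e)).
case: (Rle_dec x (powr (2 * B) (/ (1 - e)))) => hx2; first lra.
have xp : 0 < x by lra.
have : 2 * B <= powr x (1 - e).
  rewrite -(@powr_inv_l (2 * B) (1 - e)); [|lra|lra].
  apply: powr_le; lra.
have e1 : powr x (1 - e) * powr x e = x by rewrite -powr_plus // (_ : 1 - e + e = 1) ?powr_1 //; ring.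
have pe : 0 <= powr x e by exact: powr_ge0.
move=> h2; have : 2 * B * powr x e <= x by rewrite -{2}e1; apply: Rmult_le_compat_r.
lra.
Qed.

Section Density.
Variables (d : nat) (T : R) (H : pt d -> pt d -> R) (uT m0 : pt d -> R) (alpha : R)
  (eta : pt d -> R) (kappa0 : R).
Hypothesis data : mfg_data T H uT m0 alpha eta kappa0.
Variables (eps : R) (u m : pt d -> R -> R).
Hypothesis sol : is_solution T H uT m0 alpha eta eps u m.

Let hT : 0 < T := T_gt0 data.
Let b := drift H u.
Let SMu k : SM T k u := SM_u data sol k.
Let SMm k : SM T k m := SM_m data sol k.
Let SMb i k : SM T k (b i) := SM_drift data sol i k.

Lemma SM_mpow a k : SM T k (fun x t => powr (m x t) a).
Proof. by have [c [c0 hc]] := m_positive data sol; apply: (SM_powr_pos a c0 hc). Qed.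

Lemma m_gt0 x t : 0 < t < T -> 0 < m x t.
Proof. by move=> ht; have [c [c0 hc]] := m_positive data sol; have := hc x t ht; lra. Qed.

#[local] Hint Resolve SMu SMm SMb SM_mpow : sm.

Definition Dm2 x t := sumI (fun i => DD (Some i) m x t * DD (Some i) m x t).
Definition divb x t := sumI (fun i => DD (Some i) (b i) x t).

Lemma SM_Dm2 k : SM T k Dm2. Proof. rewrite /Dm2; sm. Qed.
Lemma SM_divb k : SM T k divb. Proof. rewrite /divb; sm. Qed.
#[local] Hint Resolve SM_Dm2 SM_divb : sm.

Lemma DD_mpow o a x t : 0 < t < T ->
  DD o (fun x t => powr (m x t) a) x t = a * powr (m x t) (a - 1) * DD o m x t.
Proof. move=> ht; apply: (@DD_powr_pos _ T) => //; exact: m_gt0. Qed.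

Definition mpow a x t := powr (m x t) a.
Definition rate_div a x t := - (a * (a - 1)) * (powr (m x t) (a - 2) * Dm2 x t) + (a - 1) * (powr (m x t) a * divb x t).
Definition rate_drift a x t := - (a * (a - 1)) * (powr (m x t) (a - 2) * Dm2 x t
   + powr (m x t) (a - 1) * sumI (fun i => b i x t * DD (Some i) m x t)).

Lemma mpowE a x t : 0 < t < T -> powr (m x t) (a - 1) = powr (m x t) (a - 2) * m x t /\
  powr (m x t) a = powr (m x t) (a - 2) * m x t * m x t.
Proof.
move=> ht; have m0' := m_gt0 x ht.
have e : powr (m x t) (a - 1) = powr (m x t) (a - 2) * m x t.
  rewrite -{3}(@powr_1 (m x t)); [|lra]; rewrite -powr_plus //; congr powr; ring.
split => //; rewrite -e -{3}(@powr_1 (m x t)); [|lra]; rewrite -powr_plus //; congr powr; ring.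
Qed.

(* [k] is the share of the drift put in divergence form: the remaining source
   involves only [div b] for [k = 1], only [b . Dm] for [k = a]. *)
Let P i a k x t := a * (powr (m x t) (a - 1) * DD (Some i) m x t) + k * (powr (m x t) a * b i x t).

Lemma DD_P i a k x t : 0 < t < T -> DD (Some i) (P i a k) x t =
  a * ((a - 1) * powr (m x t) (a - 2) * (DD (Some i) m x t * DD (Some i) m x t)
    + powr (m x t) (a - 1) * DD (Some i) (DD (Some i) m) x t)
  + k * (a * powr (m x t) (a - 1) * DD (Some i) m x t * b i x t + powr (m x t) a * DD (Some i) (b i) x t).
Proof.
move=> ht; rewrite /P (@DD_plus _ T) //; try by sm.
rewrite !(@DD_scal _ T) //; try by sm.
rewrite !(@DD_mult _ T) //; try by sm.
rewrite !DD_mpow // (_ : a - 1 - 1 = a - 2); ring.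
Qed.

Lemma SM_P i a k j : SM T j (P i a k). Proof. rewrite /P; sm. Qed.

Lemma energy_identity a k x t : 0 < t < T -> DD None (mpow a) x t =
  (- (a * (a - 1)) * (powr (m x t) (a - 2) * Dm2 x t)
   + (a - k) * (powr (m x t) a * divb x t)
   + (a - k * a) * (powr (m x t) (a - 1) * sumI (fun i => b i x t * DD (Some i) m x t)))
  + sumI (fun i => DD (Some i) (P i a k) x t).
Proof.
move=> ht; have [e1 e2] := mpowE a x ht.
rewrite /mpow DD_mpow // (m_eq data sol x ht).
rewrite [X in _ = _ + X](sumI_ext (fun i => DD_P i a k x ht)) /Dm2 /divb /b.
rewrite -!sumI_scal -!sumI_plus; apply: sumI_ext => i.
rewrite e2 e1; ring.
Qed.

Lemma mpow_balance a : forall s t, 0 <= s <= t -> t <= T ->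
  sp (fun x t => powr (cl T m x t) a) t - sp (fun x t => powr (cl T m x t) a) s = sint (rate_div a) s t.
Proof.
move=> s t hst ht.
have [c [c0 hc]] := m_positive data sol.
apply: (@balance d T (mpow a) (rate_div a) (fun i => P i a 1)) => //; try lra.
- exact: SM_mpow.
- rewrite /rate_div; sm.
- by move=> i; exact: SM_P.
- by move=> x r hr; rewrite (energy_identity a 1) // /rate_div; ring.
- apply: cont_powr_pos; last exact: (m_cl_cont data sol).
  move=> [x r]; apply: Rlt_le_trans c0 _.
  have : forall x t, 0 <= t <= T -> c <= cl T m x t.
    by apply: slab_limit_ge => //; [exact: (m_cl_cont data sol)|move=> y q hq; rewrite cl_in; [exact: hc|lra]].
  move=> /(_ x (clamp T r) (clamp_in r hT)); by rewrite /cl (clamp_id (clamp_in r hT)).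
- by move=> x r hr; rewrite /mpow cl_in //; lra.
Qed.

Lemma mpow_is_derive a t : 0 < t < T -> is_derive (sp (mpow a)) t (sp (rate_drift a) t).
Proof.
move=> ht; apply: (@sp_balance d T (mpow a) (rate_drift a) (fun i => P i a a)) => //.
- exact: SM_mpow.
- rewrite /rate_drift; sm.
- by move=> i; exact: SM_P.
- by move=> x r hr; rewrite (energy_identity a a) // /rate_drift; ring.
Qed.

Lemma mpow_cl_cont a : slabcont (fun x t => powr (cl T m x t) a).
Proof.
have [c [c0 hc]] := m_positive data sol.
apply: cont_powr_pos; last exact: (m_cl_cont data sol).
move=> [x r]; apply: Rlt_le_trans c0 _.
have : forall x t, 0 <= t <= T -> c <= cl T m x t.
  by apply: slab_limit_ge => //; [exact: (m_cl_cont data sol)|move=> y q hq; rewrite cl_in; [exact: hc|lra]].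
move=> /(_ x (clamp T r) (clamp_in r hT)); by rewrite /cl (clamp_id (clamp_in r hT)).
Qed.

Lemma sp_mpow_cl a t : 0 < t < T -> sp (fun x t => powr (cl T m x t) a) t = sp (mpow a) t.
Proof. by move=> ht; apply: (@sp_eq _ T) => // x s hs; rewrite cl_in //; lra. Qed.

Lemma sp_mpow_0 a : sp (fun x t => powr (cl T m x t) a) 0 = torint (fun x => powr (m0 x) a).
Proof. by congr (boxint _ _ _); apply: functional_extensionality => x; rewrite cl_in ?(m_0 sol) //; lra. Qed.

Lemma sp_mpow_gt0 a t : 0 < t < T -> 0 < sp (mpow a) t.
Proof.
move=> ht; apply: Rnot_le_lt => h.
have sl := ext0_slice (SM_ext0 (SM_mpow a 0%N)) ht.
have := torint_zero sl (ext0_periodic (SM_ext0 (SM_mpow a 0%N)) ht) (fun x => powr_ge0 _ _) h (fun _ => 0).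
have := powr_gt0 a (m_gt0 (fun _ => 0) ht); lra.
Qed.

Definition grad_energy a x t := powr (m x t) (a - 2) * Dm2 x t.

Lemma SM_grad_energy a k : SM T k (grad_energy a). Proof. rewrite /grad_energy; sm. Qed.

Lemma grad_energy_ge0 a x t : 0 <= grad_energy a x t.
Proof. by apply: Rmult_le_pos; [exact: powr_ge0|apply: sumI_ge0 => i; nra]. Qed.

(** The Sobolev inequality at [w = m^(a / 2)], whose squared gradient is [a^2 / 4] times
    [grad_energy m a]. *)
Lemma sobolev_mpow p C a t : 0 < t < T ->
  (forall (w : pt d -> R) (dw : 'I_d -> pt d -> R),
    cont w -> periodic w -> (forall x, 0 <= w x) ->
    (forall i, cont (dw i)) -> (forall i, periodic (dw i)) ->
    (forall i x, is_derive (fun r => w (upd x i r)) (x i) (dw i x)) ->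
    torint (fun x => powr (w x) p) <=
      C * powr (torint (fun x => sumI (fun i => dw i x * dw i x) + w x * w x)) (p / 2)) ->
  sp (mpow (a * p / 2)) t <= C * powr (a * a / 4 * sp (grad_energy a) t + sp (mpow a) t) (p / 2).
Proof.
move=> ht hS.
pose w x t := powr (m x t) (a / 2).
have SMw k : SM T k w by exact: SM_mpow.
have := hS (fun x => w x t) (fun i x => DD (Some i) w x t).
have -> : torint (fun x => powr (w x t) p) = sp (mpow (a * p / 2)) t.
  congr (boxint _ _ _); apply: functional_extensionality => x.
  rewrite /w powr_powr; last by have := m_gt0 x ht; lra.
  by congr powr; field.
have -> : torint (fun x => sumI (fun i => DD (Some i) w x t * DD (Some i) w x t) + w x t * w x t) =
   a * a / 4 * sp (grad_energy a) t + sp (mpow a) t.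
  rewrite -(@sp_scal _ T) //; last exact: SM_ext0 (SM_grad_energy a 0%N).
  rewrite -(@sp_plus _ T) //; last exact: SM_ext0 (SM_mpow a 0%N); last first.
    by apply: ext0_mult; [exact: ext0_const|exact: SM_ext0 (SM_grad_energy a 0%N)].
  congr (boxint _ _ _); apply: functional_extensionality => x.
  have mp := m_gt0 x ht; congr (_ + _); last first.
    by rewrite /w -powr_plus //; congr powr; field.
  rewrite /grad_energy /Dm2 -!sumI_scal; apply: sumI_ext => i.
  rewrite /w DD_mpow //.
  rewrite (_ : powr (m x t) (a - 2) = powr (m x t) (a / 2 - 1) * powr (m x t) (a / 2 - 1)); first by field.
  by rewrite -powr_plus //; congr powr; field.
have e1 i : SM T 0 (DD (Some i) w) by exact: SM_DD (SMw 1%N).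
apply.
- exact: ext0_slice (SM_ext0 (SMw 0%N)) ht.
- exact: ext0_periodic (SM_ext0 (SMw 0%N)) ht.
- by move=> x; exact: powr_ge0.
- by move=> i; exact: ext0_slice (SM_ext0 (e1 i)) ht.
- by move=> i; exact: ext0_periodic (SM_ext0 (e1 i)) ht.
- by move=> i x; exact: (SM_der (Some i) x (SMw 1%N) ht).
Qed.

End Density.

Lemma Rabs_le_of_sqr x y : 0 <= y -> x * x <= y * y -> x <= y.
Proof. by move=> hy h; apply: Rnot_lt_le => hlt; nra. Qed.

Section Integrability.
Variables (d : nat) (T : R) (H : pt d -> pt d -> R) (uT m0 : pt d -> R) (alpha mu : R)
  (eta : pt d -> R) (kappa0 : R).
Hypothesis data : mfg_data T H uT m0 alpha eta kappa0.
Hypothesis hd : 2 <= INR d.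
Hypothesis hmu : 0 < mu < 1.
Hypothesis A3 : exists c C : R, 0 < c /\ 0 < C /\
  forall x p, sumI (fun i => dHp i H x p * p i) - H x p >= c * H x p - C.
Hypothesis H_superlinear : forall L, exists C, forall x p, L * sumI (fun i => Rabs (p i)) <= H x p + C.
Hypothesis A5a : exists C : R, forall x p,
  vnorm (fun i => dHx i H x p) <= C * H x p + C /\
  mnorm (fun i j => dHx i (dHx j H) x p) <= C * H x p + C.
Hypothesis A5b : forall delta : R, 0 < delta -> exists Cd : R, forall M : mat d, msym M -> forall x p,
  mtr (mmul (fun i j => dHp i (dHx j H) x p) M)
    <= delta * mtr (mmul (fun i j => dHp i (dHp j H) x p) (mmul M M)) + Cd * H x p.
Hypothesis A9a : exists C : R, forall x p,
  mnorm (fun i j => dHx i (dHp j H) x p) * mnorm (fun i j => dHx i (dHp j H) x p)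
    <= C * Rpower (H x p) ((2 + 2 * mu) / (2 + mu)).
Hypothesis A9b : exists C : R, forall M : mat d, msym M -> forall x p,
  mnorm (mmul (fun i j => dHp i (dHp j H) x p) M)
    * mnorm (mmul (fun i j => dHp i (dHp j H) x p) M)
  <= C * Rpower (H x p) (mu / (2 + mu))
       * mtr (mmul (fun i j => dHp i (dHp j H) x p) (mmul M M)).

Let hT : 0 < T := T_gt0 data.

Lemma divbE eps u m x t : is_solution T H uT m0 alpha eta eps u m -> 0 < t < T ->
  divb H u x t = mtr (fun i j => dHx i (dHp j H) x (grad u x t)) +
    mtr (mmul (fun i j => dHp i (dHp j H) x (grad u x t)) (hessu u x t)).
Proof.
move=> sol ht.
have V1 i : SM T 1 (DD (Some i) u) by exact: (SM_V data sol).
rewrite /divb /drift.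
rewrite (sumI_ext (g := fun k => dHx k (dHp k H) x (grad u x t) +
   sumI (fun i => dHp i (dHp k H) x (grad u x t) * hessu u x t k i))).
  by rewrite sumI_plus sumI_swap.
move=> k; rewrite (@DD_comp d T (Hjoint H) (H_smooth data) [:: rshift d k] _ k x t V1 ht).
have cE s (G : pt d -> pt d -> R) : iterD s (Hjoint H) = Hjoint G ->
    slabcomp (Hjoint H) s (fun i => DD (Some i) u) x t = G x (grad u x t).
  by move=> e; rewrite /slabcomp e Hjoint_cat.
rewrite (cE _ (dHx k (dHp k H))); last by rewrite /= pd_Hjoint_r pd_Hjoint_l.
congr (_ + _); apply: sumI_ext => i.
by rewrite (cE _ (dHp i (dHp k H))) //= !pd_Hjoint_r.
Qed.

(** The two bounds of (A9) have a common scale: for [k = (1 + mu) / (2 + mu)], [2 * k] is the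
    exponent in the first, and also [mu / (2 + mu) + 1], which fits the second since [A] and [H] are
    both at most [A + H]. *)
Lemma div_bound : exists C, 0 < C /\ forall eps u m, is_solution T H uT m0 alpha eta eps u m ->
  forall x t, 0 < t < T ->
  Rabs (divb H u x t) <= C * powr (energyA H u x t + hamil H u x t) ((1 + mu) / (2 + mu)).
Proof.
have [C1 hC1] := A9a; have [C2 hC2] := A9b.
exists (INR d * (sqrt (Rabs C1) + sqrt (Rabs C2)) + 1).
have s1 := sqrt_pos (Rabs C1); have s2 := sqrt_pos (Rabs C2).
have q1 := sqrt_sqrt (Rabs C1) (Rabs_pos _); have q2 := sqrt_sqrt (Rabs C2) (Rabs_pos _).
have c0 : 0 <= INR d * (sqrt (Rabs C1) + sqrt (Rabs C2)) by apply: Rmult_le_pos; lra.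
split; first lra.
move=> eps u m sol x t ht.
have A0 := energyA_ge0 data A5b sol x ht.
have h1 : 1 <= hamil H u x t by rewrite hamilE; exact: H_ge1 data _ _.
set A := energyA H u x t in A0 *; set h := hamil H u x t in h1 *.
set N := A + h; set k := (1 + mu) / (2 + mu).
have k0 : 0 < k by apply: Rdiv_lt_0_compat; lra.
have pN : 0 <= powr N k by exact: powr_ge0.
have pNN : powr N k * powr N k = powr N (mu / (2 + mu)) * N.
  rewrite -{4}(@powr_1 N); last by rewrite /N; lra.
  by rewrite -!powr_plus; [congr powr; rewrite /k; field; lra|rewrite /N; lra|rewrite /N; lra].
have b1 : mnorm (fun i j => dHx i (dHp j H) x (grad u x t)) <= sqrt (Rabs C1) * powr N k.
  apply: Rabs_le_of_sqr; first exact: Rmult_le_pos.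
  apply: Rle_trans (hC1 x (grad u x t)) _; rewrite -hamilE -/h -powr_Rpower; last lra.
  have -> : sqrt (Rabs C1) * powr N k * (sqrt (Rabs C1) * powr N k) = Rabs C1 * (powr N k * powr N k).
    by rewrite -{3}q1; ring.
  rewrite -powr_plus; last by rewrite /N; lra.
  have -> : (2 + 2 * mu) / (2 + mu) = k + k by rewrite /k; field; lra.
  apply: Rle_trans (_ : Rabs C1 * powr h (k + k) <= _).
    by apply: Rmult_le_compat_r; [exact: powr_ge0|exact: Rle_abs].
  apply: Rmult_le_compat_l; first exact: Rabs_pos.
  by apply: powr_le; rewrite /N; lra.
have b2 : mnorm (mmul (fun i j => dHp i (dHp j H) x (grad u x t)) (hessu u x t)) <= sqrt (Rabs C2) * powr N k.
  apply: Rabs_le_of_sqr; first exact: Rmult_le_pos.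
  apply: Rle_trans (hC2 _ (hessu_sym data sol x ht) x (grad u x t)) _.
  rewrite -hamilE -/h -powr_Rpower; last lra.
  change (C2 * powr h (mu / (2 + mu)) * A <= sqrt (Rabs C2) * powr N k * (sqrt (Rabs C2) * powr N k)).
  have -> : sqrt (Rabs C2) * powr N k * (sqrt (Rabs C2) * powr N k) = Rabs C2 * (powr N k * powr N k).
    by rewrite -{3}q2; ring.
  rewrite pNN Rmult_assoc.
  have p1 := powr_ge0 h (mu / (2 + mu)).
  apply: Rle_trans (_ : Rabs C2 * (powr h (mu / (2 + mu)) * A) <= _).
    by apply: Rmult_le_compat_r; [exact: Rmult_le_pos|exact: Rle_abs].
  apply: Rmult_le_compat_l; first exact: Rabs_pos.
  apply: Rmult_le_compat => //; last by rewrite /N; lra.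
  by apply: powr_le; [apply: Rlt_le; apply: Rdiv_lt_0_compat; lra|rewrite /N; lra].
rewrite (@divbE eps u m x t sol ht).
apply: Rle_trans (Rabs_triang _ _) _.
have k1 := mtr_mnorm (fun i j => dHx i (dHp j H) x (grad u x t)).
have k2 := mtr_mnorm (mmul (fun i j => dHp i (dHp j H) x (grad u x t)) (hessu u x t)).
have k3 : INR d * mnorm (fun i j => dHx i (dHp j H) x (grad u x t)) <= INR d * (sqrt (Rabs C1) * powr N k).
  by apply: Rmult_le_compat_l => //; lra.
have k4 : INR d * mnorm (mmul (fun i j => dHp i (dHp j H) x (grad u x t)) (hessu u x t)) <= INR d * (sqrt (Rabs C2) * powr N k).
  by apply: Rmult_le_compat_l => //; lra.
nra.
Qed.

(* With [s = 1 + (a - 1)(2 + mu)], [m^a |div D_pH|] is at most a multiple of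
   [((A + H) m)^(1 - k) (m^s)^k], [k = 1 / (2 + mu)]; the upper bound on [a] says
   that [L^s] in space-time is subcritical for the energy of [m^(a/2)]. *)
Lemma density_bound a : 1 <= a -> a < INR d * (1 + mu) / (INR d * (1 + mu) - 2) ->
  exists C, 0 < C /\ forall eps u m, is_solution T H uT m0 alpha eta eps u m ->
    forall t, 0 < t < T -> sp (mpow m a) t <= C.
Proof.
move=> ha hlt.
have D2 : 0 < INR d * (1 + mu) - 2 by nra.
(* For [a = 1] the coefficient [a * (a - 1)] of the dissipation vanishes, and conservation of mass
   gives the bound. *)
case: ha => ha; last first.
  exists 1; split; first lra.
  move=> eps u m sol t ht; apply: Rle_trans (_ : sp m t <= _); last by rewrite (sp_m data sol ht); lra.
  right; rewrite -ha.
  apply: (@sp_eq _ T) => // x s hs; rewrite /mpow powr_1 //.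
  by have := m_gt0 data sol x hs; lra.
pose s := 1 + (a - 1) * (2 + mu).
pose q := s / a.
have hlt2 : a * (INR d * (1 + mu) - 2) < INR d * (1 + mu) by apply/Rlt_div_r.
have hgap : (a - 1) * (INR d * (1 + mu) - 2) < 2 by lra.
have qa : q * a = s by rewrite /q; field; lra.
have q1 : 1 < q.
  apply: (Rmult_lt_reg_r a); first lra.
  by rewrite qa /s; nra.
have qd : INR d * (q - 1) < 2.
  apply: (Rmult_lt_reg_r a); first lra.
  rewrite (_ : INR d * (q - 1) * a = INR d * (s - a)); last by rewrite -qa; ring.
  by rewrite /s; nra.
have q2 : q < 2 by nra.
(* [m^s] lies between [m^(a p / 2)] and [m^a] with weights [2 - q] and [q - 1]. This [p] makes the
   power [p / 2 * (2 - q)] of the energy equal to 1, so that the bound is linear in the energy and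
   can be integrated in time. Its subcriticality is [d * (q - 1) < 2]. *)
pose p := 2 / (2 - q).
have hp : 2 < p by apply/Rlt_div_r; lra.
have ip : / p = (2 - q) / 2 by rewrite /p; field; lra.
have [CS [CS0 hS]] : exists C, 0 < C /\ _ := @sobolev d p hp ltac:(rewrite ip; lra).
have [Cd [Cd0 hCd]] := div_bound.
have [C1 [C10 hC1]] := first_order data A3 H_superlinear.
have [C2 [C20 hC2]] := second_order data A3 H_superlinear A5a A5b.
pose k := / (2 + mu).
have k0 : 0 < k < / 2.
  by split; [apply: Rinv_0_lt_compat; lra|apply: Rinv_lt_contravar; lra].
have k' : (1 + mu) / (2 + mu) = 1 - k by rewrite /k; field; lra.
pose y0 := torint (fun x => powr (m0 x) a).
have cm0 : cont m0 by exact: smooth_cont (m0_smooth data).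
have y00 : 0 <= y0.
  apply: boxint_ge0; [lra|by apply: cont_powr => //; lra|by move=> x _; exact: powr_ge0].
pose X := C1 + C2 + 1.
pose K1 := powr CS (2 - q).
pose K2 := K1 * (a / (4 * (a - 1)) + T).
have K10 : 0 < K1 by exact: powr_gt0.
have K20 : 0 < K2.
  apply: Rmult_lt_0_compat => //.
  have : 0 < a / (4 * (a - 1)) by apply: Rdiv_lt_0_compat; lra.
  lra.
pose B := (a - 1) * (Cd * (powr X (1 - k) * powr K2 k)).
have B0 : 0 < B.
  apply: Rmult_lt_0_compat; first lra.
  by apply: Rmult_lt_0_compat => //; apply: Rmult_lt_0_compat; apply: powr_gt0 => //; rewrite /X; lra.
(* The exponent that closes the estimate: [q < 2] rests on [2 <= d], and [k < / 2] on [0 < mu]. *)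
have qk : 0 <= q * k < 1.
  split; first by apply: Rmult_le_pos; lra.
  by apply: Rle_lt_trans (_ : 2 * k < _); [apply: Rmult_le_compat_r; lra|lra].
exists (2 * (y0 + 1) + powr (2 * B) (/ (1 - q * k))); split.
  by have := powr_ge0 (2 * B) (/ (1 - q * k)); lra.
move=> eps u m sol.
have SMmp := SM_mpow data sol; have SMG := SM_grad_energy data sol; have SMd := SM_divb data sol.
have SMA := SM_energyA data sol; have SMh := SM_hamil data sol; have SMm := SM_m data sol.
have mp x t : 0 < t < T -> 0 < m x t by exact: (m_gt0 data sol).
have eG : ext0 T (grad_energy m a) by exact: SM_ext0 (SMG a 0%N).
have ema c : ext0 T (mpow m c) by exact: SM_ext0 (SMmp c 0%N).
pose W x t := mpow m a x t * Rabs (divb H u x t).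
have eW : ext0 T W by apply: ext0_mult => //; apply: ext0_Rabs; exact: SM_ext0 (SMd 0%N).
have W0 x t : 0 <= W x t by apply: Rmult_le_pos; [exact: powr_ge0|exact: Rabs_pos].
pose J := sint W 0 T.
have J0 : 0 <= J by apply: sint_ge0 => // x t _; exact: W0.
have ineq t : 0 <= t <= T ->
    sp (fun x t => powr (cl T m x t) a) t + a * (a - 1) * sint (grad_energy m a) 0 t <= y0 + (a - 1) * J.
  move=> ht.
  have bal := mpow_balance data sol a (s := 0) (t := t) ltac:(lra) ltac:(lra).
  rewrite (sp_mpow_0 data sol) -/y0 in bal.
  have sc f c : ext0 T f -> ext0 T (fun x t => c * f x t) by move=> h; apply: ext0_mult => //; exact: ext0_const.
  have eQ : ext0 T (rate_div H u m a).
    apply: (SM_ext0 (k := 0)); apply: SM_plus; apply: SM_scal; first exact: SMG.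
    by apply: SM_mult; [exact: SMmp|exact: SMd].
  have : sint (rate_div H u m a) 0 t <= sint (fun x t => - (a * (a - 1)) * grad_energy m a x t + (a - 1) * W x t) 0 t.
    apply: (@sint_le _ T) => //; try lra; first by apply: ext0_plus; exact: sc.
    move=> x r hr; rewrite /rate_div; apply: Rplus_le_compat_l; apply: Rmult_le_compat_l; first lra.
    by apply: Rmult_le_compat_l; [exact: powr_ge0|exact: Rle_abs].
  rewrite (@sint_plus _ T) //; try lra; try exact: sc.
  rewrite !(@sint_scal _ T) //; try lra.
  have : (a - 1) * sint W 0 t <= (a - 1) * J.
    by apply: Rmult_le_compat_l; [lra|apply: (@sint_mono_b _ T)].
  lra.
(* One number that bounds the integral of [m^a] at every time and the total dissipation; the added 1
   makes it at least 1. *)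
pose R0 := y0 + 1 + (a - 1) * J.
have J1 : 0 <= (a - 1) * J by apply: Rmult_le_pos; lra.
have R1 : 1 <= R0 by rewrite /R0; lra.
have Gt0 t : 0 <= t <= T -> 0 <= sint (grad_energy m a) 0 t.
  move=> ht; apply: Rle_trans (_ : sint (fun (_ : pt d) _ => 0) 0 t <= _); first by rewrite sint_const; lra.
  by apply: (@sint_le _ T) => //; try lra; [exact: ext0_const|move=> x r _; exact: grad_energy_ge0].
have aa : 0 < a * (a - 1) by apply: Rmult_lt_0_compat; lra.
have yR t : 0 < t < T -> sp (mpow m a) t <= R0.
  move=> ht; have := ineq t ltac:(lra); rewrite sp_mpow_cl // => h.
  have := Rmult_le_pos _ _ (Rlt_le _ _ aa) (Gt0 t ltac:(lra)); rewrite /R0; lra.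
have GR : a * (a - 1) * sint (grad_energy m a) 0 T <= R0.
  have h := ineq T ltac:(lra).
  have : 0 <= sp (fun x t => powr (cl T m x t) a) T.
    apply: boxint_ge0; [lra| |by move=> x _; exact: powr_ge0].
    by apply: cont_powr; [lra|exact: (m_cl_slice data sol)].
  rewrite /R0; lra.
have Gsp t : 0 < t < T -> 0 <= sp (grad_energy m a) t.
  move=> ht; apply: boxint_ge0; [lra|exact: ext0_slice eG ht|by move=> x _; exact: grad_energy_ge0].
have step t : 0 < t < T -> sp (mpow m s) t <= K1 * powr R0 (q - 1) * (a * a / 4 * sp (grad_energy m a) t + sp (mpow m a) t).
  move=> ht.
  have yp := sp_mpow_gt0 data sol a ht.
  set N2 := a * a / 4 * _ + _.
  have N20 : 0 < N2.
    have : 0 <= a * a / 4 * sp (grad_energy m a) t by apply: Rmult_le_pos; [nra|exact: Gsp].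
    rewrite /N2; lra.
  have sob := sobolev_mpow data sol a ht hS; rewrite -/N2 in sob.
  have := @slice_holder d (fun x => mpow m (a * p / 2) x t) (fun x => mpow m a x t) (fun x => mpow m s x t)
    (2 - q) (CS * powr N2 (p / 2)) R0.
  have -> : 1 - (2 - q) = q - 1 by ring.
  have -> : powr (CS * powr N2 (p / 2)) (2 - q) = K1 * N2.
    rewrite powr_mult; [|lra|exact: powr_ge0]; rewrite powr_powr; last lra.
    by rewrite (_ : p / 2 * (2 - q) = 1) ?powr_1 //; [lra|rewrite /p; field; lra].
  move=> hh; rewrite (_ : K1 * powr R0 (q - 1) * N2 = K1 * N2 * powr R0 (q - 1)); last ring.
  apply: hh; try lra.
  - exact: ext0_slice (ema _) ht.
  - exact: ext0_slice (ema _) ht.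
  - exact: ext0_slice (ema _) ht.
  - by move=> z; exact: powr_ge0.
  - by move=> z; exact: powr_ge0.
  - move=> z; right; rewrite /mpow !powr_powr; try by (apply: Rlt_le; exact: mp).
    rewrite -powr_plus; last exact: mp.
    by congr powr; rewrite -qa /p; field; lra.
  - by apply: Rmult_lt_0_compat => //; exact: powr_gt0.
  - exact: sob.
  - exact: yR.
have S1 : sint (mpow m s) 0 T <= K2 * powr R0 q.
  pose c := K1 * powr R0 (q - 1).
  have c0 : 0 <= c by apply: Rmult_le_pos; [lra|exact: powr_ge0].
  have e1 : ext0 T (fun (_ : pt d) _ => 0) by exact: ext0_const.
  have : sint (mpow m s) 0 T <= sint (fun x t => c * (a * a / 4) * grad_energy m a x t + c * mpow m a x t + 0 * 0) 0 T.
    apply: (@sint_sp_le _ T) => //; try lra.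
      by apply: ext0_plus; [apply: ext0_plus|]; apply: ext0_mult => //; exact: ext0_const.
    move=> t ht; apply: Rle_trans (step t ht) _; right.
    rewrite -/c Rmult_plus_distr_l -Rmult_assoc -!(@sp_scal _ T) // -(@sp_plus _ T) //; try (by apply: ext0_mult => //; exact: ext0_const).
    by apply: (@sp_eq _ T) => // x r _; ring.
  rewrite (@sint_comb d T) //.
  have : sint (mpow m a) 0 T <= R0 * T.
    have -> : R0 * T = sint (fun (_ : pt d) _ => R0) 0 T by rewrite sint_const; ring.
    apply: (@sint_sp_le _ T) => //; try lra; first exact: ext0_const.
    by move=> t ht; rewrite sp_const; exact: yR.
  move=> h1 h2.
  have h3 : a * a / 4 * sint (grad_energy m a) 0 T <= a / (4 * (a - 1)) * R0.
    have -> : a * a / 4 * sint (grad_energy m a) 0 T = a / (4 * (a - 1)) * (a * (a - 1) * sint (grad_energy m a) 0 T) by field; lra.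
    apply: Rmult_le_compat_l => //; apply: Rlt_le; apply: Rdiv_lt_0_compat; lra.
  have -> : K2 * powr R0 q = c * (a / (4 * (a - 1)) * R0 + R0 * T).
    rewrite /K2 /c (_ : powr R0 q = powr R0 (q - 1) * R0); first ring.
    by rewrite -{3}(@powr_1 R0) -?powr_plus; [congr powr; ring|lra|lra].
  have h4 := Rmult_le_compat_l _ _ _ c0 h1; have h5 := Rmult_le_compat_l _ _ _ c0 h3.
  lra.
pose N x t := energyA H u x t + hamil H u x t.
have SMN j : SM T j N by apply: SM_plus; [exact: SMA|exact: SMh].
have N1 x t : 0 < t < T -> 1 <= N x t.
  move=> ht; have := energyA_ge0 data A5b sol x ht; have := H_ge1 data x (grad u x t).
  rewrite -hamilE /N; lra.
have JX : J <= Cd * (powr X (1 - k) * powr (K2 * powr R0 q) k).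
  have -> : J = Cd * sint (fun x t => / Cd * W x t) 0 T.
    by rewrite (@sint_scal _ T) //; [rewrite /J; field; lra|lra|lra].
  apply: Rmult_le_compat_l; first lra.
  have := @sint_holder d T (fun x t => N x t * m x t) (mpow m s) (fun x t => / Cd * W x t) (1 - k) X (K2 * powr R0 q).
  rewrite (_ : 1 - (1 - k) = k); last ring.
  apply => //; try lra.
  - by apply: (SM_ext0 (k := 0)); apply: SM_mult; [exact: SMN|exact: SMm].
  - by apply: ext0_mult => //; exact: ext0_const.
  - by move=> z r hr; apply: Rmult_le_pos; [have := N1 z r hr; lra|apply: Rlt_le; exact: mp].
  - by move=> z r _; exact: powr_ge0.
  - move=> z r hr.
    have n1 := N1 z r hr; have mz := mp z r hr.
    have := hCd eps u m sol z r hr; rewrite k' -/(N z r) => hdv.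
    apply: Rle_trans (_ : mpow m a z r * powr (N z r) (1 - k) <= _).
      rewrite /W -Rmult_assoc (Rmult_comm (/ Cd)) Rmult_assoc.
      apply: Rmult_le_compat_l; first exact: powr_ge0.
      apply: (Rmult_le_reg_l Cd) => //; rewrite -Rmult_assoc Rinv_r ?Rmult_1_l //; lra.
    right; rewrite powr_mult; [|lra|lra]; rewrite /mpow powr_powr; last lra.
    rewrite Rmult_assoc -powr_plus // Rmult_comm; congr (_ * powr _ _).
    by rewrite /s /k; field; lra.
  - by rewrite /X; lra.
  - by apply: Rmult_lt_0_compat => //; apply: powr_gt0; lra.
  - have [f1 _] := hC1 eps u m sol; have f2 := hC2 eps u m sol.
    rewrite (@sint_eq d T _ (fun x t => energyA H u x t * m x t + hamil H u x t * m x t)) //; try lra.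
      rewrite (@sint_plus _ T) //; try lra.
      + by rewrite /X; lra.
      + by apply: (SM_ext0 (k := 0)); apply: SM_mult; [exact: SMA|exact: SMm].
      + by apply: (SM_ext0 (k := 0)); apply: SM_mult; [exact: SMh|exact: SMm].
    by move=> x r _; rewrite /N; ring.
have R0_le : R0 <= (y0 + 1) + B * powr R0 (q * k).
  rewrite /R0; apply: Rplus_le_compat_l.
  have -> : B * powr R0 (q * k) = (a - 1) * (Cd * (powr X (1 - k) * powr (K2 * powr R0 q) k)).
    rewrite powr_mult; [|lra|exact: powr_ge0]; rewrite powr_powr; last lra.
    by rewrite /B; ring.
  apply: Rmult_le_compat_l; [lra|exact: JX].
have fin := @sublinear_bound R0 (y0 + 1) B (q * k) ltac:(lra) ltac:(lra) B0 qk R0_le.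
by move=> t ht; apply: Rle_trans (yR t ht) fin.
Qed.

Lemma higher_density theta a0 K : 1 < theta -> 1 <= a0 -> 0 < K ->
  exists C, 0 < C /\ forall eps u m, is_solution T H uT m0 alpha eta eps u m ->
    (forall t, 0 < t < T -> sp (mpow m a0) t <= K) ->
    forall D, 0 <= D -> (forall x t, 0 < t < T -> sumI (fun i => drift H u i x t * drift H u i x t) <= D) ->
    forall t, 0 < t < T -> sp (mpow m (theta * a0)) t <= C + C * powr D ((INR d * (theta - 1) + 2) / 2).
Proof.
move=> hth ha0 hK.
set r := (INR d * (theta - 1) + 2) / 2.
pose a := theta * a0.
have a1 : 1 < a by rewrite /a; nra.
have r1 : theta <= r by rewrite /r; nra.
(* [p] and the weight [tau] below meet two requirements: [m^a] lies between [m^(a p / 2)] and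
   [m^a0], and the power [p / 2 * tau] of the energy is [r / (r + 1)], which gives [y^(1 + 1 / r)]
   after inversion. The Sobolev condition becomes [d * (theta - 1) < 2 * r], which holds with margin
   2. *)
pose p := 2 * r / (r + 1 - theta).
have hp : 2 < p by apply/Rlt_div_r; lra.
have ip : / p = (r + 1 - theta) / (2 * r) by rewrite /p; field; lra.
have hdp : INR d * (/ 2 - / p) < 1.
  rewrite ip (_ : INR d * (/ 2 - (r + 1 - theta) / (2 * r)) = INR d * (theta - 1) / (2 * r)); last by field; lra.
  apply/Rlt_div_l; [lra|rewrite /r; lra].
have [CS [CS0 hS]] : exists C, 0 < C /\ _ := @sobolev d p hp hdp.
pose tau := (r + 1 - theta) / (r + 1).
have tau01 : 0 < tau < 1.
  by split; [apply: Rdiv_lt_0_compat; lra|apply/Rlt_div_l; lra].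
pose K3 := powr CS tau * powr K (1 - tau).
have K30 : 0 < K3 by apply: Rmult_lt_0_compat; exact: powr_gt0.
pose c := powr K3 ((r + 1) / r).
have c0 : 0 < c by exact: powr_gt0.
pose c2 := 4 / (a * a) / c.
have aa0 : 0 < a * a by nra.
have c20 : 0 < c2 by apply: Rdiv_lt_0_compat => //; apply: Rdiv_lt_0_compat; lra.
pose y0 := torint (fun x => powr (m0 x) a).
have cm0 : cont m0 by exact: smooth_cont (m0_smooth data).
have y00 : 0 <= y0.
  apply: boxint_ge0; [lra|by apply: cont_powr => //; lra|by move=> x _; exact: powr_ge0].
pose Cf := powr (/ c2) r * powr 2 r.
have Cf0 : 0 < Cf.
  by apply: Rmult_lt_0_compat; apply: powr_gt0; [exact: Rinv_0_lt_compat|lra].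
pose Cg := Cf * powr (4 / (a * a)) r.
have Cg0 : 0 <= Cg by apply: Rmult_le_pos; [lra|exact: powr_ge0].
exists (y0 + Cf + Cg); split; first lra.
move=> eps u m sol hm D hD hb.
have SMmp := SM_mpow data sol; have SMG := SM_grad_energy data sol.
have SMb := SM_drift data sol; have SMm := SM_m data sol.
have mp x t : 0 < t < T -> 0 < m x t by exact: (m_gt0 data sol).
have eG : ext0 T (grad_energy m a) by exact: SM_ext0 (SMG a 0%N).
have ema e : ext0 T (mpow m e) by exact: SM_ext0 (SMmp e 0%N).
have Gsp t : 0 < t < T -> 0 <= sp (grad_energy m a) t.
  move=> ht; apply: boxint_ge0; [lra|exact: ext0_slice eG ht|by move=> x _; exact: grad_energy_ge0].
pose y := sp (mpow m a).
(* Beyond the second summand, [c2 * y^(1 / r)] exceeds [D + 4 / a^2], where [4 / a^2] pays for the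
   zero order term in the Sobolev energy. The first summand puts the initial value below [B]. *)
pose B := y0 + powr ((D + 4 / (a * a)) / c2) r.
have coer t : 0 < t < T -> y t * powr (y t) (/ r) <= c * (a * a / 4 * sp (grad_energy m a) t + y t).
  move=> ht.
  have yp : 0 < y t := sp_mpow_gt0 data sol a ht.
  set N2 := a * a / 4 * _ + _.
  have N20 : 0 < N2.
    have : 0 <= a * a / 4 * sp (grad_energy m a) t by apply: Rmult_le_pos; [lra|exact: Gsp].
    rewrite /N2; lra.
  have sob := sobolev_mpow data sol a ht hS; rewrite -/N2 in sob.
  have hh : y t <= K3 * powr N2 (r / (r + 1)).
    have -> : K3 * powr N2 (r / (r + 1)) = powr (CS * powr N2 (p / 2)) tau * powr K (1 - tau).
      rewrite powr_mult; [|lra|exact: powr_ge0]; rewrite powr_powr; last lra.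
      rewrite (_ : p / 2 * tau = r / (r + 1)); first by rewrite /K3; ring.
      by rewrite /p /tau; field; lra.
    apply: (@slice_holder d (fun x => mpow m (a * p / 2) x t) (fun x => mpow m a0 x t)) => //.
    - exact: ext0_slice (ema _) ht.
    - exact: ext0_slice (ema _) ht.
    - exact: ext0_slice (ema _) ht.
    - by move=> z; exact: powr_ge0.
    - by move=> z; exact: powr_ge0.
    - move=> z; right; rewrite /mpow !powr_powr; try by (apply: Rlt_le; exact: mp).
      rewrite -powr_plus; last exact: mp.
      by congr powr; rewrite /a /p /tau; field; lra.
    - by apply: Rmult_lt_0_compat => //; exact: powr_gt0.
    - exact: hm.
  have -> : y t * powr (y t) (/ r) = powr (y t) ((r + 1) / r).
    by rewrite -{1}(@powr_1 (y t)) -?powr_plus; [congr powr; field; lra|lra|lra].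
  have -> : c * N2 = powr (K3 * powr N2 (r / (r + 1))) ((r + 1) / r).
    rewrite powr_mult; [|lra|exact: powr_ge0]; rewrite powr_powr; last lra.
    by rewrite (_ : r / (r + 1) * ((r + 1) / r) = 1) ?powr_1 //; [lra|field; lra].
  by apply: powr_le => //; apply: Rlt_le; apply: Rdiv_lt_0_compat; lra.
have decay t : 0 < t < T -> B < y t -> sp (rate_drift H u m a) t <= 0.
  move=> ht hB.
  have yp : 0 < y t := sp_mpow_gt0 data sol a ht.
  have Q4le : sp (rate_drift H u m a) t <= a * (a - 1) / 2 * (D * y t - sp (grad_energy m a) t).
    have -> : a * (a - 1) / 2 * (D * y t - sp (grad_energy m a) t) =
       sp (fun x t => (a * (a - 1) / 2 * D) * mpow m a x t + (- (a * (a - 1) / 2)) * grad_energy m a x t) t.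
      rewrite (@sp_plus _ T) //; try (by apply: ext0_mult => //; exact: ext0_const).
      by rewrite !(@sp_scal _ T) // /y; ring.
    apply: (@sp_le _ T) => //.
    - apply: (SM_ext0 (k := 0)); apply: SM_scal; apply: SM_plus; first exact: SMG.
      by apply: SM_mult; [exact: SMmp|apply: SM_sumI => i; apply: SM_mult; [exact: SMb|exact: SM_DD (SMm 1%N)]].
    - by apply: ext0_plus; apply: ext0_mult => //; exact: ext0_const.
    move=> x; have [e1 e2] := mpowE data sol a x ht.
    rewrite /rate_drift /grad_energy /mpow e1 e2 /Dm2.
    have pc := powr_ge0 (m x t) (a - 2); set cc := powr _ _ in pc *.
    have mx := mp x t ht; set mm := m x t in mx *.
    have hDx := hb x t ht.
    (* The square of [D m + m b] splits the drift term so that half of the dissipation is kept. *)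
    have key : - sumI (fun i => drift H u i x t * DD (Some i) m x t) * mm <=
       / 2 * sumI (fun i => DD (Some i) m x t * DD (Some i) m x t) + / 2 * (mm * mm) * D.
      apply: Rle_trans (_ : / 2 * sumI (fun i => DD (Some i) m x t * DD (Some i) m x t)
         + / 2 * (mm * mm) * sumI (fun i => drift H u i x t * drift H u i x t) <= _).
        rewrite -sumI_opp Rmult_comm -!sumI_scal -sumI_plus; apply: sumI_le => i.
        have := Rle_0_sqr (DD (Some i) m x t + mm * drift H u i x t); rewrite /Rsqr; lra.
      apply: Rplus_le_compat_l; apply: Rmult_le_compat_l => //; nra.
    set S1 := sumI (fun i => drift H u i x t * _) in key *; set S2 := sumI _ in key *.
    have k2 : a * (a - 1) * cc * (- S1 * mm) <= a * (a - 1) * cc * (/ 2 * S2 + / 2 * (mm * mm) * D).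
      apply: Rmult_le_compat_l => //; apply: Rmult_le_pos => //; nra.
    lra.
  apply: Rle_trans Q4le _.
  have ac : 0 < a * (a - 1) / 2 by nra.
  suff : D * y t <= sp (grad_energy m a) t by move=> h; nra.
  have hc := coer t ht.
  have hy : (D + 4 / (a * a)) / c2 <= powr (y t) (/ r).
    have dp : 0 <= (D + 4 / (a * a)) / c2.
      apply: Rdiv_le_0_compat => //; have : 0 < 4 / (a * a) by apply: Rdiv_lt_0_compat; lra.
      lra.
    rewrite -(@powr_inv_r ((D + 4 / (a * a)) / c2) r) //; last lra.
    apply: powr_le; first by apply: Rlt_le; apply: Rinv_0_lt_compat; lra.
    rewrite /B in hB; lra.
  have h1 : D + 4 / (a * a) <= c2 * powr (y t) (/ r).
    have -> : D + 4 / (a * a) = c2 * ((D + 4 / (a * a)) / c2) by field; lra.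
    by apply: Rmult_le_compat_l; lra.
  have h2 : (D + 4 / (a * a)) * y t <= c2 * powr (y t) (/ r) * y t by apply: Rmult_le_compat_r; lra.
  have h3 : 4 / (a * a) / c * (y t * powr (y t) (/ r)) <= 4 / (a * a) / c * (c * (a * a / 4 * sp (grad_energy m a) t + y t)).
    by apply: Rmult_le_compat_l; [exact: Rlt_le|].
  have e3 : 4 / (a * a) / c * (c * (a * a / 4 * sp (grad_energy m a) t + y t)) = sp (grad_energy m a) t + 4 / (a * a) * y t.
    by field; lra.
  rewrite e3 -/c2 in h3; lra.
have bound t : 0 < t < T -> y t <= B.
  move=> ht.
  pose yc := sp (fun x t => powr (cl T m x t) a).
  have cyc : cont yc by apply: sp_cont; exact: (mpow_cl_cont data sol).
  have ycE s : 0 < s < T -> yc s = y s by move=> hs; exact: sp_mpow_cl.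
  (* The squared positive part of [yc - B] is 0 initially and cannot increase, since [decay] gives
     the sign of the derivative exactly where that part is positive. *)
  have h0 : powr (yc t - B) 2 <= powr (yc 0 - B) 2.
    apply: (@nonincreasing (fun s => powr (yc s - B) 2) (fun s => 2 * powr (yc s - B) 1 * sp (rate_drift H u m a) s)); first lra.
    - by apply: cont_powr; [lra|apply: cont_minus => //; exact: cont_const].
    - move=> s hs; have hs' : 0 < s < T by lra.
      have dy : is_derive (fun s => yc s - B) s (sp (rate_drift H u m a) s).
        rewrite -[sp _ s]Rminus_0_r; apply: (@is_derive_minus _ _ yc); last exact: (@is_derive_const _ _ B).
        apply: is_derive_ext_loc (mpow_is_derive data sol a hs').
        have hl : locally s (fun r => 0 < r < T) := @near_slab d T None (fun _ => 0) s hs'.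
        by apply: filter_imp hl => q hq; symmetry; exact: ycE.
      have d2 := @is_derive_powr (yc s - B) 2 ltac:(lra).
      rewrite (_ : 2 - 1 = 1) in d2; last ring.
      rewrite Rmult_comm; exact: (@is_derive_comp _ _ (fun y => powr y 2) (fun s => yc s - B) s _ _ d2 dy).
    - move=> s hs; have hs' : 0 < s < T by lra.
      case: (Rle_dec (yc s) B) => h; first by rewrite powr_neg; lra.
      have q := decay s hs' ltac:(rewrite -ycE //; lra).
      have := powr_ge0 (yc s - B) 1; nra.
  apply: Rnot_lt_le => hlt.
  have z : powr (yc 0 - B) 2 = 0.
    apply: powr_neg; first lra.
    have -> : yc 0 = y0 by exact: (sp_mpow_0 data sol).
    by have := powr_ge0 ((D + 4 / (a * a)) / c2) r; rewrite /B; lra.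
  have : 0 < powr (yc t - B) 2 by apply: powr_gt0; rewrite ycE //; lra.
  lra.
move=> t ht; apply: Rle_trans (bound t ht) _.
have : powr ((D + 4 / (a * a)) / c2) r <= Cf * powr D r + Cg.
  have a4 : 0 <= 4 / (a * a) by apply: Rlt_le; apply: Rdiv_lt_0_compat; lra.
  rewrite /Rdiv powr_mult; [|rewrite -/(Rdiv 4 (a * a)); lra|by apply: Rlt_le; exact: Rinv_0_lt_compat].
  rewrite -/(Rdiv 4 (a * a)).
  have := powr_sum_le (p := r) hD a4 ltac:(lra) => h.
  have := Rmult_le_compat_r _ _ _ (powr_ge0 (/ c2) r) h.
  rewrite /Cg /Cf; lra.
have := powr_ge0 D r; rewrite /B => h1 h2.
have : 0 <= (y0 + Cg) * powr D r by apply: Rmult_le_pos; lra.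
lra.
Qed.

End Integrability.

(** * The estimate of the coupling *)

(** The supremum is taken in the extended reals, and [real] sends both infinities to 0. A member of
    [E] excludes minus infinity, an upper bound excludes plus infinity. *)
Lemma supR_le (E : R -> Prop) B : (exists r, E r) -> (forall r, E r -> r <= B) -> supR E <= B.
Proof.
move=> [r hr] h; rewrite /supR.
have [h1 h2] := Lub_Rbar_correct E.
have := h2 B (fun x hx => h x hx); have := h1 r hr.
by case: (Lub_Rbar E) => [l| |] //=.
Qed.

Lemma supR_ge (E : R -> Prop) B r : (forall r, E r -> r <= B) -> E r -> r <= supR E.
Proof.
move=> h hr; rewrite /supR.
have [h1 h2] := Lub_Rbar_correct E.
have := h2 B (fun x hx => h x hx); have := h1 r hr.
by case: (Lub_Rbar E) => [l| |] //=.
Qed.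

Lemma powr_le_1plus G a b : 0 <= G -> 0 < a <= b -> powr G a <= 1 + powr G b.
Proof.
move=> hG hab; case: (Rle_dec G 1) => h.
  have : powr G a <= powr 1 a by apply: powr_le; lra.
  rewrite powr_base1; have := powr_ge0 G b; lra.
have := @powr_le_exp G a b ltac:(lra) ltac:(lra); lra.
Qed.

Lemma powr_affine_le C G a e : 0 <= C -> 0 <= G -> 0 <= e ->
  powr (C + C * powr G a) e <= powr C e * powr 2 e + powr C e * powr 2 e * powr G (a * e).
Proof.
move=> hC hG he.
have -> : C + C * powr G a = C * (1 + powr G a) by ring.
have g0 := powr_ge0 G a.
rewrite powr_mult //; last lra.
apply: Rle_trans (_ : powr C e * (powr 2 e * (powr 1 e + powr (powr G a) e)) <= _).
  apply: Rmult_le_compat_l; first exact: powr_ge0.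
  by apply: powr_sum_le => //; lra.
rewrite powr_base1 powr_powr //; lra.
Qed.

(** For [d = 0] and [d = 1] the denominator is negative, so that the upper limit of [beta0] is at
    most 0, against [1 <= beta0]. *)
Lemma dimension_ge2 d mu beta0 : 0 < mu < 1 -> 1 <= beta0 ->
  beta0 < INR d * (1 + mu) / (INR d * (1 + mu) - 2) -> 2 <= INR d.
Proof.
move=> hmu hb hlt.
case: d hlt => [|[|d]] hlt; last by rewrite !S_INR; have := pos_INR d; lra.
- rewrite /= Rmult_0_l /Rdiv Rmult_0_l in hlt; lra.
- have hneg : INR 1 * (1 + mu) - 2 < 0 by rewrite /=; lra.
  have : INR 1 * (1 + mu) / (INR 1 * (1 + mu) - 2) < 0.
    rewrite /Rdiv; have := Rinv_lt_0_compat _ hneg; rewrite /= in hneg *; nra.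
  lra.
Qed.

Section Gradient.
Variables (d : nat) (T : R) (H : pt d -> pt d -> R) (uT m0 : pt d -> R) (alpha mu : R)
  (eta : pt d -> R) (kappa0 : R).
Hypothesis data : mfg_data T H uT m0 alpha eta kappa0.
Hypothesis hmu : 0 < mu < 1.

(** The bound [M] depends on the solution and only ensures that the supremum is finite: an infinite
    one would be read as 0 by [supR]. *)
Lemma grad_le_LinfLinf eps u m : is_solution T H uT m0 alpha eta eps u m ->
  forall x t, 0 < t < T -> vnorm (grad u x t) <= LinfLinf_grad T u.
Proof.
move=> sol x t ht.
have SMV := SM_V data sol.
have [M hM] := ext0_bounded (ltac:(sm) : ext0 T (fun x t => sumI (fun i => DD (Some i) u x t * DD (Some i) u x t))).
apply: (@supR_ge _ (sqrt M)); last by exists x, t.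
move=> r [y [s [hs ->]]]; apply: sqrt_le_1_alt.
exact: Rle_trans (Rle_abs _) (hM y s hs).
Qed.

Lemma LinfLinf_grad_ge0 eps u m : is_solution T H uT m0 alpha eta eps u m -> 0 <= LinfLinf_grad T u.
Proof.
move=> sol; apply: Rle_trans (vnorm_ge0 _) (@grad_le_LinfLinf eps u m sol (fun _ => 0) (T / 2) _).
have := T_gt0 data; lra.
Qed.

(** (A8) and (A7) multiply the powers [mu] and [2 + mu] of the gradient; the lower power [mu] that
    remains is dominated by 1 plus the power [2 + 2 * mu]. *)
Lemma drift_bound :
  (exists c1 C1 c2 C2 : R, 0 <= c1 /\ 0 <= C1 /\ 0 <= c2 /\ 0 <= C2 /\
     forall x p, c1 * powr (vnorm p) (2 + mu) + C1 <= H x p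
                 <= c2 * powr (vnorm p) (2 + mu) + C2) ->
  (exists C : R, forall x p,
     vnorm (fun i => dHp i H x p) * vnorm (fun i => dHp i H x p)
       <= C * powr (vnorm p) mu * H x p + C) ->
  exists C, 0 < C /\ forall eps u m, is_solution T H uT m0 alpha eta eps u m ->
    forall x t, 0 < t < T -> sumI (fun i => drift H u i x t * drift H u i x t) <=
      C + C * powr (LinfLinf_grad T u) (2 + 2 * mu).
Proof.
move=> [c1 [C1 [c2 [C2 [_ [_ [hc2 [hC2 A7]]]]]]]] [C8 A8].
exists (Rabs C8 * (c2 + C2 + 1) + 1).
have p8 := Rabs_pos C8.
have q8 : 0 <= Rabs C8 * (c2 + C2 + 1) by apply: Rmult_le_pos; lra.
split; first lra.
move=> eps u m sol x t ht.
set G := LinfLinf_grad T u.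
have G0 : 0 <= G := @LinfLinf_grad_ge0 eps u m sol.
pose v := vnorm (grad u x t).
have hv : v <= G := @grad_le_LinfLinf eps u m sol x t ht.
have v0 : 0 <= v := vnorm_ge0 _.
rewrite (sumI_ext (g := fun i => dHp i H x (grad u x t) * dHp i H x (grad u x t))); last by move=> i; rewrite driftE.
rewrite -(vnorm_sqr (fun i => dHp i H x (grad u x t))).
apply: Rle_trans (A8 x (grad u x t)) _.
have h1 := H_ge1 data x (grad u x t).
have [_ h2] := A7 x (grad u x t).
rewrite -/v in h2 *; set h := H _ _ in h1 h2 *.
have g1 : powr v mu <= powr G mu by apply: powr_le; lra.
have g2 : powr v (2 + mu) <= powr G (2 + mu) by apply: powr_le; lra.
have g3 : powr G mu * powr G (2 + mu) = powr G (2 + 2 * mu).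
  by rewrite -powr_plus0; [congr powr; ring|lra|lra].
have g4 : powr G mu <= 1 + powr G (2 + 2 * mu) by apply: powr_le_1plus => //; lra.
have pv := powr_ge0 v mu; have pG := powr_ge0 G mu; have pG2 := powr_ge0 G (2 + mu).
set X := powr G (2 + 2 * mu) in g3 g4 *.
have X0 : 0 <= X := powr_ge0 _ _.
have k1 : powr v mu * h <= (c2 + C2) * (1 + X).
  apply: Rle_trans (_ : powr G mu * (c2 * powr G (2 + mu) + C2) <= _).
    apply: Rmult_le_compat => //; first lra.
    by apply: Rle_trans h2 _; apply: Rplus_le_compat_r; apply: Rmult_le_compat_l.
  rewrite Rmult_plus_distr_l (_ : powr G mu * (c2 * powr G (2 + mu)) = c2 * X); last by rewrite -g3; ring.
  have : powr G mu * C2 <= (1 + X) * C2 by apply: Rmult_le_compat_r.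
  lra.
have k0 : 0 <= powr v mu * h by apply: Rmult_le_pos; lra.
have k2 : C8 * powr v mu * h <= Rabs C8 * ((c2 + C2) * (1 + X)).
  apply: Rle_trans (_ : Rabs C8 * (powr v mu * h) <= _); last by apply: Rmult_le_compat_l.
  by rewrite Rmult_assoc; apply: Rmult_le_compat_r => //; exact: Rle_abs.
have := Rle_abs C8.
have : 0 <= Rabs C8 * X by exact: Rmult_le_pos.
lra.
Qed.

End Gradient.

Theorem theorem2 (d : nat) (T : R) (H : pt d -> pt d -> R) (uT m0 : pt d -> R)
  (alpha mu : R) (eta : pt d -> R) (theta ups beta0 : R) :
  0 < T ->
  (* (A1) *)
  smooth (Hjoint H) ->
  (forall p, periodic (fun x => H x p)) ->
  (forall x (p q : pt d) (lam : R), p <> q -> 0 < lam < 1 ->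
     H x (fun i => lam * p i + (1 - lam) * q i) < lam * H x p + (1 - lam) * H x q) ->
  (forall x (M : R), exists Rad : R, forall p, Rad < vnorm p -> M * vnorm p < H x p) ->
  (forall x p, 1 <= H x p) ->
  (* (A2) *)
  smooth uT -> periodic uT -> smooth m0 -> periodic m0 ->
  (forall x, 0 <= m0 x) -> torint m0 = 1 ->
  (* (A3) *)
  (exists c C : R, 0 < c /\ 0 < C /\
     forall x p, sumI (fun i => dHp i H x p * p i) - H x p >= c * H x p - C) ->
  (* (A4) *)
  0 < alpha ->
  (* (A5) *)
  (exists C : R, forall x p,
     vnorm (fun i => dHx i H x p) <= C * H x p + C /\
     mnorm (fun i j => dHx i (dHx j H) x p) <= C * H x p + C) ->
  (forall delta : R, 0 < delta -> exists Cd : R, forall M : mat d, msym M -> forall x p,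
     mtr (mmul (fun i j => dHp i (dHx j H) x p) M)
       <= delta * mtr (mmul (fun i j => dHp i (dHp j H) x p) (mmul M M)) + Cd * H x p) ->
  (* (A6) *)
  (exists kappa0 : R, 0 < kappa0 /\ forall x, kappa0 <= m0 x) ->
  (* (A7) *)
  0 < mu < 1 ->
  (exists c1 C1 c2 C2 : R, 0 <= c1 /\ 0 <= C1 /\ 0 <= c2 /\ 0 <= C2 /\
     forall x p, c1 * powr (vnorm p) (2 + mu) + C1 <= H x p
                 <= c2 * powr (vnorm p) (2 + mu) + C2) ->
  (* (A8) *)
  (exists C : R, forall x p,
     vnorm (fun i => dHp i H x p) * vnorm (fun i => dHp i H x p)
       <= C * powr (vnorm p) mu * H x p + C) ->
  (* (A9) *)
  (exists C : R, forall x p,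
     mnorm (fun i j => dHx i (dHp j H) x p) * mnorm (fun i j => dHx i (dHp j H) x p)
       <= C * Rpower (H x p) ((2 + 2 * mu) / (2 + mu))) ->
  (exists C : R, forall M : mat d, msym M -> forall x p,
     mnorm (mmul (fun i j => dHp i (dHp j H) x p) M)
       * mnorm (mmul (fun i j => dHp i (dHp j H) x p) M)
     <= C * Rpower (H x p) (mu / (2 + mu))
          * mtr (mmul (fun i j => dHp i (dHp j H) x p) (mmul M M))) ->
  (* mollifier *)
  is_mollifier eta ->
  (* parameters *)
  1 < theta -> 0 <= ups <= 1 ->
  1 <= beta0 -> beta0 < INR d * (1 + mu) / (INR d * (1 + mu) - 2) ->
  let beta := theta * beta0 / (theta + ups - theta * ups) in
  let r := (INR d * (theta - 1) + 2) / 2 in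
  let p := beta / alpha in
  1 < p ->
  exists C : R, forall (eps : R) (u m : pt d -> R -> R),
    0 < eps -> is_solution T H uT m0 alpha eta eps u m ->
    LinfLp T p (geps eta eps alpha m)
      <= C + C * powr (LinfLinf_grad T u)
                      ((2 + 2 * mu) * r * ups * alpha / (theta * beta0)).
Proof.
move=> hT hHs hHp hconv hcoer hH1 huTs huTp hm0s hm0p hm00 hmass A3 halpha A5a A5b
  [kappa0 [hk0 hk]] hmu A7 A8 A9a A9b heta hth hups hb1 hb2 beta r p hp.
have data : mfg_data T H uT m0 alpha eta kappa0 by split.
have hd := dimension_ge2 hmu hb1 hb2.
have hSL := superlinear hHs hHp hconv hcoer hH1.
have [K [K0 hK]] := density_bound data hd hmu A3 hSL A5a A5b A9a A9b hb1 hb2.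
have [Ch [Ch0 hCh]] := higher_density data hd hmu hth hb1 K0.
have [Cb [Cb0 hCb]] := drift_bound data hmu A7 A8.
pose w := theta + ups - theta * ups.
have w1 : 1 <= w <= theta by rewrite /w; split; nra.
(* The weight with which [beta] is the average of [theta * beta0] and [beta0], hence the Hölder
   weight between the integrals of these powers of [m]. *)
pose a := ups / w.
have a01 : 0 <= a <= 1.
  split; first by apply: Rdiv_le_0_compat; lra.
  by apply/Rle_div_l; [lra|rewrite /w; nra].
have betaE : beta = theta * beta0 / w by [].
have beta_conv : beta = theta * beta0 * a + beta0 * (1 - a).
  by rewrite betaE /a; apply: (Rmult_eq_reg_r w); [|lra]; rewrite /w; field; rewrite -/w; lra.
have beta1 : 1 <= beta.
  rewrite beta_conv (_ : _ + _ = beta0 + beta0 * ((theta - 1) * a)); last by ring.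
  have : 0 <= beta0 * ((theta - 1) * a) by apply: Rmult_le_pos; [lra|apply: Rmult_le_pos; lra].
  lra.
have ap : alpha * p = beta by rewrite /p; field; lra.
have r0 : 0 <= r by rewrite /r; nra.
(* This is [a / p], the power left on the integral of [m^(theta * beta0)] after interpolation and
   the root of order [p]; the exponent to be reached is [(2 + 2 * mu) * r * e]. *)
pose e := ups * alpha / (theta * beta0).
have tb0 : 0 < theta * beta0 by nra.
have e0 : 0 <= e by apply: Rdiv_le_0_compat => //; nra.
have ip : / p = alpha / beta by rewrite /p; field; lra.
have aip : a * / p = e.
  rewrite ip betaE /a /e; field; lra.
pose D1 := Ch + Ch * (powr Cb r * powr 2 r).
have q1 : 0 <= powr Cb r * powr 2 r by apply: Rmult_le_pos; exact: powr_ge0.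
have D10 : 0 < D1 by rewrite /D1; have := Rmult_le_pos _ _ (Rlt_le _ _ Ch0) q1; lra.
pose C := powr K ((1 - a) * / p) * (powr D1 e * powr 2 e).
exists C => eps u m heps sol.
set G := LinfLinf_grad T u.
have G0 : 0 <= G := LinfLinf_grad_ge0 data sol.
have -> : (2 + 2 * mu) * r * ups * alpha / (theta * beta0) = (2 + 2 * mu) * r * e.
  by rewrite /e; field; lra.
apply: supR_le; first by exists (Lpnorm p (fun x => geps eta eps alpha m x (T / 2))), (T / 2); split => //; lra.
move=> _ [t [ht ->]].
have SMmp := SM_mpow data sol.
have ema c : ext0 T (mpow m c) by exact: SM_ext0 (SMmp c 0%N).
have mp x : 0 < m x t by exact: (m_gt0 data sol x ht).
have yK : sp (mpow m beta0) t <= K by exact: hK sol t ht.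
pose Y := D1 + D1 * powr G ((2 + 2 * mu) * r).
have gY := powr_ge0 G ((2 + 2 * mu) * r).
have Y0 : 0 < Y by rewrite /Y; have := Rmult_le_pos _ _ (Rlt_le _ _ D10) gY; lra.
have yY : sp (mpow m (theta * beta0)) t <= Y.
  pose D := Cb + Cb * powr G (2 + 2 * mu).
  have gD := powr_ge0 G (2 + 2 * mu).
  have D0 : 0 <= D by rewrite /D; have := Rmult_le_pos _ _ (Rlt_le _ _ Cb0) gD; lra.
  have h1 := hCh eps u m sol (hK eps u m sol) D D0 (hCb eps u m sol) t ht.
  rewrite -/r in h1; apply: Rle_trans h1 _.
  have h2 := @powr_affine_le Cb G (2 + 2 * mu) r (Rlt_le _ _ Cb0) G0 r0.
  rewrite -/D in h2.
  have := Rmult_le_compat_l _ _ _ (Rlt_le _ _ Ch0) h2.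
  rewrite /Y /D1; have : 0 <= Ch * powr G ((2 + 2 * mu) * r) by apply: Rmult_le_pos; lra.
  lra.
have interp : sp (mpow m beta) t <= powr Y a * powr K (1 - a).
  (* [slice_holder] excludes the ends [a = 0] and [a = 1], that is [ups = 0] and [ups = 1]; there
     [beta] is one of the two exponents. *)
  case: (a01) => -[a0|a0] a1'; last first.
    rewrite -a0 powr_exp0 Rmult_1_l Rminus_0_r powr_1; last lra.
    by rewrite (_ : beta = beta0) //; rewrite beta_conv -a0; ring.
  case: a1' => a1'; last first.
    rewrite a1' Rminus_diag powr_exp0 Rmult_1_r powr_1; last lra.
    by rewrite (_ : beta = theta * beta0) //; rewrite beta_conv a1'; ring.
  apply: (@slice_holder d (fun x => mpow m (theta * beta0) x t) (fun x => mpow m beta0 x t)) => //.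
  - exact: ext0_slice (ema _) ht.
  - exact: ext0_slice (ema _) ht.
  - exact: ext0_slice (ema _) ht.
  - by move=> z; exact: powr_ge0.
  - by move=> z; exact: powr_ge0.
  - move=> z; right; rewrite /mpow !powr_powr; try by (apply: Rlt_le).
    by rewrite -powr_plus // beta_conv.
rewrite /Lpnorm.
have g0 x : 0 <= geps eta eps alpha m x t := g_ge0 data sol x ht.
have -> : (fun x => powr (Rabs (geps eta eps alpha m x t)) p) = fun x => powr (geps eta eps alpha m x t) p.
  by apply: functional_extensionality => x; rewrite Rabs_pos_eq.
have hg := sp_g_powr data sol (p := p) (t := t) ltac:(lra) ltac:(rewrite ap; lra) ht.
rewrite ap in hg.
have ip0 : 0 <= / p by apply: Rlt_le; apply: Rinv_0_lt_compat; lra.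
apply: Rle_trans (_ : powr (powr Y a * powr K (1 - a)) (/ p) <= _).
  by apply: powr_le => //; apply: Rle_trans hg interp.
rewrite powr_mult; [|exact: powr_ge0|exact: powr_ge0].
rewrite !powr_powr; [|lra|lra]; rewrite aip Rmult_comm.
have h3 := @powr_affine_le D1 G ((2 + 2 * mu) * r) e (Rlt_le _ _ D10) G0 e0.
have := Rmult_le_compat_l _ _ _ (powr_ge0 K ((1 - a) * / p)) h3.
rewrite -/Y /C; lra.
Qed.
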